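(* Let $p\in\{2,3,5,7,11,13\}$ and let $MC_n$ denote the class in $BP^*\llbracket\xi\rrbracket/(\langle p\rangle\xi)$ defined in the context, written in its normal form (the unique remainder $s=\sum_i s_i\xi^i$ whose polynomial coefficients $s_i\in\mathbb{Z}_{(p)}[v_1,v_2,\ldots]$ have all integer coefficients in $\{0,\ldots,p-1\}$). Then: (1) for $p=2$: $MC_2=(v_1^6+v_2^2)\xi^6+(\text{terms in }\xi^{\ge 7})$ and $MC_4=v_1^4v_2^2\xi^{10}+(\text{terms in }\xi^{\ge11})$; (2) for $p=3$: $MC_4=2v_1^9\xi^{22}+(\text{terms in }\xi^{\ge23})$; (3) for $p=5$: $MC_8=3v_1^{16}\xi^{88}+(\text{higher order terms})$; (4) for $p=7$: $MC_{12}=4v_1^{22}\xi^{192}+(\text{higher order terms})$; (5) for $p=11$: $MC_{20}=9v_1^{34}\xi^{520}+(\text{higher order terms})$; (6) for $p=13$: $MC_{24}=11v_1^{40}\xi^{744}+(\text{higher order terms})$.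
   Context: $BP^*=\mathbb{Z}_{(p)}[v_1,v_2,\ldots]$ with Hazewinkel generators $v_i$ (of cohomological degree $-2(p^i-1)$); $\xi$ has degree $2$. The $BP$ formal group law is $F(x,y)=\exp(\log x+\log y)$ where $\log(x)=\sum_{k\ge0}\ell_kx^{p^k}$, $\ell_0=1$, and $p\,\ell_k=\sum_{i=0}^{k-1}\ell_i v_{k-i}^{p^i}$; $F$ has coefficients in $BP^*$. Write $[i]\xi$ for the $i$-fold formal sum of $\xi$ and $\langle p\rangle\xi=[p]\xi/\xi\in BP^*\llbracket\xi\rrbracket$. Define $a_i=a_i(\xi)\in BP^*\llbracket\xi\rrbracket$ by $\prod_{i=0}^{p-1}([i]\xi+_F x)=\sum_{i\ge0}a_ix^{i+1}$ in $BP^*\llbracket\xi,x\rrbracket$. Let $c_j=p^k\ell_k$ if $j=p^k-1$ for some $k\ge0$ and $c_j=0$ otherwise (these are the images $r_*[\mathbb{C}P^j]$ under Quillen's map $r\colon MU_{(p)}\to BP$). For $n\ge0$ set \[MC_n(\xi)=\sum_{k=0}^n c_{n-k}\cdot\Big(a_0^{2n+1}\big(\textstyle\sum_{i\ge0}a_iz^i\big)^{-(n+1)}\Big)[z^k],\] where $S(z)[z^k]$ denotes the coefficient of $z^k$ (for $k\le n$ this coefficient is a polynomial in the $a_i$), regarded as an element of $BP^*\llbracket\xi\rrbracket/(\langle p\rangle\xi)$. (This equals $r_*q_*\chi^{2n}P_{C_p,MU}[\mathbb{C}P^n]$, where $P_{C_p,MU}$ is tom Dieck's Steenrod power operation, $\chi=\prod_{i=1}^{p-1}[i]\xi$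 and $q_*$ reduces modulo $\langle p\rangle\xi$.) Every element of $BP^*\llbracket\xi\rrbracket$ is congruent modulo $\langle p\rangle\xi$ to a unique series whose coefficients are polynomials in the $v_i$ with integer coefficients in $\{0,\dots,p-1\}$; ''$MC_n=c\,\xi^m+$ higher order terms'' means this normal form has lowest-order term $c\,\xi^m$. *)

(* Defs.v *)
From HB Require Import structures.
From mathcomp Require Import all_boot all_order all_algebra.
From mathcomp Require Import monalg.

Set Implicit Arguments.
Unset Strict Implicit.
Unset Printing Implicit Defensive.

Import Order.TTheory GRing.Theory Num.Theory.
Local Open Scope ring_scope.

(* Coefficient ring.  BP^* ⊗ Q = Q[v_1, v_2, ...] is modelled as the
   monoid algebra of commutative monomials in countably many variables
   indexed by nat; the variable with index i stands for v_(i+1).       *)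
Definition BPQ : Type := {malg rat[{cmonom nat}]}.

(* the Hazewinkel generator v_i (i >= 1) *)
Definition vv (i : nat) : BPQ := << ucm i.-1 >>.

Definition plocal (p : nat) (r : rat) : bool := coprime `|denq r|%N p.

Definition inBP (p : nat) (r : BPQ) : Prop := forall m, plocal p (r@_m).

Definition digitpoly (p : nat) (r : BPQ) : Prop :=
  forall m, exists2 d : nat, (d < p)%N & r@_m = d%:R.

Definition series := nat -> BPQ.
Definition bseries := nat -> nat -> BPQ.

Definition sone : series := fun n => (n == 0%N)%:R.
Definition svar : series := fun n => (n == 1%N)%:R.
Definition smul (f g : series) : series :=
  fun n => \sum_(i < n.+1) f i * g (n - i)%N.
Definition spow (f : series) (k : nat) : series := iter k (smul f) sone.
Definition sadd (f g : series) : series := fun n => f n + g n.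
Definition sscale (c : BPQ) (f : series) : series := fun n => c * f n.

Definition bone : bseries := fun a b => ((a == 0%N) && (b == 0%N))%:R.
Definition bmul (f g : bseries) : bseries :=
  fun a b => \sum_(i < a.+1) \sum_(j < b.+1) f i j * g (a - i)%N (b - j)%N.
Definition bpow (f : bseries) (k : nat) : bseries := iter k (bmul f) bone.

(* The BP logarithm  log x = sum_k ell_k x^(p^k),
   ell_0 = 1,  p ell_k = sum_(i<k) ell_i v_(k-i)^(p^i).               *)
Definition ell_step (p : nat) (s : seq BPQ) : seq BPQ :=
  let k := size s in
  rcons s ((p%:R)^-1 *: \sum_(i < k) s`_i * vv (k - i)%N ^+ (p ^ i)).
Definition ell (p k : nat) : BPQ := (iter k (ell_step p) [:: 1])`_k.

Definition logc (p j : nat) : BPQ :=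
  \sum_(k < j.+1) (j == p ^ k)%N%:R * ell p k.

(* exp = compositional inverse of log: exp_0 = 0 and, since log(exp y) = y,
   exp_n = [n = 1] - sum_(2 <= j <= n) logc_j [y^n](exp y)^j
   (the right-hand side only involves exp_1, ..., exp_(n-1)).         *)
Definition exp_step (p : nat) (s : seq BPQ) : seq BPQ :=
  let n := size s in
  rcons s ((n == 1%N)%:R -
           \sum_(2 <= j < n.+1) logc p j * spow (fun i => s`_i) j n).
Definition expc (p n : nat) : BPQ := (iter n.+1 (exp_step p) [::])`_n.

(* The formal group law F(x,y) = exp(log x + log y); fgl p j k is the
   coefficient of x^j y^k. *)
Definition logsum (p : nat) : bseries :=
  fun j k => (k == 0%N)%:R * logc p j + (j == 0%N)%:R * logc p k.
Definition fgl (p : nat) : bseries :=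
  fun j k => \sum_(m < (j + k).+1) expc p m * bpow (logsum p) m j k.

(* a +_F b, for series a, b in ξ without constant term *)
Definition fadd (p : nat) (a b : series) : series :=
  fun n => \sum_(j < n.+1) \sum_(k < n.+1) fgl p j k * smul (spow a j) (spow b k) n.

Definition fmul (p i : nat) : series := iter i (fun a => fadd p a svar) (fun _ => 0).

(* <p>ξ = [p]ξ / ξ *)
Definition anglep (p : nat) : series := fun n => fmul p p n.+1.

(* [i]ξ +_F x, as a series in (ξ, x) (a has no constant term) *)
Definition faddx (p : nat) (a : series) : bseries :=
  fun n b => \sum_(j < n.+1) fgl p j b * spow a j n.

(* prod_(i=0)^(p-1) ([i]ξ +_F x) = sum_i a_i x^(i+1) *)
Definition prodP (p : nat) : bseries :=
  \big[bmul/bone]_(i < p) faddx p (fmul p i).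
Definition acoef (p i : nat) : series := fun n => prodP p n i.+1.

Definition cc (p j : nat) : BPQ :=
  \sum_(k < j.+2) (j.+1 == p ^ k)%N%:R * ((p ^ k)%:R * ell p k).

Definition wser (p : nat) : bseries :=
  fun n i => if (0 < i)%N then acoef p i n else 0.

(* (a_0^(2n+1) (sum_i a_i z^i)^(-(n+1)))[z^k], for k <= n, written as the
   polynomial in the a_i obtained by expanding (a_0 + w)^(-(n+1)):
   sum_(j<=k) (-1)^j C(n+j,j) a_0^(n-j) [z^k] w^j                      *)
Definition Scoef (p n k : nat) : series :=
  fun m => \sum_(j < k.+1)
     ((-1) ^+ j * 'C(n + j, j)%:R) *
     smul (spow (acoef p 0) (n - j)) (fun q => bpow (wser p) j q k) m.

Definition MC (p n : nat) : series :=
  fun m => \sum_(k < n.+1) cc p (n - k) * Scoef p n k m.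

Definition congp (p : nat) (f g : series) : Prop :=
  exists2 t : series, (forall n, inBP p (t n)) &
    forall n, f n - g n = smul (anglep p) t n.

Definition normal_form (p : nat) (x s : series) : Prop :=
  (forall n, digitpoly p (s n)) /\ congp p s x.

Definition NF_lowest (p : nat) (x : series) (c : BPQ) (m : nat) : Prop :=
  (exists s, normal_form p x s) /\
  forall s, normal_form p x s -> (forall i, (i < m)%N -> s i = 0) /\ s m = c.

(* Main.v *)
(** Put [lambda_k = ell_k xi^(p^k - 1)] and [[i]xi +_F x = xi * eta_i].  Modulo
    [<p>xi] and up to high filtration, taking logarithms shows that all the
    [eta_i] are roots of one equation whose coefficients only involve
    [eps = - lambda_2] and [phi = - lambda_3], because [lambda_1] is eliminated
    by the relation [<p>xi = 0].  Hence [prod_i eta_i], and with it the class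
    [MC_n] divided by a power of [xi], is an explicit polynomial in [eps] and
    [phi], which reflected polynomial arithmetic computes.

    The filtration gives [p] the weight [p - 1]: an element [x] has weight [k]
    when [p^a x] lies in [(<p>xi, xi^(k + a (p - 1)))] for some [a].  Since [p]
    is [- v_1 xi^(p - 1)] up to higher terms and [v_1] is not a zero divisor
    modulo [p], an integral element of weight [k] lies in [(<p>xi, xi^k)], so
    that leading terms can be computed after inverting [p].

    The coefficients of [F] and [<p>xi] are integral because [v_i |-> v_i^p]
    lifts the Frobenius endomorphism (functional equation lemma). *)

From Stdlib Require Import ZArith.
Require Import Defs.
From HB Require Import structures.
From mathcomp Require Import all_boot all_order all_algebra.
From mathcomp Require Import monalg boolp.
From mathcomp Require Import ring zify ssrZ.

Set Implicit Arguments.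
Unset Strict Implicit.
Unset Printing Implicit Defensive.

Import Order.TTheory GRing.Theory Num.Theory.
Local Open Scope ring_scope.

(** * Power series *)

Definition ps (R : Type) := nat -> R.

Section PowerSeries.
Variable R : comNzRingType.
Implicit Types f g h : ps R.

HB.instance Definition _ := Choice.copy (ps R) (nat -> R).

Definition ps_add f g : ps R := fun n => f n + g n.
Definition ps_opp f : ps R := fun n => - f n.
Definition ps_mul f g : ps R := fun n => \sum_(i < n.+1) f i * g (n - i)%N.

Fact ps_addA : associative ps_add.
Proof. by move=> f g h; apply/funext=> n; exact: addrA. Qed.
Fact ps_addC : commutative ps_add.
Proof. by move=> f g; apply/funext=> n; exact: addrC. Qed.
Fact ps_add0 : left_id (fun=> 0) ps_add.
Proof. by move=> f; apply/funext=> n; exact: add0r. Qed.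
Fact ps_addN : left_inverse (fun=> 0) ps_opp ps_add.
Proof. by move=> f; apply/funext=> n; exact: addNr. Qed.

HB.instance Definition _ :=
  GRing.isZmodule.Build (ps R) ps_addA ps_addC ps_add0 ps_addN.

Definition ps_trunc N f : {poly R} := \poly_(i < N) f i.

Lemma coef_truncM N f g n : (n < N)%N ->
  (ps_trunc N f * ps_trunc N g)`_n = ps_mul f g n.
Proof.
move=> nN; rewrite coefM; apply: eq_bigr => i _; rewrite !coef_poly.
by rewrite !(leq_ltn_trans _ nN) ?leq_subr // -ltnS.
Qed.

Lemma coefM_congr N (P P' S : {poly R}) n : (n < N)%N ->
  (forall i, (i < N)%N -> P`_i = P'`_i) -> (P * S)`_n = (P' * S)`_n.
Proof.
move=> nN e; rewrite !coefM; apply: eq_bigr => i _.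
by rewrite e // (leq_ltn_trans _ nN) // -ltnS.
Qed.

Fact ps_mulC : commutative ps_mul.
Proof.
by move=> f g; apply/funext=> n; rewrite -!(@coef_truncM n.+1) // mulrC.
Qed.

Fact ps_mulA : associative ps_mul.
Proof.
move=> f g h; apply/funext=> n; rewrite -!(@coef_truncM n.+1) //.
have e f1 g1 i : (i < n.+1)%N ->
    (ps_trunc n.+1 (ps_mul f1 g1))`_i = (ps_trunc n.+1 f1 * ps_trunc n.+1 g1)`_i.
  by move=> iN; rewrite coef_truncM // coef_poly iN.
by rewrite mulrC !(coefM_congr _ (ltnSn n) (e _ _)) mulrC mulrA.
Qed.

Definition ps_one : ps R := fun n => (n == 0%N)%:R.

Fact ps_mul1 : left_id ps_one ps_mul.
Proof.
move=> f; apply/funext=> n; rewrite /ps_mul big_ord_recl /= /ps_one eqxx mul1r subn0.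
by rewrite big1 ?addr0 // => i _; rewrite mul0r.
Qed.

Fact ps_mulDl : left_distributive ps_mul ps_add.
Proof.
move=> f g h; apply/funext=> n; rewrite /ps_mul /ps_add -big_split.
by apply: eq_bigr => i _; rewrite mulrDl.
Qed.

Fact ps_one_neq0 : ps_one != 0.
Proof. by apply/eqP=> /(congr1 (@^~ 0%N)) /eqP; rewrite /ps_one oner_eq0. Qed.

HB.instance Definition _ := GRing.Zmodule_isComNzRing.Build (ps R)
  ps_mulA ps_mulC ps_mul1 ps_mulDl ps_one_neq0.

Lemma psD f g n : (f + g) n = f n + g n. Proof. by []. Qed.
Lemma psN f n : (- f) n = - f n. Proof. by []. Qed.
Lemma psB f g n : (f - g) n = f n - g n. Proof. by []. Qed.
Lemma ps0 n : (0 : ps R) n = 0. Proof. by []. Qed.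
Lemma ps1 n : (1 : ps R) n = (n == 0%N)%:R. Proof. by []. Qed.
Lemma psM f g n : (f * g) n = \sum_(i < n.+1) f i * g (n - i)%N.
Proof. by []. Qed.

Lemma ps_sum (I : Type) (r : seq I) (P : pred I) (F : I -> ps R) n :
  (\sum_(i <- r | P i) F i) n = \sum_(i <- r | P i) F i n.
Proof. by elim/big_rec2: _ => // i x y _ <-. Qed.

Lemma psMn f k n : (f *+ k) n = f n *+ k.
Proof. by elim: k => // k IH; rewrite !mulrS psD IH. Qed.

Lemma ps_nat k n : (k%:R : ps R) n = (if n == 0%N then k%:R else 0).
Proof. by rewrite psMn ps1; case: (n == 0%N); rewrite // mul0rn. Qed.

Definition psC (c : R) : ps R := fun n => if n == 0%N then c else 0.

Lemma psCM c f n : (psC c * f) n = c * f n.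
Proof.
rewrite psM big_ord_recl /= /psC /= subn0 big1 ?addr0 // => i _.
by rewrite mul0r.
Qed.

Fact psC_is_zmod_morphism : zmod_morphism psC.
Proof.
by move=> a b; apply/funext=> n; rewrite psB /psC; case: ifP; rewrite // subr0.
Qed.

Fact psC_is_monoid_morphism : monoid_morphism psC.
Proof.
split=> [|a b]; apply/funext=> n; first by rewrite ps1 /psC; case: ifP.
by rewrite psCM /psC; case: ifP; rewrite // mulr0.
Qed.

HB.instance Definition _ :=
  GRing.isZmodMorphism.Build R (ps R) psC psC_is_zmod_morphism.
HB.instance Definition _ :=
  GRing.isMonoidMorphism.Build R (ps R) psC psC_is_monoid_morphism.

Definition psX : ps R := fun n => (n == 1%N)%:R.

Lemma psXM f n : (psX * f) n = if n is n'.+1 then f n' else 0.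
Proof.
rewrite psM /psX; case: n => [|n]; first by rewrite big_ord1 mul0r.
rewrite big_ord_recl mul0r add0r big_ord_recl mul1r big1 ?addr0 //=.
  by rewrite /bump /= subn1.
by move=> i _; rewrite mul0r.
Qed.

Lemma psXnM k f n : (psX ^+ k * f) n = if (n < k)%N then 0 else f (n - k)%N.
Proof.
elim: k n => [|k IH] n; first by rewrite expr0 mul1r subn0.
by rewrite exprS -mulrA psXM; case: n => [|n] //; rewrite IH.
Qed.

Lemma psXn k n : (psX ^+ k) n = (n == k)%:R.
Proof.
rewrite -[_ ^+ _]mulr1 psXnM ps1 subn_eq0.
by case: ltngtP.
Qed.

End PowerSeries.

Arguments psX {R}.

(** * The frozen constructions over an arbitrary ring *)

(* The definitions are those of [Defs], with BPQ, the generators v_i and the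
   division by p replaced by abstract data: unification on the concrete type
   {malg rat[{cmonom nat}]} is prohibitively slow.  At A := BPQ they are
   convertible to the originals. *)
Section Generic.
Variables (A : comNzRingType) (p : nat) (divp : A -> A) (v : nat -> A).

Definition gspow (f : ps A) k : ps A := iter k (@ps_mul A f) (@ps_one A).
Definition gbone : ps (ps A) := fun a b => ((a == 0%N) && (b == 0%N))%:R.
Definition gbmul (f g : ps (ps A)) : ps (ps A) :=
  fun a b => \sum_(i < a.+1) \sum_(j < b.+1) f i j * g (a - i)%N (b - j)%N.
Definition gbpow (f : ps (ps A)) k : ps (ps A) := iter k (gbmul f) gbone.

Definition gell_step (s : seq A) : seq A :=
  let k := size s in
  rcons s (divp (\sum_(i < k) s`_i * v (k - i)%N ^+ (p ^ i))).
Definition gell k : A := (iter k gell_step [:: 1])`_k.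
Definition glogc j : A := \sum_(k < j.+1) (j == p ^ k)%N%:R * gell k.
Definition gexp_step (s : seq A) : seq A :=
  let n := size s in
  rcons s ((n == 1%N)%:R -
           \sum_(2 <= j < n.+1) glogc j * gspow (fun i => s`_i) j n).
Definition gexpc n : A := (iter n.+1 gexp_step [::])`_n.
Definition glogsum : ps (ps A) :=
  fun j k => (k == 0%N)%:R * glogc j + (j == 0%N)%:R * glogc k.
Definition gfgl : ps (ps A) :=
  fun j k => \sum_(m < (j + k).+1) gexpc m * gbpow glogsum m j k.
Definition gfadd (a b : ps A) : ps A :=
  fun n => \sum_(j < n.+1) \sum_(k < n.+1)
     gfgl j k * @ps_mul A (gspow a j) (gspow b k) n.
Definition gfmul i : ps A := iter i (fun a => gfadd a psX) (fun=> 0).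
Definition ganglep : ps A := fun n => gfmul p n.+1.
Definition gfaddx (a : ps A) : ps (ps A) :=
  fun n b => \sum_(j < n.+1) gfgl j b * gspow a j n.
Definition gprodP : ps (ps A) := \big[gbmul/gbone]_(i < p) gfaddx (gfmul i).
Definition gacoef i : ps A := fun n => gprodP n i.+1.
Definition gcc j : A :=
  \sum_(k < j.+2) (j.+1 == p ^ k)%N%:R * ((p ^ k)%:R * gell k).
Definition gwser : ps (ps A) :=
  fun n i => if (0 < i)%N then gacoef i n else 0.
Definition gScoef n k : ps A :=
  fun m => \sum_(j < k.+1)
     ((-1) ^+ j * 'C(n + j, j)%:R) *
     @ps_mul A (gspow (gacoef 0) (n - j)) (fun q => gbpow gwser j q k) m.
Definition gMC n : ps A :=
  fun m => \sum_(k < n.+1) gcc (n - k) * gScoef n k m.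

Lemma gspowE (f : ps A) k : gspow f k = f ^+ k.
Proof. by elim: k => //= k IH; rewrite exprS -IH. Qed.

Lemma gbmulE f g : gbmul f g = f * g.
Proof.
by apply/funext=> a; apply/funext=> b; rewrite psM ps_sum; apply: eq_bigr.
Qed.

Lemma gboneE : gbone = 1.
Proof.
apply/funext=> a; apply/funext=> b; rewrite ps1 /gbone.
by case: (a == 0%N).
Qed.

Lemma gbpowE f k : gbpow f k = f ^+ k.
Proof.
elim: k => [|k IH]; first exact: gboneE.
by rewrite exprS -IH -gbmulE.
Qed.

End Generic.

Section Instance.
Variable p : nat.
Let divp (x : BPQ) : BPQ := (p%:R)^-1 *: x.

Lemma anglepE : anglep p = ganglep p divp vv. Proof. by []. Qed.
Lemma MCE n : MC p n = gMC p divp vv n. Proof. by []. Qed.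
End Instance.

(** * Filtrations by order *)

Record filtration (S : comNzRingType) := Filtration {
  fil :> nat -> S -> Prop;
  filT : forall x, fil 0 x;
  filW : forall a b x, (a <= b)%N -> fil b x -> fil a x;
  fil0 : forall N, fil N 0;
  filD : forall N x y, fil N x -> fil N y -> fil N (x + y);
  filM : forall a b x y, fil a x -> fil b y -> fil (a + b)%N (x * y) }.

Section FiltrationTheory.
Variables (S : comNzRingType) (F : filtration S).
Implicit Types x y z : S.

Lemma filMl N c x : F N x -> F N (c * x).
Proof. by move=> h; rewrite -[N]add0n; apply: filM => //; apply: filT. Qed.

Lemma filMr N c x : F N x -> F N (x * c).
Proof. by rewrite mulrC; exact: filMl. Qed.

Lemma filN N x : F N x -> F N (- x).
Proof. by rewrite -mulN1r; exact: filMl. Qed.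

Lemma filB N x y : F N x -> F N y -> F N (x - y).
Proof. by move=> hx hy; apply: filD => //; apply: filN. Qed.

Lemma fil_sum N (I : Type) (r : seq I) (P : pred I) (G : I -> S) :
  (forall i, P i -> F N (G i)) -> F N (\sum_(i <- r | P i) G i).
Proof.
move=> h; elim/big_rec: _ => [|i x Pi hx]; first exact: fil0.
by apply: filD => //; apply: h.
Qed.

Lemma filX a x k : F a x -> F (a * k)%N (x ^+ k).
Proof.
move=> hx; elim: k => [|k IH]; first by rewrite muln0; apply: filT.
by rewrite exprS mulnS; apply: filM.
Qed.

Lemma filX1 x k : F 1%N x -> F k (x ^+ k).
Proof. by move/(filX k); rewrite mul1n. Qed.

Lemma fil_trans N x y z : F N (x - y) -> F N (y - z) -> F N (x - z).
Proof. by move=> h1 h2; rewrite -(subrK y x) -addrA; apply: filD. Qed.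

Lemma fil_sym N x y : F N (x - y) -> F N (y - x).
Proof. by move=> h; rewrite -opprB; apply: filN. Qed.

Lemma filMc N x x' y y' : F N (x - x') -> F N (y - y') -> F N (x * y - x' * y').
Proof.
move=> hx hy; rewrite (_ : _ - _ = (x - x') * y + x' * (y - y')); last by ring.
by apply: filD; [apply: filMr | apply: filMl].
Qed.

Lemma filXc N x y k : F N (x - y) -> F N (x ^+ k - y ^+ k).
Proof.
by move=> h; elim: k => [|k IH]; [rewrite subrr; apply: fil0 | rewrite !exprS; apply: filMc].
Qed.

Lemma filXB N x y k : F 1%N x -> F 1%N y -> F N (x - y) ->
  F (N + k)%N (x ^+ k.+1 - y ^+ k.+1).
Proof.
move=> hx hy h; rewrite subrXX; apply: filM => //; apply: fil_sum => i _ /=.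
have e : (k.+1 - i.+1 + i = k)%N by rewrite subSS subnK // -ltnS.
by rewrite -[k in F k]e; apply: filM; apply: filX1.
Qed.

Lemma fil_horner N (Q : {poly S}) a : F 1%N a ->
  (forall n, (n < N)%N -> F N Q`_n) -> F N Q.[a].
Proof.
move=> ha h; rewrite horner_coef; apply: fil_sum => i _.
case: (ltnP i N) => hi; first by apply: filMr; apply: h.
by apply: filMl; apply: filW hi _; apply: filX1.
Qed.

Section Eval.
Variables (R : comNzRingType) (kappa : R -> S) (N : nat) (a : S).
Hypothesis kD : forall x y : R, kappa (x + y) = kappa x + kappa y.
Hypothesis k0 : kappa 0 = 0.
Hypothesis kM : forall x y : R, F N (kappa (x * y) - kappa x * kappa y).
Hypothesis k1 : F N (kappa 1 - 1).
Hypothesis ha : F 1%N a.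

Definition ev (f : ps R) : S := \sum_(j < N) kappa (f j) * a ^+ j.

Lemma evD f g : ev (f + g) = ev f + ev g.
Proof.
by rewrite /ev -big_split; apply: eq_bigr => i _ /=; rewrite psD kD mulrDl.
Qed.

Lemma ev0 : ev 0 = 0.
Proof. by rewrite /ev big1 // => i _; rewrite ps0 k0 mul0r. Qed.

Lemma ev_sum (I : Type) (r : seq I) (P : pred I) (G : I -> ps R) :
  ev (\sum_(i <- r | P i) G i) = \sum_(i <- r | P i) ev (G i).
Proof. by elim/big_rec2: _ => [|i x y _ <-]; rewrite ?ev0 ?evD. Qed.

Let ksum (I : Type) (r : seq I) (P : pred I) (G : I -> R) :
  kappa (\sum_(i <- r | P i) G i) = \sum_(i <- r | P i) kappa (G i).
Proof. by elim/big_rec2: _ => [|i x y _ <-]; rewrite ?k0 ?kD. Qed.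

Lemma evM f g : F N (ev (f * g) - ev f * ev g).
Proof.
pose P (f : ps R) : {poly S} := \poly_(j < N) kappa (f j).
have evP h : ev h = (P h).[a] by rewrite horner_poly.
rewrite !evP -hornerM -hornerN -hornerD; apply: fil_horner => // n nN.
rewrite coefB coefM coef_poly nN psM ksum -sumrB; apply: fil_sum => i _.
by rewrite !coef_poly !(leq_ltn_trans _ nN) ?leq_subr // -ltnS.
Qed.

Lemma ev1 : F N (ev 1 - 1).
Proof.
rewrite /ev; case: N k1 => [|N' k1']; first by move=> _; apply: filT.
rewrite big_ord_recl big1 => [|i _]; last by rewrite ps1 k0 mul0r.
by rewrite addr0 expr0 mulr1.
Qed.

Lemma ev_expr f k : F N (ev (f ^+ k) - ev f ^+ k).
Proof.
elim: k => [|k IH]; first exact: ev1.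
rewrite !exprS; apply: fil_trans (evM _ _) _; apply: filMc => //.
by rewrite subrr; apply: fil0.
Qed.

End Eval.

End FiltrationTheory.

Section PsFiltration.
Variable R : comNzRingType.

Definition disc_fil N (x : R) := (0 < N)%N -> x = 0.

Fact disc_filM a b x y :
  disc_fil a x -> disc_fil b y -> disc_fil (a + b) (x * y).
Proof.
move=> hx hy ab; case: (posnP a) => [a0|a0]; last by rewrite hx // mul0r.
by rewrite hy ?mulr0 //; rewrite a0 in ab.
Qed.

Definition discrete : filtration R.
Proof.
exists disc_fil => //; last exact: disc_filM.
- by move=> a b x ab h a0; apply: h; apply: leq_trans ab.
- by move=> N x y hx hy N0; rewrite hx // hy // addr0.
Defined.

Variable F : filtration R.

Definition ps_fil_def N (f : ps R) := forall n, F (N - n)%N (f n).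

Fact ps_filM a b f g :
  ps_fil_def a f -> ps_fil_def b g -> ps_fil_def (a + b) (f * g).
Proof.
move=> hf hg n; rewrite psM; apply: fil_sum => i _.
by apply: filW (filM (hf i) (hg (n - i)%N)); have := ltn_ord i; lia.
Qed.

Definition ps_fil : filtration (ps R).
Proof.
exists ps_fil_def; last exact: ps_filM.
- by move=> f n; apply: filT.
- by move=> a b f ab h n; apply: filW (h n); apply: leq_sub2r.
- by move=> N n; apply: fil0.
- by move=> N f g hf hg n; apply: filD.
Defined.

End PsFiltration.

(* The xi-adic filtration of A[[xi]] and the total degree filtration of
   A[[xi,x]]. *)
Definition fil1 (A : comNzRingType) : filtration (ps A) := ps_fil (discrete A).
Definition fil2 (A : comNzRingType) : filtration (ps (ps A)) := ps_fil (fil1 A).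

Lemma fil1P (A : comNzRingType) N (f : ps A) :
  fil1 A N f <-> forall n, (n < N)%N -> f n = 0.
Proof.
split=> h n; last by move=> hn; apply: h; rewrite subn_gt0 in hn.
by move=> hn; apply: (h n); rewrite subn_gt0.
Qed.

Lemma fil2P (A : comNzRingType) N (f : ps (ps A)) :
  fil2 A N f <-> forall a b, (a + b < N)%N -> f a b = 0.
Proof.
split=> h a b hab; first by apply: (h a b); lia.
by apply: h; lia.
Qed.

(** * Logarithm and exponential *)

Section EllBasics.
Variables (A : comNzRingType) (p : nat) (divp : A -> A) (v : nat -> A).
Local Notation ell_step := (gell_step p divp v).
Local Notation ell := (gell p divp v).
Local Notation logc := (glogc p divp v).
Local Notation exp_step := (gexp_step p divp v).
Local Notation expc := (gexpc p divp v).
Local Notation logsum := (glogsum p divp v).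
Local Notation fgl := (gfgl p divp v).

Lemma ell_iter k : size (iter k (ell_step) [:: 1]) = k.+1 /\
  forall i, (i <= k)%N -> (iter k (ell_step) [:: 1])`_i = ell i.
Proof.
elim: k => [|k [sk IH]]; first by split=> // [[]].
split; first by rewrite /= size_rcons sk.
move=> i; rewrite leq_eqVlt => /orP[/eqP-> //|ik].
by rewrite /= nth_rcons sk ik IH.
Qed.

Lemma ell0 : ell 0 = 1. Proof. by []. Qed.

Lemma ell_stepE k :
  ell k.+1 = (ell_step (iter k (ell_step) [:: 1]))`_k.+1.
Proof. by []. Qed.

Lemma ell_rec k : ell k.+1 =
  divp (\sum_(i < k.+1) ell i * v (k.+1 - i) ^+ (p ^ i)).
Proof.
have [sk IH] := ell_iter k; rewrite ell_stepE.
move: (iter _ _ _) sk IH => s sk IH.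
rewrite /gell_step nth_rcons sk ltnn eqxx; congr divp.
by apply: eq_bigr => i _; rewrite IH // -ltnS.
Qed.

Lemma logc0 : logc 0 = 0.
Proof. by rewrite /glogc big_ord1 expn0 mul0r. Qed.

Lemma logc1 : (1 < p)%N -> logc 1 = 1.
Proof.
move=> p1; rewrite /glogc !big_ord_recl big_ord0 ell0 expn0 expn1 /= mul1r.
by rewrite (_ : (1 == p)%N = false) ?mul0r ?addr0 //; lia.
Qed.

Lemma exp_iter k : size (iter k (exp_step) [::]) = k /\
  forall i, (i < k)%N -> (iter k (exp_step) [::])`_i = expc i.
Proof.
elim: k => [|k [sk IH]]; first by split.
split; first by rewrite /= size_rcons sk.
move=> i; rewrite ltnS leq_eqVlt => /orP[/eqP-> //|ik].
by rewrite /= nth_rcons sk ik IH.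
Qed.

Lemma exp_stepE n : expc n = (exp_step (iter n (exp_step) [::]))`_n.
Proof. by []. Qed.

Lemma expc_rec n : expc n = (n == 1%N)%:R -
  \sum_(2 <= j < n.+1)
     logc j * gspow (fun i => (iter n (exp_step) [::])`_i) j n.
Proof.
have [sk _] := exp_iter n; rewrite exp_stepE.
move: (iter _ _ _) sk => s sk.
by rewrite /gexp_step nth_rcons sk ltnn eqxx.
Qed.

Lemma expc0 : expc 0 = 0.
Proof. by rewrite expc_rec big_geq // subr0. Qed.

Lemma log_exp_coef n : (1 < p)%N ->
  \sum_(j < n.+1) logc j * ((expc : ps A) ^+ j) n = (n == 1%N)%:R.
Proof.
move=> p1; case: n => [|n].
  by rewrite big_ord1 logc0 mul0r.
rewrite big_ord_recl logc0 mul0r add0r big_ord_recl (logc1 p1) mul1r expr1.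
rewrite expc_rec; move: (iter n.+1 _ _) (exp_iter n.+1) => s [sk es].
apply: subr0_eq; rewrite addrAC [_ - _ - _]addrAC subrr sub0r.
rewrite addrC big_add1 big_add1 !succnK big_mkord -sumrB big1 // => i _.
rewrite gspowE -mulrBr.
pose t : ps A := fun i => s`_i.
have E0 : fil1 A 1 (expc : ps A) by apply/fil1P => -[] // _; exact: expc0.
have h : fil1 A n.+1 ((expc : ps A) - t).
  by apply/fil1P => j jn; rewrite psB /t es // subrr.
have s0 : fil1 A 1 t.
  by apply/fil1P => -[] // _; rewrite /t es ?expc0.
have /fil1P/(_ n.+1) := filXB i.+1 E0 s0 h.
rewrite psB => e; rewrite -[RHS](mulr0 (logc i.+2)); congr (_ * _).
by apply: e; rewrite addnS ltnS leq_addr.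
Qed.

End EllBasics.

Section LogExp.
Variables (A : comNzRingType) (p : nat) (divp : A -> A) (v : nat -> A).
Local Notation ell_step := (gell_step p divp v).
Local Notation ell := (gell p divp v).
Local Notation logc := (glogc p divp v).
Local Notation exp_step := (gexp_step p divp v).
Local Notation expc := (gexpc p divp v).
Local Notation logsum := (glogsum p divp v).
Local Notation fgl := (gfgl p divp v).
Variables (S : comNzRingType) (F : filtration S) (iota : {rmorphism A -> S}).
Hypothesis p1 : (1 < p)%N.

Definition logT N z := \sum_(k < N) iota (ell k) * z ^+ (p ^ k).

Lemma logcT N z : F 1%N z -> F N (logT N z - ev iota N z (logc)).
Proof.
move=> hz.
have -> : ev iota N z (logc) =
    \sum_(k < N | (p ^ k < N)%N) iota (ell k) * z ^+ (p ^ k).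
  transitivity (\sum_(j < N) \sum_(k < N | (j == p ^ k :> nat)%N)
                  iota (ell k) * z ^+ (p ^ k)).
    apply: eq_bigr => j _; rewrite /glogc rmorph_sum mulr_suml.
    rewrite (big_ord_widen N (fun k => iota ((j == p ^ k :> nat)%N%:R * ell k)
       * z ^+ j)) // big_mkcond [RHS]big_mkcond.
    apply: eq_bigr => k _; case: eqP => [->|_]; last by rewrite mul0r rmorph0 mul0r if_same.
    by rewrite mul1r (leq_trans (ltn_expl k p1)) // ltnS.
  rewrite (exchange_big_dep (fun k : 'I_N => (p ^ k < N)%N)) /=; last first.
    by move=> j k _ /eqP <-.
  apply: eq_bigr => k hk; rewrite (big_pred1 (Ordinal hk)) //.
rewrite /logT (bigID (fun k : 'I_N => (p ^ k < N)%N)) /= addrC addrK.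
apply: fil_sum => k; rewrite -leqNgt => hk; apply: filMl.
by apply: filW hk _; apply: filX1.
Qed.

Definition islog z g := forall N, F N (g - logT N z).
Definition isexp g w := forall N, F N (w - ev iota N g (expc)).

Lemma islog_fil1 z g : F 1%N z -> islog z g -> F 1%N g.
Proof.
move=> hz /(_ 1%N); rewrite /logT big_ord1 rmorph1 mul1r expn0 expr1 => h.
by rewrite -(subrK z g); apply: filD.
Qed.

Lemma islogD N z g : F 1%N z -> islog z g -> F (p ^ N)%N (g - logT N z).
Proof.
move=> hz /(_ (p ^ N)%N) h; apply: fil_trans h _.
have Np : (N <= p ^ N)%N by apply: ltnW; apply: ltn_expl.
rewrite /logT (big_ord_widen _ (fun k => iota (ell k) * z ^+ (p ^ k)) Np).
rewrite (bigID (fun k : 'I_(p ^ N) => (k < N)%N)) /= addrC addrK.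
apply: fil_sum => k; rewrite -leqNgt => hk; apply: filMl.
by apply: filW (filX1 _ hz); rewrite leq_exp2l.
Qed.

Lemma isexp_fil1 g w : F 1%N g -> isexp g w -> F 1%N w.
Proof.
move=> hg /(_ 1%N); rewrite /ev big_ord1 expc0 rmorph0 mul0r subr0.
by [].
Qed.

Let iD := rmorphD iota.
Let i0 := rmorph0 iota.
Let iM N x y : F N (iota (x * y) - iota x * iota y).
Proof. by rewrite rmorphM subrr; apply: fil0. Qed.
Let i1 N : F N (iota 1 - 1).
Proof. by rewrite rmorph1 subrr; apply: fil0. Qed.

Lemma isexp_islog g w : F 1%N g -> isexp g w -> islog w g.
Proof.
move=> hg hw N; have w1 := isexp_fil1 hg hw.
apply: (@fil_trans _ _ _ _ (ev iota N w (logc))); last first.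
  by apply: fil_sym; apply: logcT.
have evC c : F N (ev iota N g (psC c) - iota c).
  rewrite /ev; case: N => [|N']; first exact: filT.
  rewrite big_ord_recl big1 => [|i _]; last by rewrite rmorph0 mul0r.
  by rewrite addr0 mulr1 subrr; apply: fil0.
pose H : ps A := \sum_(j < N) psC (logc j) * (expc : ps A) ^+ j.
have HX n : (n < N)%N -> H n = (n == 1%N)%:R.
  move=> nN; rewrite -(log_exp_coef divp v n p1) /H ps_sum.
  have h : fil1 A 1 (expc : ps A) by apply/fil1P => -[] // _; exact: expc0.
  rewrite (big_ord_widen N (fun j => logc j * ((expc : ps A) ^+ j) n)) //.
  rewrite [RHS]big_mkcond; apply: eq_bigr => j _ /=; rewrite psCM.
  case: ltnP => // jn; have /fil1P -> := filX1 j h; rewrite ?mulr0 //.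
have eH : F N (ev iota N g H - g).
  case: N {hw evC} H HX => [|[|N]] H HX; first exact: filT.
    by rewrite /ev big_ord1 HX // rmorph0 mul0r sub0r; apply: filN.
  rewrite /ev !big_ord_recl !HX //= rmorph0 mul0r add0r rmorph1 mul1r expr1.
  rewrite big1 ?addr0 ?subrr; first exact: fil0.
  move=> i _; have hi : (bump 0 (bump 0 i) < N.+2)%N.
    by rewrite /bump !leq0n !add1n !ltnS.
  by rewrite (HX _ hi) rmorph0 mul0r.
apply: fil_trans (fil_sym eH) _; rewrite ev_sum // -sumrB.
apply: fil_sum => j _.
apply: fil_trans (evM iD i0 (@iM N) hg _ _) _; apply: filMc => //.
apply: fil_trans (ev_expr iD i0 (@iM N) (@i1 N) hg _ _) _.
by apply: filXc; apply: fil_sym.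
Qed.

Section TwoVar.
Variables a b : S.
Hypotheses (ha : F 1%N a) (hb : F 1%N b).

Definition ev2 N (B : ps (ps A)) : S := ev (ev iota N b) N a B.

Lemma fgl_ev2 la lb N : islog a la -> islog b lb ->
  F N (ev2 N (fgl) - ev iota N (la + lb) (expc)).
Proof.
move=> hla hlb; case: (posnP N) => [->|N0]; first exact: filT.
have [la1 lb1] := (islog_fil1 ha hla, islog_fil1 hb hlb).
have kD := evD N b iD; have k0 := ev0 N b i0.
have kM := evM iD i0 (@iM N) hb; have k1 := ev1 b i0 (i1 N).
have evC (c : A) : ev iota N b (psC c) = iota c.
  rewrite /ev -(prednK N0) big_ord_recl big1 => [|i _]; last by rewrite rmorph0 mul0r.
  by rewrite addr0 mulr1.
have ev2C (f : ps A) : ev2 N (psC f) = ev iota N b f.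
  rewrite /ev2 [LHS]/ev (bigD1 (Ordinal N0)) //= mulr1 big1 ?addr0 // => i.
  by rewrite -val_eqE /= /psC => /negbTE ->; rewrite k0 mul0r.
have ls1 : fil2 A 1 (logsum).
  apply/fil2P => -[|i] [|j] // _; rewrite /glogsum !mul1r logc0 addr0 //.
pose H : ps (ps A) :=
  \sum_(m < N + N) psC (psC (expc m)) * (logsum : ps (ps A)) ^+ m.
have -> : ev2 N (fgl) = ev2 N H.
  apply: eq_bigr => j _; congr (_ * _); apply: eq_bigr => k _; congr (iota _ * _).
  rewrite /gfgl /H !ps_sum.
  rewrite (big_ord_widen (N + N) (fun m => expc m * gbpow (logsum) m j k)); last first.
    by have := ltn_ord j; have := ltn_ord k; lia.
  rewrite big_mkcond; apply: eq_bigr => m _; rewrite !psCM gbpowE.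
  by case: ltnP => // jn; have /fil2P -> := filX1 m ls1; rewrite ?mulr0 //; lia.
have els : F N (ev2 N (logsum) - (la + lb)).
  have -> : ev2 N (logsum) = ev iota N a (logc) + ev iota N b (logc).
    pose lx : ps (ps A) := fun j => psC (logc j).
    have -> : logsum = lx + psC (logc : ps A).
      apply/funext=> j; apply/funext=> k; rewrite !psD /glogsum /lx /psC.
      by case: (k == 0%N); case: (j == 0%N); rewrite ?mul1r ?mul0r.
    rewrite /ev2 evD //; congr (_ + _).
      by apply: eq_bigr => j _; rewrite evC.
    exact: ev2C.
  rewrite opprD addrACA; apply: filD.
    by apply: fil_trans (fil_sym (logcT _ ha)) _; apply: fil_sym.
  by apply: fil_trans (fil_sym (logcT _ hb)) _; apply: fil_sym.
have l1 : F 1%N (la + lb) by apply: filD.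
apply: (@fil_trans _ _ _ _ (ev iota (N + N) (la + lb) (expc))); last first.
  rewrite /ev (big_ord_widen (N + N)
    (fun j => iota (expc j) * (la + lb) ^+ j) (leq_addr N N)).
  rewrite (bigID (fun k : 'I_(N + N) => (k < N)%N)) /= addrC addrK.
  apply: fil_sum => k; rewrite -leqNgt => hk; apply: filMl.
  by apply: filW hk _; apply: filX1.
rewrite /ev2 ev_sum // -sumrB; apply: fil_sum => m _.
apply: fil_trans (evM kD k0 kM ha _ _) _; apply: filMc.
  by rewrite -/(ev2 N _) ev2C evC subrr; apply: fil0.
apply: fil_trans (ev_expr kD k0 kM k1 ha _ _) _.
by apply: filXc.
Qed.

Lemma islog_fgl la lb w : islog a la -> islog b lb ->
  (forall N, F N (w - ev2 N (fgl))) -> islog w (la + lb).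
Proof.
move=> hla hlb hw; apply: isexp_islog.
  by apply: filD; [apply: islog_fil1 hla | apply: islog_fil1 hlb].
by move=> N; apply: fil_trans (hw N) _; apply: fgl_ev2.
Qed.

End TwoVar.
End LogExp.

(** * Frobenius lifts *)

Section FrobRing.
Variable p : nat.

(* A ring with 1/p, a subring of "integral" elements and an endomorphism
   lifting, on integral elements, the Frobenius modulo p. *)
Record frob0 (R : comNzRingType) := Frob0 {
  intg : R -> Prop;
  sg : R -> R;
  pinv : R;
  pinvE : p%:R * pinv = 1;
  intg0 : intg 0;
  intg1 : intg 1;
  intgD : forall x y, intg x -> intg y -> intg (x + y);
  intgN : forall x, intg x -> intg (- x);
  intgM : forall x y, intg x -> intg y -> intg (x * y);
  sg_intg : forall x, intg x -> intg (sg x);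
  sg0 : sg 0 = 0;
  sg1 : sg 1 = 1;
  sgD : forall x y, sg (x + y) = sg x + sg y;
  sgM : forall x y, sg (x * y) = sg x * sg y }.

Definition frob_lift R (f : frob0 R) x :=
  intg f x /\ intg f (pinv f * (sg f x - x ^+ p)).

Section Theory.
Variables (R : comNzRingType) (f : frob0 R).
Implicit Types x y z : R.
Local Notation int := (intg f).
Local Notation q := (pinv f).

Lemma intgB x y : int x -> int y -> int (x - y).
Proof. by move=> hx hy; apply: intgD => //; apply: intgN. Qed.

Lemma intg_sum (I : Type) (r : seq I) (P : pred I) (G : I -> R) :
  (forall i, P i -> int (G i)) -> int (\sum_(i <- r | P i) G i).
Proof.
move=> h; elim/big_rec: _ => [|i x Pi hx]; first exact: intg0.
by apply: intgD => //; apply: h.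
Qed.

Lemma intgX x k : int x -> int (x ^+ k).
Proof.
move=> hx; elim: k => [|k IH]; first exact: intg1.
by rewrite exprS; apply: intgM.
Qed.

Lemma intg_nat k : int k%:R.
Proof. by elim: k => [|k IH]; [exact: intg0 | rewrite mulrS; apply: intgD => //; apply: intg1]. Qed.

Lemma intgMn x k : int x -> int (x *+ k).
Proof. by move=> hx; rewrite -mulr_natl; apply: intgM => //; apply: intg_nat. Qed.

Lemma pinvX k : p%:R ^+ k * q ^+ k = 1.
Proof. by rewrite -exprMn pinvE expr1n. Qed.

Lemma sgN x : sg f (- x) = - sg f x.
Proof. by apply: (@addrI _ (sg f x)); rewrite -sgD !subrr sg0. Qed.

Lemma sgB x y : sg f (x - y) = sg f x - sg f y.
Proof. by rewrite sgD sgN. Qed.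

Lemma sg_sum (I : Type) (r : seq I) (P : pred I) (G : I -> R) :
  sg f (\sum_(i <- r | P i) G i) = \sum_(i <- r | P i) sg f (G i).
Proof. by elim/big_rec2: _ => [|i x y _ <-]; rewrite ?sg0 ?sgD. Qed.

Lemma sgX x k : sg f (x ^+ k) = sg f x ^+ k.
Proof. by elim: k => [|k IH]; rewrite ?sg1 // !exprS sgM IH. Qed.

Lemma sg_nat k : sg f k%:R = k%:R.
Proof. by elim: k => [|k IH]; rewrite ?sg0 // !mulrS sgD sg1 IH. Qed.

Lemma frob_liftD x y : prime p -> frob_lift f x -> frob_lift f y ->
  frob_lift f (x + y).
Proof.
move=> pp [x0 hx] [y0 hy]; split; first exact: intgD.
have [n pn] : exists n, p = n.+1 by exists p.-1; rewrite prednK // prime_gt0.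
have -> : q * (sg f (x + y) - (x + y) ^+ p) =
   q * (sg f x - x ^+ p) + q * (sg f y - y ^+ p) -
   \sum_(i < n) x ^+ (n - i) * y ^+ i.+1 *+ ('C(p, i.+1) %/ p).
  rewrite exprDn sgD pn big_ord_recl big_ord_recr /= !bin0 binn subn0 subnn.
  rewrite /bump !add1n expr0 mulr1 mul1r !mulr1n.
  have -> : \sum_(i < n) x ^+ (n.+1 - (1 + i)) * y ^+ (1 + i) *+ 'C(n.+1, 1 + i) =
     p%:R * \sum_(i < n) x ^+ (n - i) * y ^+ i.+1 *+ ('C(p, i.+1) %/ p).
    rewrite mulr_sumr; apply: eq_bigr => i _; rewrite add1n subSS mulr_natl -mulrnA.
    rewrite -pn divnK // prime_dvd_bin //=.
    by rewrite pn ltnS; apply: ltn_ord.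
  rewrite -pn; set s := \sum_(i < n) _; set a := x ^+ p; set b := y ^+ p.
  have {2}-> : s = p%:R * q * s by rewrite pinvE mul1r.
  by move: (p%:R : R) => pR; ring.
apply: intgB; first exact: intgD.
by apply: intg_sum => i _; apply: intgMn; apply: intgM; apply: intgX.
Qed.

Lemma frob_lift0 : prime p -> frob_lift f 0.
Proof.
move=> pp; split; first exact: intg0.
by rewrite sg0 expr0n gtn_eqF ?prime_gt0 // subrr mulr0; apply: intg0.
Qed.

Lemma frob_lift_sum (I : Type) (r : seq I) (G : I -> R) : prime p ->
  (forall i, frob_lift f (G i)) -> frob_lift f (\sum_(i <- r) G i).
Proof.
move=> pp h; elim/big_rec: _ => [|i x _ hx]; first exact: frob_lift0.
exact: frob_liftD.
Qed.

Lemma pow_congr k x y : int x -> int y -> int (q ^+ k.+1 * (x - y)) ->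
  int (q ^+ k.+2 * (x ^+ p - y ^+ p)).
Proof.
move=> hx hy h.
have h1 : int (q * (x - y)).
  have -> : q * (x - y) = p%:R ^+ k * (q ^+ k.+1 * (x - y)).
    by rewrite exprS mulrA [_ ^+ k * (_ * _)]mulrCA pinvX mulr1.
  by apply: intgM => //; apply: intgX; apply: intg_nat.
rewrite subrXX exprS; set s := \sum_(i < p) _.
have -> : q * q ^+ k.+1 * ((x - y) * s) = (q ^+ k.+1 * (x - y)) * (q * s) by ring.
apply: intgM => //.
have -> : s = \sum_(i < p) ((x ^+ (p.-1 - i) - y ^+ (p.-1 - i)) * y ^+ i) + p%:R * y ^+ p.-1.
  have -> : p%:R * y ^+ p.-1 = \sum_(i < p) y ^+ p.-1.
    by rewrite sumr_const card_ord mulr_natl.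
  rewrite -big_split; apply: eq_bigr => i _ /=.
  rewrite mulrBl -exprD (_ : (p.-1 - i + i)%N = p.-1) ?subrK //.
  by have := ltn_ord i; lia.
rewrite mulrDr [q * (p%:R * _)]mulrA [q * p%:R]mulrC pinvE mul1r; apply: intgD; last exact: intgX.
rewrite mulr_sumr; apply: intg_sum => i _; rewrite subrXX !mulrA.
apply: intgM; last exact: intgX.
by apply: intgM => //; apply: intg_sum => j _; apply: intgM; apply: intgX.
Qed.

Lemma pow_congrX x y i : int x -> int y -> int (q * (x - y)) ->
  int (q ^+ i.+1 * (x ^+ (p ^ i) - y ^+ (p ^ i))).
Proof.
move=> hx hy h; elim: i => [|i IH]; first by rewrite expn0 !expr1.
by rewrite expnSr !exprM; apply: pow_congr => //; apply: intgX.
Qed.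

Lemma frob_iter z j : (forall x, int x -> frob_lift f x) -> int z ->
  int (iter j (sg f) z) /\ int (q * (z ^+ (p ^ j) - iter j (sg f) z)).
Proof.
move=> fl hz; elim: j => [|j [h1 h2]].
  by rewrite expn0 expr1 subrr mulr0; split=> //; apply: intg0.
have [_ h3] := fl _ h1; split; first exact: sg_intg.
rewrite expnSr exprM iterS.
have -> : q * ((z ^+ (p ^ j)) ^+ p - sg f (iter j (sg f) z)) =
  p%:R * (q ^+ 2 * ((z ^+ (p ^ j)) ^+ p - (iter j (sg f) z) ^+ p)) -
  q * (sg f (iter j (sg f) z) - (iter j (sg f) z) ^+ p).
  rewrite [q ^+ 2]expr2 !mulrA pinvE mul1r; ring.
apply: intgB => //; apply: intgM; first exact: intg_nat.
by apply: (@pow_congr 0) => //; apply: intgX.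
Qed.

End Theory.

Section PsFrob.
Variables (R : comNzRingType) (f : frob0 R).
Hypothesis pp : prime p.

Definition ps_intg (h : ps R) := forall n, intg f (h n).
Definition ps_sg (h : ps R) : ps R :=
  fun n => if (p %| n)%N then sg f (h (n %/ p)%N) else 0.

Lemma sum_dvd (F : nat -> R) m : (forall i, ~~ (p %| i)%N -> F i = 0) ->
  \sum_(i < (p * m).+1) F i = \sum_(i < m.+1) F (p * i)%N.
Proof.
move=> h; have p0 := prime_gt0 pp; elim: m => [|m IH].
  by rewrite muln0 !big_ord1 muln0.
rewrite [RHS]big_ord_recr /= -IH -!(big_mkord xpredT (fun i => F i)).
have e1 : ((p * m).+1 <= (p * m.+1).+1)%N by rewrite ltnS leq_mul2l leqnSn orbT.
rewrite (big_cat_nat (leq0n _) e1) /=; congr (_ + _).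
rewrite big_nat_recr ?leq_mul2l ?leqnSn ?orbT //=; last first.
  by rewrite mulnS; lia.
rewrite big_nat_cond big1 ?add0r // => i; rewrite andbT => /andP[h1 h2].
apply: h; apply/negP => /dvdnP[k e].
have h3 : (m < k)%N by rewrite -(ltn_pmul2l p0) [(p * k)%N]mulnC -e.
have h4 : (k < m.+1)%N by rewrite -(ltn_pmul2l p0) [(p * k)%N]mulnC -e.
by lia.
Qed.

Lemma ps_sgM g h : ps_sg (g * h) = ps_sg g * ps_sg h.
Proof.
have p0 := prime_gt0 pp; apply/funext=> n; rewrite psM /ps_sg.
case: ifP => [/dvdnP[m ->]|/negbT pn]; last first.
  rewrite big1 // => i _; case: ifP => pi; last by rewrite mul0r.
  case: ifP => pni; last by rewrite mulr0.
  by case/negP: pn; rewrite -(dvdn_subl (ltn_ord i : (i <= n)%N) pi).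
rewrite mulnK // mulnC.
rewrite (@sum_dvd (fun i => (if (p %| i)%N then sg f (g (i %/ p)%N) else 0) *
  (if (p %| p * m - i)%N then sg f (h ((p * m - i) %/ p)%N) else 0))); last first.
  by move=> i /negbTE ->; rewrite mul0r.
rewrite psM sg_sum; apply: eq_bigr => i _; rewrite sgM.
by rewrite -mulnBr !dvdn_mulr // !mulKn.
Qed.

Definition ps_frob : frob0 (ps R).
Proof.
apply: (@Frob0 _ ps_intg ps_sg (psC (pinv f))).
- by rewrite -(rmorph_nat (@psC R)) -rmorphM pinvE rmorph1.
- by move=> n; apply: intg0.
- by move=> n; rewrite ps1; apply: intg_nat.
- by move=> x y hx hy n; apply: intgD.
- by move=> x hx n; apply: intgN.
- by move=> x y hx hy n; rewrite psM; apply: intg_sum => i _; apply: intgM.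
- move=> x hx n; rewrite /ps_sg; case: ifP => _; last exact: intg0.
  exact: sg_intg.
- by apply/funext=> n; rewrite /ps_sg !ps0 sg0 if_same.
- apply/funext=> -[|n]; rewrite /ps_sg; first by rewrite dvdn0 div0n ps1 sg1.
  case: ifP => // /dvdnP[[|m] e]; first by rewrite mul0n in e.
  by rewrite [in LHS]e mulnK ?prime_gt0 // ps1 sg0.
- move=> x y; apply/funext=> n; rewrite psD /ps_sg.
  by case: ifP; rewrite ?sgD ?addr0.
- exact: ps_sgM.
Defined.

Lemma ps_sgC c : sg ps_frob (psC c) = psC (sg f c).
Proof.
apply/funext=> -[|n]; first by rewrite /= /ps_sg dvdn0 div0n.
rewrite /= /ps_sg; case: ifP => // /dvdnP[[|m] e]; first by rewrite mul0n in e.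
by rewrite [in LHS]e mulnK ?prime_gt0 // sg0.
Qed.

Lemma ps_sgX : sg ps_frob psX = psX ^+ p.
Proof.
have p0 := prime_gt0 pp.
apply/funext=> n; rewrite psXn /= /ps_sg /psX; case: ifP => [/dvdnP[m ->]|/negbT pn].
  rewrite mulnK // -{2}(mul1n p) eqn_pmul2r //.
  by case: eqP; rewrite ?sg1 ?sg0.
by case: eqP pn => // ->; rewrite dvdnn.
Qed.

Lemma ps_frob_lift : (forall x, intg f x -> frob_lift f x) ->
  forall h, intg ps_frob h -> frob_lift ps_frob h.
Proof.
move=> fl h hh; split=> // n.
pose g : ps R := \sum_(i < n.+1) psC (h i) * psX ^+ i.
have gE i : (i <= n)%N -> g i = h i.
  move=> hi; rewrite /g ps_sum (bigD1 (Ordinal (hi : (i < n.+1)%N))) //=.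
  rewrite psCM psXn eqxx mulr1 big1 ?addr0 // => j; rewrite -val_eqE /= => ji.
  by rewrite psCM psXn eq_sym (negbTE ji) mulr0.
have [_ /(_ n)] : frob_lift ps_frob g.
  apply: frob_lift_sum => // i; have [h1 h2] := fl _ (hh i); split.
    move=> m; rewrite psCM psXn.
    by apply: intgM => //; apply: intg_nat.
  rewrite sgM ps_sgC sgX ps_sgX exprMn -rmorphXn exprAC -mulrBl -rmorphB mulrA.
  rewrite /= -rmorphM => m; rewrite psCM -exprM psXn.
  by apply: intgM => //; apply: intg_nat.
rewrite /= !psCM !psB /ps_sg gE ?leq_div //.
have -> : (g ^+ p) n = (h ^+ p) n; last by [].
apply: subr0_eq; rewrite -psB.
have hgh : fil1 R n.+1 (g - h) by apply/fil1P => i hi; rewrite psB gE ?subrr.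
by have /fil1P -> := filXc p hgh.
Qed.

Lemma ps_sg_fil (F : filtration R) N h :
  (forall M x, F M x -> F (p * M)%N (sg f x)) ->
  ps_fil F N h -> ps_fil F (p * N)%N (sg ps_frob h).
Proof.
move=> hF hh n; rewrite /= /ps_sg; case: ifP => [/dvdnP[m ->]|_]; last exact: fil0.
rewrite mulnK ?prime_gt0 // [(m * p)%N]mulnC -mulnBr; apply: hF; exact: hh.
Qed.

End PsFrob.
End FrobRing.

(** * Functional equation lemma *)

Lemma tri_sum (R : nmodType) (G : nat -> nat -> R) m :
  \sum_(i < m) \sum_(j < i.+1) G j (i - j)%N =
  \sum_(j < m) \sum_(i < m - j) G j i.
Proof.
elim: m => [|m IH]; first by rewrite !big_ord0.
rewrite big_ord_recr IH /=.
have -> : \sum_(j < m) \sum_(i < m - j) G j i = \sum_(j < m.+1) \sum_(i < m - j) G j i.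
  by rewrite [RHS]big_ord_recr /= subnn big_ord0 addr0.
rewrite -big_split; apply: eq_bigr => j _ /=.
by rewrite subSn ?big_ord_recr // -ltnS.
Qed.

Fact ring_aux1 (R : comNzRingType) (a b c d e : R) :
  a - b - c = (d - b) + (e - c) - (d + e - a).
Proof. by ring. Qed.

Fact ring_aux2 (R : comNzRingType)
    (q w z h1 h2 h3 L0 L1 L2 L3 D0 D1 D2 D3 : R) :
  q * ((w - z) - (h1 + h2 - h3)) =
    (q * L1 - D1 - q * h1) + (q * L2 - D2 - q * h2) - (q * L3 - D3 - q * h3)
    + q * (L0 - L1 - L2) - q * (L0 - L3 - (w - z))
    - (D0 - D1 - D2) + (D0 - D3).
Proof. by ring. Qed.

Section Ell.
Variables (A : comNzRingType) (p : nat) (divp : A -> A) (v : nat -> A).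
Hypothesis pp : prime p.
Hypothesis divpE : forall x, p%:R * divp x = x.
Variable f : frob0 p A.
Hypothesis v_int : forall j, intg f (v j).
Hypothesis sgv : forall j, sg f (v j) = v j ^+ p.

Local Notation ell := (gell p divp v).

Lemma pI (x y : A) : p%:R * x = p%:R * y -> x = y.
Proof.
by move=> e; rewrite -[x]mul1r -[y]mul1r -(pinvE f) [p%:R * _]mulrC -!mulrA e.
Qed.

Lemma ell_untw m : (0 < m)%N ->
  p%:R * ell m = \sum_(i < m) ell i * v (m - i) ^+ (p ^ i).
Proof. by case: m => // m _; rewrite ell_rec divpE. Qed.

Definition sgi j x := iter j (sg f) x.

Lemma sgiM j x y : sgi j (x * y) = sgi j x * sgi j y.
Proof. by elim: j => //= j ->; rewrite sgM. Qed.
Lemma sgi_nat j k : sgi j k%:R = k%:R.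
Proof. by elim: j => //= j ->; rewrite sg_nat. Qed.
Lemma sgi_sum j (I : Type) (r : seq I) (P : pred I) (G : I -> A) :
  sgi j (\sum_(i <- r | P i) G i) = \sum_(i <- r | P i) sgi j (G i).
Proof. by elim: j => //= j ->; rewrite sg_sum. Qed.
Lemma sgiX j x k : sgi j (x ^+ k) = sgi j x ^+ k.
Proof. by elim: j => //= j ->; rewrite sgX. Qed.
Lemma sgi_v j i : sgi j (v i) = v i ^+ (p ^ j).
Proof. by elim: j => [|j /= ->] //; rewrite sgX sgv expnS exprM. Qed.
Lemma sgi_int j x : intg f x -> intg f (sgi j x).
Proof. by move=> hx; elim: j => //= j; apply: sg_intg. Qed.

(* The recursion for the Hazewinkel generators peels off the last factor of
   each monomial of ell_k; this one peels off the first. *)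
Lemma ell_tw k : p%:R * ell k.+1 =
  \sum_(j < k.+1) v j.+1 * sgi j.+1 (ell (k - j)).
Proof.
elim/ltn_ind: k => k IH; apply: pI.
rewrite ell_untw // mulr_sumr big_ord_recl big_ord_recr /= !ell0 mul1r.
rewrite subnn ell0 (_ : sg f (sgi k 1) = 1); last exact: (sgi_nat k.+1 1).
rewrite mulr1 mulrDr addrC expr1; congr (_ + _).
pose G j i := v j.+1 * sgi j.+1 (ell i) * v (k - i - j) ^+ (p ^ (i + j).+1).
transitivity (\sum_(i < k) \sum_(j < i.+1) G j (i - j)%N).
  apply: eq_bigr => i _; rewrite /bump /= add1n mulrA IH // mulr_suml.
  apply: eq_bigr => j _; rewrite /G; have ji : (j <= i)%N by rewrite -ltnS.
  by rewrite subnK // subSS -subnDA subnK.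
rewrite tri_sum mulr_sumr; apply: eq_bigr => j _.
rewrite mulrCA -[p%:R in RHS](sgi_nat j.+1) -sgiM ell_untw; last by rewrite subn_gt0.
rewrite sgi_sum mulr_sumr; apply: eq_bigr => i _.
rewrite sgiM sgiX sgi_v -exprM -expnD /G mulrA.
by congr (_ * v _ ^+ (p ^ _)); lia.
Qed.

Lemma ell_int k : intg f (p%:R ^+ k * ell k).
Proof.
elim/ltn_ind: k => -[|k] IH; first by rewrite ell0 mul1r; apply: intg1.
rewrite exprSr -mulrA ell_untw // mulr_sumr; apply: intg_sum => i _.
have ik : (i <= k)%N by rewrite -ltnS.
have -> : p%:R ^+ k = p%:R ^+ (k - i) * p%:R ^+ i :> A by rewrite -exprD subnK.
rewrite -mulrA [_ ^+ i * (_ * _)]mulrA.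
apply: intgM; first by apply: intgX; apply: intg_nat.
by apply: intgM; [apply: IH | apply: intgX].
Qed.

Section Dwork.
Variables (S : comNzRingType) (F : filtration S) (iota : {rmorphism A -> S}).
Variable Phi : frob0 p S.
Hypothesis iota_sg : forall x, sg Phi (iota x) = iota (sg f x).
Hypothesis iota_int : forall x, intg f x -> intg Phi (iota x).
Hypothesis PhiL : forall x, intg Phi x -> frob_lift Phi x.
Hypothesis PhiF : forall N x, F N x -> F (p * N)%N (sg Phi x).

Local Notation LT := (logT p divp v iota).
Local Notation SG j := (iter j (sg Phi)).

Lemma SG_fil j N x : F N x -> F (p ^ j * N)%N (SG j x).
Proof.
move=> h; elim: j => [|j IH]; first by rewrite mul1n.
by rewrite expnS -mulnA; apply: PhiF.
Qed.

Lemma SG_sum j (I : Type) (r : seq I) (P : pred I) (G : I -> S) :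
  SG j (\sum_(i <- r | P i) G i) = \sum_(i <- r | P i) SG j (G i).
Proof. by elim: j => //= j ->; rewrite sg_sum. Qed.
Lemma SGM j x y : SG j (x * y) = SG j x * SG j y.
Proof. by elim: j => //= j ->; rewrite sgM. Qed.
Lemma SGB j x y : SG j (x - y) = SG j x - SG j y.
Proof. by elim: j => //= j ->; rewrite sgB. Qed.
Lemma SGX j x k : SG j (x ^+ k) = SG j x ^+ k.
Proof. by elim: j => //= j ->; rewrite sgX. Qed.
Lemma SG_iota j x : SG j (iota x) = iota (sgi j x).
Proof. by elim: j => //= j ->; rewrite iota_sg. Qed.

Definition dwork m g := \sum_(j < m) iota (v j.+1) * SG j.+1 g.

Lemma dworkB m g h : dwork m (g - h) = dwork m g - dwork m h.
Proof.
by rewrite /dwork -sumrB; apply: eq_bigr => j _; rewrite SGB mulrBr.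
Qed.

Lemma dwork_fil m N g : F N g -> F (2 * N)%N (dwork m g).
Proof.
move=> h; apply: fil_sum => j _; apply: filMl; apply: filW (SG_fil j.+1 h).
rewrite leq_mul2r; apply/orP; right.
apply: (@leq_trans p); first exact: prime_gt1.
by rewrite -{1}(expn1 p) leq_pexp2l // prime_gt0.
Qed.

Lemma dwork_log m z : intg Phi z -> F 1%N z ->
  exists2 h, intg Phi h & F m.+1 (p%:R * LT m.+1 z - dwork m (LT m.+1 z) - p%:R * h).
Proof.
move=> zi z1; have p0 := prime_gt1 pp.
pose T j i := iota (v j.+1 * sgi j.+1 (ell i)).
pose E := \sum_(j < m) \sum_(i < m - j)
   T j i * ((z ^+ (p ^ j.+1)) ^+ (p ^ i) - (SG j.+1 z) ^+ (p ^ i)).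
exists (z + pinv Phi * E).
  apply: intgD => //; rewrite mulr_sumr; apply: intg_sum => j _.
  rewrite mulr_sumr; apply: intg_sum => i _.
  have [h1 h2] := frob_iter j.+1 PhiL zi.
  have h3 := pow_congrX i (intgX _ zi) h1 h2.
  set d := _ - _ in h3 *; set q := pinv Phi in h3 *.
  have -> : q * (T j i * d) =
     iota (v j.+1 * sgi j.+1 (p%:R ^+ i * ell i)) * (q ^+ i.+1 * d).
    rewrite sgiM sgiX sgi_nat /T !rmorphM rmorphXn rmorph_nat exprS.
    have {1}-> : q = p%:R ^+ i * q ^+ i * q by rewrite pinvX mul1r.
    by move: (p%:R : S) => pS; ring.
  apply: intgM => //; apply: iota_int; apply: intgM => //.
  by apply: sgi_int; apply: ell_int.
rewrite mulrDr mulrA pinvE mul1r.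
have -> : p%:R * LT m.+1 z = p%:R * z +
    \sum_(j < m) \sum_(i < m - j) T j i * (z ^+ (p ^ j.+1)) ^+ (p ^ i).
  rewrite /logT big_ord_recl mulrDr ell0 rmorph1 mul1r expn0 expr1; congr (_ + _).
  rewrite -(tri_sum (fun j i => T j i * (z ^+ (p ^ j.+1)) ^+ (p ^ i))) mulr_sumr.
  apply: eq_bigr => k _; rewrite lift0 mulrA -(rmorph_nat iota) -rmorphM.
  rewrite ell_tw rmorph_sum mulr_suml; apply: eq_bigr => j _.
  by rewrite -exprM -expnD addSn subnKC // -ltnS.
rewrite (_ : _ - (p%:R * z + E) = \sum_(j < m) \sum_(i < m - j)
   T j i * (SG j.+1 z) ^+ (p ^ i) - dwork m (LT m.+1 z)); last first.
  have -> : E = \sum_(j < m) \sum_(i < m - j) T j i * (z ^+ (p ^ j.+1)) ^+ (p ^ i) -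
    \sum_(j < m) \sum_(i < m - j) T j i * (SG j.+1 z) ^+ (p ^ i).
    rewrite -sumrB; apply: eq_bigr => j _; rewrite -sumrB; apply: eq_bigr => i _.
    by rewrite mulrBr.
  ring.
rewrite /dwork -sumrB; apply: fil_sum => j _.
rewrite /logT SG_sum mulr_sumr.
have -> : \sum_(i < m.+1) iota (v j.+1) * SG j.+1 (iota (ell i) * z ^+ (p ^ i)) =
   \sum_(i < m.+1) T j i * (SG j.+1 z) ^+ (p ^ i).
  by apply: eq_bigr => i _; rewrite SGM SG_iota SGX /T rmorphM mulrA.
apply: fil_sym.
have mj : (m - j <= m.+1)%N by rewrite (leq_trans (leq_subr _ _)).
rewrite (big_ord_widen _ (fun i => T j i * (SG j.+1 z) ^+ (p ^ i)) mj).
rewrite (bigID (fun i : 'I_m.+1 => (i < m - j)%N)) /= addrC addrK.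
apply: fil_sum => i; rewrite -leqNgt => hi; apply: filMl.
have /(filX (p ^ i)) := SG_fil j.+1 z1; apply: filW.
rewrite muln1 -expnD; apply: leq_trans (ltn_expl _ p0).
by rewrite addSn ltnS; lia.
Qed.

End Dwork.

Hypothesis fl : forall x, intg f x -> frob_lift f x.

Definition frob1 := ps_frob f pp.
Definition frob2 := ps_frob frob1 pp.
Definition iota2 : {rmorphism A -> ps (ps A)} := @psC (ps A) \o @psC A.

Lemma frob2_fil N x : fil2 A N x -> fil2 A (p * N)%N (sg frob2 x).
Proof.
apply: ps_sg_fil => M y; apply: ps_sg_fil => K z.
by move=> hz; rewrite /= /disc_fil muln_gt0 => /andP[_ K0]; rewrite hz // sg0.
Qed.

Lemma islog_int z1 z2 l1 l2 w : intg frob2 z1 -> intg frob2 z2 ->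
  fil2 A 1 z1 -> fil2 A 1 z2 -> fil2 A 1 w ->
  islog p divp v (fil2 A) iota2 z1 l1 -> islog p divp v (fil2 A) iota2 z2 l2 ->
  islog p divp v (fil2 A) iota2 w (l1 + l2) -> intg frob2 w.
Proof.
move=> i1 i2 f1 f2 fw L1 L2 Lw.
have isg x : sg frob2 (iota2 x) = iota2 (sg f x) by rewrite !ps_sgC.
have iint x : intg f x -> intg frob2 (iota2 x).
  by move=> hx a b; rewrite /= /psC; case: (a == 0%N); case: (b == 0%N) => //; apply: intg0.
have PL := ps_frob_lift (pp := pp) (ps_frob_lift (pp := pp) fl).
suff H n : forall a b, (a + b < n)%N -> intg f (w a b).
  by move=> a b; apply: (H (a + b).+1).
elim: n => // n IH a b; rewrite ltnS leq_eqVlt => /orP[/eqP ab|]; last exact: IH.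
case: (posnP n) => [n0|n0].
  by move/fil2P: fw => -> //; [apply: intg0 | rewrite ab n0].
pose z : ps (ps A) := fun a b => if (a + b < n)%N then w a b else 0.
have zi : intg frob2 z.
  by move=> c d; rewrite /z; case: ltnP => h; [apply: IH | apply: intg0].
have wz : fil2 A n (w - z).
  by apply/fil2P => c d cd; rewrite !psB /z cd subrr.
have zf : fil2 A 1 z.
  by apply/fil2P => c d cd; rewrite /z; case: ifP => // _; move/fil2P: fw => ->.
pose LT := logT p divp v iota2 n.+1.
have [h1 h1i H1] := dwork_log isg iint PL frob2_fil n i1 f1.
have [h2 h2i H2] := dwork_log isg iint PL frob2_fil n i2 f2.
have [h3 h3i H3] := dwork_log isg iint PL frob2_fil n zi zf.
rewrite -/LT in H1 H2 H3.
have e1 : fil2 A n.+1 (LT w - LT z1 - LT z2).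
  rewrite (ring_aux1 _ _ _ l1 l2).
  by apply: filB; [apply: filD; [apply: L1 | apply: L2] | apply: Lw].
have e2 : fil2 A n.+1 (LT w - LT z - (w - z)).
  rewrite /LT /logT -sumrB big_ord_recl ell0 !rmorph1 !mul1r expn0 !expr1 addrC addKr.
  apply: fil_sum => k _; rewrite -mulrBr; apply: filMl.
  rewrite lift0; have [q e] : exists q, (p ^ k.+1 = q.+2)%N.
    have : (1 < p ^ k.+1)%N by apply: leq_trans (ltn_expl _ (prime_gt1 pp)).
    by case: (p ^ _)%N => [|[|q]] // _; exists q.
  by rewrite e; apply: filW (filXB q.+1 fw zf wz); rewrite addnS ltnS leq_addr.
set D := dwork iota2 frob2 n in H1 H2 H3; set h := h1 + h2 - h3.
have e3 : fil2 A n.+1 (p%:R * ((w - z) - h)).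
  have d1 : fil2 A n.+1 (D (LT w) - D (LT z1) - D (LT z2)).
    have <- : D (LT w - LT z1 - LT z2) = D (LT w) - D (LT z1) - D (LT z2).
      by rewrite /D dworkB dworkB.
    apply: (@filW _ _ _ (2 * n.+1)%N); first by lia.
    by apply: dwork_fil => //; exact: frob2_fil.
  have d2 : fil2 A n.+1 (D (LT w) - D (LT z)).
    have <- : D (LT w - LT z) = D (LT w) - D (LT z) by exact: dworkB.
    apply: (@filW _ _ _ (2 * n)%N); first by lia.
    apply: dwork_fil; first exact: frob2_fil.
    by have := filD (filW (leqnSn n) e2) wz; rewrite subrK.
  have -> := ring_aux2 p%:R w z h1 h2 h3 (LT w) (LT z1) (LT z2) (LT z)
    (D (LT w)) (D (LT z1)) (D (LT z2)) (D (LT z)).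
  apply: filD d2; apply: filB d1; apply: filB; last exact: filMl.
  by apply: filD; [apply: filB => //; apply: filD | apply: filMl].
have e4 : fil2 A n.+1 ((w - z) - h).
  rewrite -[_ - h]mul1r -(pinvE frob2) [_ * pinv _]mulrC -mulrA.
  exact: filMl.
move/fil2P: e4 => /(_ a b); rewrite ab ltnSn => /(_ isT).
rewrite !psB => /subr0_eq e.
rewrite -(subrK (z a b) (w a b)) e.
by apply: intgD; [apply: intgB; [apply: intgD; [apply: h1i | apply: h2i] | apply: h3i] | apply: zi].
Qed.

End Ell.

(** * Integrality of the formal group law *)

Section Emb.
Variable A : comNzRingType.

Definition emb (f : ps A) : ps (ps A) := fun n => psC (f n).

Fact emb_is_zmod_morphism : zmod_morphism emb.
Proof. by move=> f g; apply/funext=> n; rewrite psB /emb psB rmorphB. Qed.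

Fact emb_is_monoid_morphism : monoid_morphism emb.
Proof.
split=> [|f g]; apply/funext=> n; rewrite /emb.
  by rewrite !ps1; case: (n == 0%N); rewrite ?rmorph1 ?rmorph0.
by rewrite !psM rmorph_sum; apply: eq_bigr => i _; rewrite rmorphM.
Qed.

HB.instance Definition _ :=
  GRing.isZmodMorphism.Build (ps A) (ps (ps A)) emb emb_is_zmod_morphism.
HB.instance Definition _ :=
  GRing.isMonoidMorphism.Build (ps A) (ps (ps A)) emb emb_is_monoid_morphism.

Lemma embC c : emb (psC c) = psC (psC c).
Proof. by apply/funext=> -[|n]; rewrite /emb /psC //=; apply/funext=> -[]. Qed.

Lemma embX : emb psX = psX.
Proof.
by apply/funext=> n; rewrite /emb /psX; case: (n == 1%N); rewrite ?rmorph1 ?rmorph0.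
Qed.

Lemma emb_fil N f : fil1 A N f -> fil2 A N (emb f).
Proof.
move/fil1P=> h; apply/fil2P => a b ab; rewrite /emb /psC; case: (b == 0%N) => //.
by apply: h; lia.
Qed.

Lemma psC_fil N (f : ps A) : fil1 A N f -> fil2 A N (psC f).
Proof.
move/fil1P=> h; apply/fil2P => a b ab; rewrite /psC; case: (a == 0%N) => //.
by apply: h; lia.
Qed.

Lemma psC_emb (g h : ps A) n b : (psC g * emb h) n b = g b * h n.
Proof. by rewrite psCM mulrC psCM mulrC. Qed.

Lemma coef_sumX (g : ps A) N b : (b < N)%N ->
  (\sum_(k < N) psC (g k) * psX ^+ k) b = g b.
Proof.
move=> bN; rewrite ps_sum (bigD1 (Ordinal bN)) //= psCM psXn eqxx mulr1.
rewrite big1 ?addr0 // => i; rewrite -val_eqE /= => ib.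
by rewrite psCM psXn eq_sym (negbTE ib) mulr0.
Qed.

End Emb.

Section Fgl.
Variables (A : comNzRingType) (p : nat) (divp : A -> A) (v : nat -> A).
Hypothesis pp : prime p.
Let p1 : (1 < p)%N := prime_gt1 pp.

Local Notation ell := (gell p divp v).
Local Notation logc := (glogc p divp v).
Local Notation fgl := (gfgl p divp v).
Local Notation fadd := (gfadd p divp v).
Local Notation fmul := (gfmul p divp v).
Local Notation faddx := (gfaddx p divp v).
Local Notation islog1 := (islog p divp v (fil1 A) (@psC A)).
Local Notation islog2 := (islog p divp v (fil2 A) (@iota2 A)).

Lemma fil1X : fil1 A 1 psX.
Proof. by apply/fil1P => -[]. Qed.

Lemma islog1_X : islog1 psX logc.
Proof.
move=> N; apply: fil_trans (fil_sym (logcT divp v (@psC A) p1 N fil1X)).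
by apply/fil1P => n nN; rewrite psB /ev coef_sumX // subrr.
Qed.

Lemma islog_emb a la : islog1 a la -> islog2 (emb a) (emb la).
Proof.
move=> h N; have := emb_fil (h N); rewrite rmorphB /logT rmorph_sum.
rewrite (eq_bigr (fun k : 'I_N => iota2 A (ell k) * emb a ^+ (p ^ k))) //.
by move=> k _; rewrite rmorphM rmorphXn /= embC.
Qed.

Lemma islog_psC a la : islog1 a la -> islog2 (psC a) (psC la).
Proof.
move=> h N; have := psC_fil (h N); rewrite rmorphB /logT rmorph_sum.
rewrite (eq_bigr (fun k : 'I_N => iota2 A (ell k) * psC a ^+ (p ^ k))) //.
by move=> k _; rewrite rmorphM rmorphXn.
Qed.

Lemma islog_fadd a b la lb : fil1 A 1 a -> fil1 A 1 b ->
  islog1 a la -> islog1 b lb -> islog1 (fadd a b) (la + lb).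
Proof.
move=> ha hb hla hlb; apply: (islog_fgl p1 ha hb hla hlb) => N.
apply/fil1P => n nN; rewrite psB; apply/eqP; rewrite subr_eq0; apply/eqP.
rewrite /ev2 /ev ps_sum /gfadd.
pose G j k : A := fgl j k * (a ^+ j * b ^+ k) n.
have z j k : (n < j)%N || (n < k)%N -> G j k = 0.
  move=> h; rewrite /G; have /fil1P -> := filM (filX1 j ha) (filX1 k hb).
    by rewrite mulr0.
  by case/orP: h; lia.
transitivity (\sum_(j < N) \sum_(k < N) G j k); last first.
  apply: eq_bigr => j _; rewrite mulr_suml ps_sum; apply: eq_bigr => k _.
  by rewrite -mulrA psCM [b ^+ k * _]mulrC.
rewrite (big_ord_widen N (fun j => \sum_(k < n.+1) fgl j k *
   (@ps_mul A (gspow a j) (gspow b k)) n)) // big_mkcond; apply: eq_bigr => j _.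
case: ifP => [jn|/negbT]; last first.
  by rewrite -leqNgt => jn; rewrite big1 // => k _; apply: z; rewrite jn.
rewrite (big_ord_widen N (fun k => fgl j k *
   (@ps_mul A (gspow a j) (gspow b k)) n)) // big_mkcond; apply: eq_bigr => k _.
case: ifP => [kn|/negbT]; first by rewrite !gspowE.
by rewrite -leqNgt => kn; rewrite z // kn orbT.
Qed.

Lemma fadd_fil a b : fil1 A 1 a -> fil1 A 1 b -> fil1 A 1 (fadd a b).
Proof.
move=> ha hb; apply/fil1P => -[] // _; rewrite /gfadd !big_ord1.
by rewrite /gfgl big_ord1 expc0 !mul0r.
Qed.

Lemma fmul_fil i : fil1 A 1 (fmul i).
Proof.
elim: i => [|i IH]; first by apply/fil1P.
by apply: fadd_fil => //; apply: fil1X.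
Qed.

Lemma islog_fmul i : islog1 (fmul i) ((logc : ps A) *+ i).
Proof.
elim: i => [|i IH].
  move=> N; rewrite mulr0n /logT big1 ?subrr; first exact: fil0.
  move=> k _; rewrite (_ : fmul 0 = 0) // expr0n expn_eq0 gtn_eqF ?mulr0 //.
  exact: ltnW.
rewrite mulrSr; apply: islog_fadd => //; [exact: fmul_fil | exact: fil1X | exact: islog1_X].
Qed.

Lemma islog_faddx a la : fil1 A 1 a -> islog1 a la ->
  islog2 (faddx a) (emb la + psC (logc : ps A)).
Proof.
move=> ha hla.
apply: (islog_fgl p1 (emb_fil ha) (psC_fil fil1X) (islog_emb hla) (islog_psC islog1_X)) => N.
apply/fil2P => n b nb; rewrite !psB; apply/eqP; rewrite subr_eq0; apply/eqP.
rewrite /ev2 /ev !ps_sum /gfaddx.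
have [nN bN] : (n < N)%N /\ (b < N)%N by lia.
transitivity (\sum_(j < N) fgl j b * (a ^+ j) n).
  rewrite (big_ord_widen N (fun j => fgl j b * gspow a j n)) // big_mkcond.
  apply: eq_bigr => j _; rewrite gspowE; case: ltnP => // nj.
  by have /fil1P -> := filX1 j ha; rewrite ?mulr0.
apply: eq_bigr => j _.
have -> : \sum_(k < N) iota2 A (fgl j k) * psC psX ^+ k =
          psC (\sum_(k < N) psC (fgl j k) * psX ^+ k).
  by rewrite rmorph_sum; apply: eq_bigr => k _; rewrite rmorphM rmorphXn.
by rewrite -rmorphXn psC_emb coef_sumX.
Qed.

Lemma faddx_fil a : fil1 A 1 a -> fil2 A 1 (faddx a).
Proof.
move=> ha; apply/fil2P => -[|n] [|b] // _.
by rewrite /gfaddx big_ord1 /gfgl big_ord1 expc0 !mul0r.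
Qed.

Lemma faddxX : faddx psX = fgl.
Proof.
apply/funext=> n; apply/funext=> b; rewrite /gfaddx (bigD1 ord_max) //=.
rewrite gspowE psXn eqxx mulr1 big1 ?addr0 // => i; rewrite -val_eqE /= => ni.
by rewrite gspowE psXn eq_sym (negbTE ni) mulr0.
Qed.

Lemma logc_pow k : logc (p ^ k) = ell k.
Proof.
rewrite /glogc; have kp : (k < (p ^ k).+1)%N by rewrite ltnS ltnW // ltn_expl.
rewrite (bigD1 (Ordinal kp)) //= eqxx mul1r big1 ?addr0 // => i.
by rewrite -val_eqE /= eqn_exp2l // eq_sym => /negbTE ->; rewrite mul0r.
Qed.

Lemma logc_npow j : (forall k, j != p ^ k)%N -> logc j = 0.
Proof. by move=> h; rewrite /glogc big1 // => i _; rewrite (negbTE (h i)) mul0r. Qed.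

Hypothesis divpE : forall x, p%:R * divp x = x.
Variable f : frob0 p A.
Hypothesis v_int : forall j, intg f (v j).
Hypothesis sgv : forall j, sg f (v j) = v j ^+ p.
Hypothesis fl : forall x, intg f x -> frob_lift f x.
Local Notation int1 := (intg (frob1 pp f)).
Local Notation int2 := (intg (frob2 pp f)).

Lemma X_int : int1 psX.
Proof. by move=> n; apply: intg_nat. Qed.

Lemma psC_int (g : ps A) : int1 g -> int2 (psC g).
Proof. by move=> hg a b; rewrite /psC; case: (a == 0%N); [apply: hg | apply: intg0]. Qed.

Lemma emb_int (g : ps A) : int1 g -> int2 (emb g).
Proof. by move=> hg a b; rewrite /emb /psC; case: (b == 0%N); [apply: hg | apply: intg0]. Qed.

Lemma fgl_int : int2 fgl.
Proof.
have h1 := fil1X; rewrite -faddxX.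
apply: (islog_int divpE v_int sgv fl (emb_int X_int) (psC_int X_int)
   (emb_fil h1) (psC_fil h1) (faddx_fil h1) (islog_emb islog1_X)
   (islog_psC islog1_X)).
by apply: islog_faddx => //; apply: islog1_X.
Qed.

Lemma fadd_int a b : int1 a -> int1 b -> int1 (fadd a b).
Proof.
move=> ha hb n; apply: intg_sum => j _; apply: intg_sum => k _; rewrite !gspowE.
apply: intgM; first exact: fgl_int.
by apply: (@intgM _ _ (frob1 pp f)); apply: intgX.
Qed.

Lemma fmul_int i : int1 (fmul i).
Proof.
elim: i => [|i IH]; first by move=> n; apply: intg0.
by apply: fadd_int => //; apply: X_int.
Qed.

Lemma faddx_int a : int1 a -> int2 (faddx a).
Proof.
move=> ha n b; apply: intg_sum => j _; rewrite gspowE; apply: intgM.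
  exact: fgl_int.
exact: (intgX _ ha).
Qed.

Local Notation angle := (ganglep p divp v).

Lemma angle_int : int1 angle.
Proof. by move=> n; apply: fmul_int. Qed.

Lemma XangleE : psX * angle = fmul p.
Proof.
apply/funext=> -[|n]; rewrite psXM //.
by have /fil1P -> := fmul_fil p.
Qed.

Lemma angle_low n : (n < p)%N ->
  angle n = if n == 0%N then p%:R else if n == p.-1 then v 1 * (1 - p%:R ^+ p.-1) else 0.
Proof.
move=> np; have pgt0 := ltnW p1.
have e1 : p%:R * ell 1 = v 1.
  by rewrite (ell_untw v divpE) // big_ord1 ell0 mul1r expn0 expr1.
have /fil1P/(_ n.+1) := islogD p1 2 (fmul_fil p) (islog_fmul p).
have np2 : (n.+1 < p ^ 2)%N.
  by rewrite -mulnn; apply: leq_ltn_trans np _; rewrite -{1}(muln1 p) ltn_pmul2l.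
move=> /(_ np2); rewrite psB psMn /logT !big_ord_recl big_ord0 addr0 psD !psCM ell0.
rewrite mul1r expn0 expr1 lift0 expn1 -XangleE psXM exprMn psXnM.
move/eqP; rewrite subr_eq0 => /eqP.
case: eqP => [->|/eqP n0].
  by rewrite p1 mulr0 addr0 (logc1 divp v p1) => <-.
case: eqP => [npE|/eqP npN].
  have -> : n.+1 = p by rewrite npE prednK.
  have lp : logc p = ell 1 by rewrite -(logc_pow 1) expn1.
  rewrite ltnn subnn lp -[ell 1 *+ p]mulr_natl e1.
  have -> : (angle ^+ p) 0%N = p%:R ^+ p.
    have a0 : angle 0%N = p%:R.
      have /fil1P/(_ 1%N) := islogD p1 1 (fmul_fil p) (islog_fmul p).
      rewrite expn1 => /(_ p1); rewrite psB psMn /logT big_ord_recl big_ord0 addr0.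
      rewrite psCM ell0 mul1r expn0 expr1 -XangleE psXM (logc1 divp v p1).
      by move/eqP; rewrite subr_eq0 => /eqP <-.
    have aX k : (angle ^+ k) 0%N = angle 0%N ^+ k.
      elim: k => [|k IH]; first by rewrite !expr0 ps1.
      by rewrite !exprS psM big_ord1 subn0 IH.
    by rewrite aX a0.
  have -> : p%:R ^+ p = p%:R * p%:R ^+ p.-1 :> A by rewrite -exprS prednK.
  rewrite mulrA [ell 1 * _]mulrC e1 mulrBr mulr1 => e.
  by apply: (@addIr _ (v 1 * p%:R ^+ p.-1)); rewrite subrK -e.
have h : (n.+1 < p)%N by rewrite ltn_neqAle np andbT; apply: contra npN => /eqP <-.
rewrite h mulr0 addr0 => <-; rewrite logc_npow ?mul0rn // => k.
case: k => [|k]; first by rewrite expn0 eqSS.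
by rewrite ltn_eqF // (leq_trans h) // -{1}(expn1 p) leq_pexp2l.
Qed.

End Fgl.

(** * The weight filtration *)

Record subr (V : comNzRingType) := Subr {
  sr :> V -> Prop;
  sr1 : sr 1;
  srB : forall x y, sr x -> sr y -> sr (x - y);
  srM : forall x y, sr x -> sr y -> sr (x * y) }.

Record idl (V : comNzRingType) (s : subr V) := Idl {
  il :> V -> Prop;
  il_sr : forall x, il x -> s x;
  il0 : il 0;
  ilD : forall x y, il x -> il y -> il (x + y);
  ilM : forall a x, s a -> il x -> il (a * x) }.

Section IdealTheory.
Variables (V : comNzRingType) (s : subr V).
Implicit Types (x y z : V) (J : idl s).

Lemma sr0 : s 0. Proof. by rewrite -(subrr 1); apply: srB; apply: sr1. Qed.
Lemma srN x : s x -> s (- x).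
Proof. by move=> h; rewrite -sub0r; apply: srB => //; apply: sr0. Qed.
Lemma srD x y : s x -> s y -> s (x + y).
Proof. by move=> hx hy; rewrite -(opprK y); apply: srB => //; apply: srN. Qed.
Lemma srX x k : s x -> s (x ^+ k).
Proof.
by move=> h; elim: k => [|k IH]; [apply: sr1 | rewrite exprS; apply: srM].
Qed.
Lemma sr_nat k : s k%:R.
Proof. by elim: k => [|k IH]; [apply: sr0 | rewrite mulrS; apply: srD => //; apply: sr1]. Qed.
Lemma sr_sum (I : Type) (r : seq I) (P : pred I) (G : I -> V) :
  (forall i, P i -> s (G i)) -> s (\sum_(i <- r | P i) G i).
Proof.
move=> h; elim/big_rec: _ => [|i x Pi hx]; first exact: sr0.
by apply: srD => //; apply: h.
Qed.

Section One.
Variable J : idl s.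

Lemma ilN x : J x -> J (- x).
Proof. by rewrite -mulN1r; apply: ilM; apply: srN; apply: sr1. Qed.
Lemma ilB x y : J x -> J y -> J (x - y).
Proof. by move=> hx hy; apply: ilD => //; apply: ilN. Qed.
Lemma ilMr x a : s a -> J x -> J (x * a).
Proof. by rewrite mulrC; apply: ilM. Qed.
Lemma il_sum (I : Type) (r : seq I) (P : pred I) (G : I -> V) :
  (forall i, P i -> J (G i)) -> J (\sum_(i <- r | P i) G i).
Proof.
move=> h; elim/big_rec: _ => [|i x Pi hx]; first exact: il0.
by apply: ilD => //; apply: h.
Qed.

Lemma il_refl x : J (x - x). Proof. by rewrite subrr; apply: il0. Qed.
Lemma il_trans x y z : J (x - y) -> J (y - z) -> J (x - z).
Proof. by move=> h1 h2; rewrite -(subrK y x) -addrA; apply: ilD. Qed.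
Lemma il_sym x y : J (x - y) -> J (y - x).
Proof. by move=> h; rewrite -opprB; apply: ilN. Qed.
Lemma ilDc x x' y y' : J (x - x') -> J (y - y') -> J (x + y - (x' + y')).
Proof. by move=> h1 h2; rewrite opprD addrACA; apply: ilD. Qed.
Lemma ilBc x x' y y' : J (x - x') -> J (y - y') -> J (x - y - (x' - y')).
Proof.
move=> h1 h2; rewrite (_ : _ - _ = (x - x') - (y - y')); last by ring.
exact: ilB.
Qed.
Lemma ilMc x x' y y' : s y -> s x' -> J (x - x') -> J (y - y') -> J (x * y - x' * y').
Proof.
move=> sy sx hx hy; rewrite (_ : _ - _ = (x - x') * y + x' * (y - y')); last by ring.
by apply: ilD; [apply: ilMr | apply: ilM].
Qed.
Lemma ilXc x y k : s x -> s y -> J (x - y) -> J (x ^+ k - y ^+ k).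
Proof.
move=> sx sy h; elim: k => [|k IH]; first exact: il_refl.
by rewrite !exprS; apply: ilMc => //; apply: srX.
Qed.

(* Newton interpolation: a monic polynomial of degree n vanishing at n points
   whose differences are units is the product of the linear factors. *)
Lemma monic_roots (ys : seq V) (q : {poly V}) :
  q \is monic -> size q = (size ys).+1 -> (forall k, s q`_k) ->
  (forall y, y \in ys -> s y /\ J q.[y]) ->
  (forall i j, (i < j < size ys)%N ->
     exists2 u, s u & J ((ys`_j - ys`_i) * u - 1)) ->
  J (q.[0] - \prod_(y <- ys) (- y)).
Proof.
elim: ys q => [|y0 ys IH] q qm sq qs qy qd.
  have e : lead_coef q = 1 by apply/eqP.
  rewrite horner_coef0 big_nil; move: e; rewrite lead_coefE sq /= => ->.
  exact: il_refl.
have [sy0 Jy0] := qy _ (mem_head _ _).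
have [q1 e] : exists q1, q - q.[y0]%:P = q1 * ('X - y0%:P).
  by apply/factor_theorem; rewrite /root hornerD hornerN hornerC subrr.
have qE : q = q1 * ('X - y0%:P) + q.[y0]%:P by rewrite -e subrK.
have sq' : size (q - q.[y0]%:P) = (size ys).+2.
  by rewrite size_polyDl sq // size_polyN (leq_ltn_trans (size_polyC_leq1 _)).
have q1n : q1 != 0 by apply/eqP=> z; move: sq'; rewrite e z mul0r size_poly0.
have sq1 : size q1 = (size ys).+1.
  by move: sq'; rewrite e size_Mmonic ?monicXsubC // size_XsubC addn2 /= => -[].
have q1m : q1 \is monic.
  have : lead_coef (q1 * ('X - y0%:P)) = 1.
    rewrite -e lead_coefDl ?(eqP qm) // size_polyN sq.
    exact: leq_ltn_trans (size_polyC_leq1 _) _.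
  by rewrite lead_coef_Mmonic ?monicXsubC // => h; apply/eqP.
have q1s k : s q1`_k.
  have [m hm] := ubnP (size q1 - k).
  elim: m k hm => // m IHm k hm.
  case: (leqP (size q1) k) => hk; first by rewrite nth_default //; apply: sr0.
  have -> : q1`_k = q`_k.+1 + y0 * q1`_k.+1.
    rewrite {1}qE coefD coefC addr0 mulrBr coefB coefMX coefMC /= mulrC.
    by rewrite subrK.
  apply: srD => //; apply: srM => //; apply: IHm; lia.
have q1v y : s y -> s q1.[y].
  move=> sy; rewrite horner_coef; apply: sr_sum => i _.
  by apply: srM => //; apply: srX.
have h1 : J (q1.[0] - \prod_(y <- ys) (- y)).
  apply: IH => //; last by move=> i j ij; apply: (qd i.+1 j.+1).
  move=> y yy; have [sy Jy] : s y /\ J q.[y] by apply: qy; rewrite inE yy orbT.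
  split=> //.
  have ij : (0 < (index y ys).+1 < (size ys).+1)%N by rewrite /= ltnS index_mem.
  have [u su] := qd _ _ ij; rewrite /= nth_index // => Ju.
  have -> : q1.[y] = u * (q.[y] - q.[y0]) - q1.[y] * ((y - y0) * u - 1).
    rewrite {1}qE hornerD hornerM hornerC hornerXsubC addrK; ring.
  apply: ilB; last by apply: ilM => //; exact: q1v.
  by apply: ilM => //; apply: ilB.
rewrite {1}qE hornerD hornerM hornerC hornerXsubC sub0r big_cons.
have -> : q1.[0] * - y0 + q.[y0] - - y0 * \prod_(y <- ys) - y =
   q.[y0] - y0 * (q1.[0] - \prod_(y <- ys) - y) by ring.
by apply: ilB => //; apply: ilM.
Qed.

Definition il_add (d : V) (sd : s d) : idl s.
Proof.
exists (fun x => s x /\ exists2 t, s t & J (x - d * t)).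
- by move=> x [].
- split; first exact: sr0.
  by exists 0; [exact: sr0 | rewrite mulr0 subrr; apply: il0].
- move=> x y [sx [t st ht]] [sy [u su hu]]; split; first exact: srD.
  by exists (t + u); [exact: srD | rewrite mulrDr; apply: ilDc].
- move=> a x sa [sx [t st ht]]; split; first exact: srM.
  exists (a * t); first exact: srM.
  by rewrite mulrCA -mulrBr; apply: ilM.
Defined.

(* y^p = A(y) follows from the equation of y once it holds modulo the ideal
   generated by the defect d = y^p - A(y), because eps and phi are nilpotent. *)
Lemma defect_il (d eps phi x1 x2 : V) (sd : s d) a b :
  s eps -> s phi -> J (eps ^+ a) -> J (phi ^+ b) ->
  il_add sd x1 -> il_add sd x2 -> J (d - (eps * x1 + phi * x2)) -> J d.
Proof.
move=> se sp Je Jp [sx1 [t1 st1 h1]] [sx2 [t2 st2 h2]] h.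
pose w := eps * t1 + phi * t2.
have sw : s w by apply: srD; apply: srM.
have hd : J (d - d * w).
  apply: il_trans h _.
  have -> : d * w = eps * (d * t1) + phi * (d * t2) by rewrite /w; ring.
  by apply: ilDc; rewrite -mulrBr; apply: ilM.
have hw : J (w ^+ (a + b)).
  rewrite /w exprDn; apply: il_sum => i _; rewrite -mulr_natr.
  apply: ilMr; first exact: sr_nat.
  have JX z m n : s z -> J (z ^+ m) -> (m <= n)%N -> J (z ^+ n).
    by move=> sz hz mn; rewrite -(subnK mn) exprD; apply: ilM => //; apply: srX.
  rewrite !exprMn; case: (leqP b i) => hi.
    apply: ilM; first by apply: srM; apply: srX.
    by apply: ilMr; [apply: srX | apply: JX hi].
  apply: ilMr; first by apply: srM; apply: srX.
  by apply: ilMr; [apply: srX | apply: (JX _ a) => //; lia].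
have hk k : J (d - d * w ^+ k).
  elim: k => [|k IH]; first by rewrite mulr1; apply: il_refl.
  apply: il_trans hd _; rewrite exprSr mulrA -mulrBl; exact: ilMr.
by rewrite -(subrK (d * w ^+ (a + b)) d); apply: ilD => //; apply: ilM.
Qed.

End One.
End IdealTheory.

Section Hat.
Variables (p : nat) (S : comNzRingType) (Phi : frob0 p S) (X angle r : S) (c : nat).
Local Notation int := (intg Phi).
Local Notation P := (p%:R : S).
Hypotheses (iX : int X) (ia : int angle) (ir : int r).
Hypothesis angleE : angle = P + X ^+ c * r.

Definition inI k x := exists t h, [/\ int t, int h & x = angle * t + X ^+ k * h].

Hypothesis inI_div : forall k x, int x -> inI (k + c) (P * x) -> inI k x.

Definition hat k x := exists a, inI (k + a * c) (P ^+ a * x).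

Lemma inI_intg k x : inI k x -> int x.
Proof.
case=> t [h [it ih ->]]; apply: intgD; apply: intgM => //; exact: intgX.
Qed.

Lemma inI0 k x : int x -> inI k (X ^+ k * x).
Proof. by move=> ix; exists 0, x; split=> //; [apply: intg0 | rewrite mulr0 add0r]. Qed.

Lemma inI_angle k x : int x -> inI k (angle * x).
Proof. by move=> ix; exists x, 0; split=> //; [apply: intg0 | rewrite mulr0 addr0]. Qed.

Lemma inID k x y : inI k x -> inI k y -> inI k (x + y).
Proof.
move=> [t [h [it ih ->]]] [t' [h' [it' ih' ->]]]; exists (t + t'), (h + h').
by split; [exact: intgD | exact: intgD | ring].
Qed.

Lemma inIM j k x y : inI j x -> inI k y -> inI (j + k) (x * y).
Proof.
move=> [t [h [it ih ->]]] [t' [h' [it' ih' ->]]].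
exists (t * (angle * t' + X ^+ k * h') + X ^+ j * h * t'), (h * h').
have [ij ik] := (intgX j iX, intgX k iX).
split; last by rewrite exprD; ring.
  by apply: intgD; apply: intgM => //; [apply: intgD; apply: intgM | apply: intgM].
exact: intgM.
Qed.

Lemma inIW j k x : (j <= k)%N -> inI k x -> inI j x.
Proof.
move=> jk [t [h [it ih ->]]]; exists t, (X ^+ (k - j) * h); split=> //.
  by apply: intgM => //; apply: intgX.
by rewrite mulrA -exprD subnKC.
Qed.

Lemma inI_P : inI c P.
Proof.
exists 1, (- r); split; [exact: intg1 | exact: intgN |].
by rewrite angleE mulr1 mulrN addrK.
Qed.

Lemma inI_PX a k x : inI k x -> inI (k + a * c) (P ^+ a * x).
Proof.
move=> h; elim: a => [|a IH]; first by rewrite mul1r addn0.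
by rewrite mulSn addnCA exprS -mulrA; apply: inIM => //; apply: inI_P.
Qed.

Lemma hat_lift k x a b : inI (k + a * c) (P ^+ a * x) -> (a <= b)%N ->
  inI (k + b * c) (P ^+ b * x).
Proof.
move=> h ab; have := inI_PX (b - a) h.
by rewrite mulrA -exprD subnK // -addnA -mulnDl subnKC.
Qed.

Lemma inI_hat k x : inI k x -> hat k x.
Proof. by move=> h; exists 0%N; rewrite addn0 mul1r. Qed.

Lemma intg_hat x : int x -> hat 0 x.
Proof. by move=> h; apply: inI_hat; rewrite -[x]mul1r; apply: (@inI0 0). Qed.

Lemma hatD k x y : hat k x -> hat k y -> hat k (x + y).
Proof.
move=> [a ha] [b hb]; exists (maxn a b); rewrite mulrDr; apply: inID.
  by apply: hat_lift ha _; rewrite leq_maxl.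
by apply: hat_lift hb _; rewrite leq_maxr.
Qed.

Lemma hatM j k x y : hat j x -> hat k y -> hat (j + k) (x * y).
Proof.
move=> [a ha] [b hb]; exists (a + b)%N; rewrite mulnDl addnACA exprD mulrACA.
exact: inIM.
Qed.

Lemma hatMl k x y : hat 0 x -> hat k y -> hat k (x * y).
Proof. exact: hatM. Qed.

Lemma hatW j k x : (j <= k)%N -> hat k x -> hat j x.
Proof. by move=> jk [a ha]; exists a; apply: inIW ha; rewrite leq_add2r. Qed.

Lemma hat1 : hat 0 1. Proof. by apply: intg_hat; apply: intg1. Qed.

Lemma hatN k x : hat k x -> hat k (- x).
Proof. by move=> h; rewrite -mulN1r; apply: hatMl => //; apply: intg_hat; apply: intgN; apply: intg1. Qed.

Lemma hatB k x y : hat k x -> hat k y -> hat k (x - y).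
Proof. by move=> hx hy; apply: hatD => //; apply: hatN. Qed.

Lemma hat0 k : hat k 0.
Proof. by apply: inI_hat; rewrite -(mulr0 (X ^+ k)); apply: inI0; apply: intg0. Qed.

Lemma hatX a x k : hat a x -> hat (a * k) (x ^+ k).
Proof.
move=> hx; elim: k => [|k IH]; first by rewrite muln0; apply: hat1.
by rewrite exprS mulnS; apply: hatM.
Qed.

Lemma hat_P a : hat (a * c) (P ^+ a).
Proof. by apply: inI_hat; rewrite -[_ ^+ a]mulr1; apply: (@inI_PX a 0); rewrite -[1]mul1r; apply: (@inI0 0); apply: intg1. Qed.

Lemma hat_divX a k x : hat (k + a * c) (P ^+ a * x) -> hat k x.
Proof.
case=> b h; exists (a + b)%N; move: h; rewrite -addnA -mulnDl mulrA -exprD.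
by rewrite [(b + a)%N]addnC.
Qed.

Lemma hat_inI k x : int x -> hat k x -> inI k x.
Proof.
move=> ix [a]; elim: a k => [|a IH] k; first by rewrite addn0 mul1r.
rewrite mulSnr addnA exprS -mulrA => h; apply: IH; apply: inI_div => //.
by apply: intgM => //; apply: intgX; apply: intg_nat.
Qed.

Definition hat_subr : subr S.
Proof. by exists (hat 0); [exact: hat1 | exact: hatB | exact: hatMl]. Defined.

Definition hat_idl (B : nat) : idl hat_subr.
Proof.
exists (hat B) => [x|||].
- exact: hatW.
- exact: hat0.
- exact: hatD.
- exact: hatMl.
Defined.

Definition psv_subr : subr (ps S).
Proof.
exists (fun f => forall b, hat 0 (f b)).
- by move=> b; rewrite ps1; apply: intg_hat; apply: intg_nat.
- by move=> x y hx hy b; rewrite psB; apply: hatB.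
- move=> x y hx hy b; rewrite psM.
  by apply: (@sr_sum _ hat_subr) => i _; apply: hatMl.
Defined.

(* Power series with coefficients in [hat 0], the first M of them in [hat B]. *)
Definition psv_idl (M B : nat) : idl psv_subr.
Proof.
exists (fun f => (forall b, hat 0 (f b)) /\ forall b, (b < M)%N -> hat B (f b)).
- by move=> x [].
- by split=> *; apply: hat0.
- move=> x y [hx hx'] [hy hy']; split=> [b|b hb]; rewrite psD; apply: hatD => //.
  + exact: hx'.
  + exact: hy'.
- move=> a x ha [hx hx']; split=> b; rewrite psM.
    by apply: (@sr_sum _ hat_subr) => i _; apply: hatMl.
  move=> hb; apply: (@il_sum _ _ (hat_idl B)) => i _; apply: hatMl => //.
  by apply: hx'; apply: leq_ltn_trans hb; apply: leq_subr.
Defined.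

End Hat.

(** * Reflected polynomial arithmetic *)

Section ListPoly.
Variables (T : Type) (z : T) (isz : T -> bool) (add mul : T -> T -> T).

Fixpoint padd (s t : seq T) : seq T :=
  match s, t with
  | [::], _ => t
  | _, [::] => s
  | a :: s', b :: t' => add a b :: padd s' t'
  end.

Definition pscale a (t : seq T) := if isz a then [::] else map (mul a) t.

Fixpoint pmul (s t : seq T) : seq T :=
  if s is a :: s' then padd (pscale a t) (z :: pmul s' t) else [::].

Fixpoint pmul_trunc n (s t : seq T) : seq T :=
  match n, s with
  | n'.+1, a :: s' => padd (pscale a (take n t)) (z :: pmul_trunc n' s' t)
  | _, _ => [::]
  end.

Variables (V : comNzRingType) (s : subr V) (J : idl s) (ev : T -> V) (x : V).
Hypothesis evz : ev z = 0.
Hypothesis iszP : forall a, isz a -> ev a = 0.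
Hypothesis evS : forall a, s (ev a).
Hypothesis evD : forall a b, ev (add a b) = ev a + ev b.
Hypothesis evM : forall a b, J (ev (mul a b) - ev a * ev b).
Hypothesis sx : s x.

Definition pev (l : seq T) : V := foldr (fun a r => ev a + x * r) 0 l.

Lemma pevS l : s (pev l).
Proof. by elim: l => [|a l IH] /=; [apply: sr0 | apply: srD => //; apply: srM]. Qed.

Lemma pevD l m : pev (padd l m) = pev l + pev m.
Proof.
elim: l m => [|a l IH] [|b m] /=; rewrite ?add0r ?addr0 // evD IH; ring.
Qed.

Lemma pev_isz l : all isz l -> pev l = 0.
Proof. by elim: l => //= a l IH /andP[/iszP -> /IH ->]; rewrite mulr0 addr0. Qed.

Lemma pev_scale a l : J (pev (pscale a l) - ev a * pev l).
Proof.
rewrite /pscale; case: ifP => [/iszP ->|_]; first by rewrite mul0r subrr; apply: il0.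
elim: l => [|b l IH] /=; first by rewrite mulr0 subrr; apply: il0.
have -> : ev a * (ev b + x * pev l) = ev a * ev b + x * (ev a * pev l) by ring.
by apply: ilDc => //; rewrite -mulrBr; apply: ilM.
Qed.

Lemma pevM l m : J (pev (pmul l m) - pev l * pev m).
Proof.
elim: l => [|a l IH] /=; first by rewrite mul0r subrr; apply: il0.
rewrite pevD /= evz add0r mulrDl -mulrA; apply: ilDc; first exact: pev_scale.
by rewrite -mulrBr; apply: ilM.
Qed.

Lemma pev_drop n l : pev l = pev (take n l) + x ^+ n * pev (drop n l).
Proof.
elim: n l => [|n IH] [|a l] /=; rewrite ?mulr0 ?add0r ?addr0 ?mul1r //.
rewrite [pev l]IH exprS; ring.
Qed.

Lemma pev_take n l : J (x ^+ n) -> J (pev (take n l) - pev l).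
Proof.
move=> h; rewrite [pev l](pev_drop n) opprD addNKr.
by apply: ilN; apply: ilMr => //; apply: pevS.
Qed.

Lemma pev_trunc_aux n l m :
  exists2 w, s w & J (pev (pmul_trunc n l m) - pev l * pev m - x ^+ n * w).
Proof.
elim: n l => [|n IH] [|a l].
- by exists 0; [apply: sr0 | rewrite /= mul0r mulr0 !subr0; apply: il0].
- exists (- (pev (a :: l) * pev m)); first by apply: srN; apply: srM; apply: pevS.
  by rewrite expr0 mul1r opprK sub0r addNr; apply: il0.
- by exists 0; [apply: sr0 | rewrite /= mul0r mulr0 !subr0; apply: il0].
have [w sw h] := IH l; exists (w - ev a * pev (drop n.+1 m)).
  by apply: srB => //; apply: srM => //; apply: pevS.
have h1 := pev_scale a (take n.+1 m); have hd := pev_drop n.+1 m.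
rewrite [pmul_trunc _ _ _]/= pevD [pev (z :: _)]/= evz add0r [pev (a :: l)]/=.
set u := pev (pscale _ _) in h1 *; set t := pev (take n.+1 m) in h1 hd.
set dd := pev (drop n.+1 m) in hd *; set r := pev (pmul_trunc n l m) in h *.
have -> : u + x * r - (ev a + x * pev l) * pev m - x ^+ n.+1 * (w - ev a * dd) =
   (u - ev a * t) + x * (r - pev l * pev m - x ^+ n * w).
  by rewrite hd exprS; ring.
by apply: ilD => //; apply: ilM.
Qed.

Lemma pevM_trunc n l m : J (x ^+ n) -> J (pev (pmul_trunc n l m) - pev l * pev m).
Proof.
move=> hn; have [w sw h] := pev_trunc_aux n l m.
by rewrite -(subrK (x ^+ n * w) (_ - _)); apply: ilD => //; apply: ilMr.
Qed.

Lemma pev_neg neg l : (forall a, ev (neg a) = - ev a) -> pev (map neg l) = - pev l.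
Proof. by move=> h; elim: l => [|a l IH] /=; rewrite ?oppr0 // h IH; ring. Qed.

End ListPoly.

Local Notation zint := int_of_Z.

Lemma zintD a b : zint (Z.add a b) = zint a + zint b.
Proof. exact: (rmorphD int_of_Z). Qed.

Lemma zintM a b : zint (Z.mul a b) = zint a * zint b.
Proof. exact: (rmorphM int_of_Z). Qed.

Lemma zintN a : zint (Z.opp a) = - zint a.
Proof. exact: (rmorphN int_of_Z). Qed.

Definition E := seq Z.
Definition F := seq E.
Definition X := seq F.
Definition Y := seq X.

Definition iszZ := Z.eqb Z0.
Definition iszE : E -> bool := all iszZ.
Definition iszF : F -> bool := all iszE.
Definition iszX : X -> bool := all iszF.
Definition addE : E -> E -> E := padd Z.add.
Definition addF : F -> F -> F := padd addE.
Definition addX : X -> X -> X := padd addF.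
Definition addY : Y -> Y -> Y := padd addX.
Definition negE : E -> E := map Z.opp.
Definition negF : F -> F := map negE.
Definition negX : X -> X := map negF.
Definition negY : Y -> Y := map negX.

Section Compute.
Variables (p cE cF M : nat).
Definition mulE : E -> E -> E := pmul_trunc Z0 iszZ Z.add Z.mul cE.
Definition mulF : F -> F -> F := pmul_trunc [::] iszE addE mulE cF.
Definition mulX : X -> X -> X := pmul_trunc [::] iszF addF mulF M.

Definition oneF : F := [:: [:: Zpos 1]].
Definition epsF : F := [:: [:: Z0; Zpos 1]].
Definition phiF : F := take cF [:: [::]; [:: Zpos 1]].
Definition lam1F : F := addF (negF oneF) (addF epsF phiF).
Definition monX k (c : F) : X := take M (ncons k [::] [:: c]).
Definition Tpoly : X := addX (addX (monX 1 oneF) (monX p lam1F))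
  (addX (monX (p ^ 2) (negF epsF)) (monX (p ^ 3) (negF phiF))).

Variable A : Y.
Definition yred (r : Y) : Y := let s := [::] :: r in
  addY (take p s) (pmul [::] iszX addX mulX (drop p s) A).
Definition ymul (a b : Y) : Y :=
  foldr (fun c r => addY (yred r) (pscale iszX mulX c b)) [::] a.
Fixpoint ypow (a : Y) (n : positive) : Y :=
  match n with
  | xH => a
  | xO m => let b := ypow a m in ymul b b
  | xI m => let b := ypow a m in ymul a (ymul b b)
  end.

Definition mulFY (c : F) (a : Y) : Y := map (fun u : X => pscale iszF mulF c u) a.

Definition ybase : Y := [:: negX Tpoly; [:: oneF]].

(* One step of the fixed point iteration for y^p = A(y). *)
Definition ystep : Y :=
  let R1 := ypow A (Pos.of_nat p) in
  let t := addY ybase (mulFY epsF (addY A (negY R1))) in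
  if (cF <= 1)%N then t else
  addY t (mulFY phiF (addY A (negY (ypow R1 (Pos.of_nat p))))).

Definition ycheck : bool := (size A <= p)%N && all iszX (addY A (negY ystep)).
End Compute.

Definition ysolve p cE cF M : Y :=
  iter (cE + cF) (ystep p cE cF M) (ybase p cF M).

Section Sound.
Variables (V : comNzRingType) (s : subr V) (J : idl s).
Variables (p cE cF M : nat) (eps phi x y : V).
Hypotheses (p0 : (0 < p)%N) (cF0 : (0 < cF)%N).
Hypotheses (se : s eps) (sp : s phi) (sx : s x) (sy : s y).

Definition evZ (a : Z) : V := (zint a)%:~R.
Definition evE : E -> V := pev evZ eps.
Definition evF : F -> V := pev evE phi.
Definition evX : X -> V := pev evF x.
Definition evY : Y -> V := pev evX y.

Lemma evZS a : s (evZ a).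
Proof. by case: a => [|n|n]; rewrite /evZ /= ?rmorph0 ?rmorphN /=; [exact: sr0 | exact: sr_nat | apply: srN; exact: sr_nat]. Qed.
Lemma evES a : s (evE a). Proof. exact: (pevS evZS se). Qed.
Lemma evFS a : s (evF a). Proof. exact: (pevS evES sp). Qed.
Lemma evXS a : s (evX a). Proof. exact: (pevS evFS sx). Qed.
Lemma evYS a : s (evY a). Proof. exact: (pevS evXS sy). Qed.

Lemma evZD a b : evZ (Z.add a b) = evZ a + evZ b.
Proof. by rewrite /evZ zintD rmorphD. Qed.
Lemma evED a b : evE (addE a b) = evE a + evE b.
Proof. exact: (pevD eps evZD). Qed.
Lemma evFD a b : evF (addF a b) = evF a + evF b.
Proof. exact: (pevD phi evED). Qed.
Lemma evXD a b : evX (addX a b) = evX a + evX b.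
Proof. exact: (pevD x evFD). Qed.
Lemma evYD a b : evY (addY a b) = evY a + evY b.
Proof. exact: (pevD y evXD). Qed.

Lemma evZN a : evZ (Z.opp a) = - evZ a.
Proof. by rewrite /evZ zintN rmorphN. Qed.
Lemma evEN a : evE (negE a) = - evE a. Proof. exact: (pev_neg eps a evZN). Qed.
Lemma evFN a : evF (negF a) = - evF a. Proof. exact: (pev_neg phi a evEN). Qed.
Lemma evXN a : evX (negX a) = - evX a. Proof. exact: (pev_neg x a evFN). Qed.
Lemma evYN a : evY (negY a) = - evY a. Proof. exact: (pev_neg y a evXN). Qed.

Lemma iszZP a : iszZ a -> evZ a = 0. Proof. by case: a. Qed.
Lemma iszEP a : iszE a -> evE a = 0. Proof. exact: (pev_isz eps iszZP). Qed.
Lemma iszFP a : iszF a -> evF a = 0. Proof. exact: (pev_isz phi iszEP). Qed.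
Lemma iszXP a : iszX a -> evX a = 0. Proof. exact: (pev_isz x iszFP). Qed.

Lemma evZ0 : evZ Z0 = 0. Proof. by []. Qed.
Lemma evZ1 : evZ (Zpos 1) = 1. Proof. by []. Qed.
Lemma ev_oneF : evF oneF = 1.
Proof. by rewrite /evF /pev /= /evE /pev /= evZ1 !mulr0 !addr0. Qed.
Lemma ev_epsF : evF epsF = eps.
Proof.
by rewrite /evF /pev /= /evE /pev /= evZ1 evZ0 !mulr0 !addr0 add0r mulr1.
Qed.

Section Mod.
Variable K : idl s.
Hypotheses (Ke : K (eps ^+ cE)) (Kp : K (phi ^+ cF)).

Lemma evEM a b : K (evE (mulE cE a b) - evE a * evE b).
Proof.
apply: (pevM_trunc (isz := iszZ)) => //; [exact: iszZP | exact: evZS | exact: evZD |].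
by move=> c d; rewrite /evZ zintM rmorphM subrr; apply: il0.
Qed.

Lemma evFM a b : K (evF (mulF cE cF a b) - evF a * evF b).
Proof.
apply: (pevM_trunc (isz := iszE)) => //; [exact: iszEP | exact: evES | exact: evED | exact: evEM].
Qed.

Lemma ev_phiF : K (evF (phiF cF) - phi).
Proof.
have h := pev_take evES sp [:: [::]; [:: Zpos 1]] Kp.
apply: il_trans h _; rewrite /pev /= /evE /pev /= evZ1 !mulr0 !addr0 add0r mulr1.
exact: il_refl.
Qed.

Lemma ev_lam1F : K (evF (lam1F cF) - (- 1 + eps + phi)).
Proof.
have -> : - 1 + eps + phi = - 1 + (eps + phi) by rewrite addrA.
rewrite /lam1F !evFD evFN ev_oneF ev_epsF; apply: ilDc; first exact: il_refl.
by apply: ilDc; [exact: il_refl | exact: ev_phiF].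
Qed.

Hypothesis Kx : K (x ^+ M).

Lemma evXM a b : K (evX (mulX cE cF M a b) - evX a * evX b).
Proof.
apply: (pevM_trunc (isz := iszF)) => //; [exact: iszFP | exact: evFS | exact: evFD | exact: evFM].
Qed.

Lemma ev_monX k c : K (evX (monX M k c) - evF c * x ^+ k).
Proof.
apply: il_trans (pev_take evFS sx _ Kx) _.
have -> : pev evF x (ncons k [::] [:: c]) = evF c * x ^+ k.
  elim: k => [|k IH] /=; first by rewrite mulr0 addr0 mulr1.
  by rewrite IH /evF /= add0r exprS; ring.
exact: il_refl.
Qed.

Definition Tval := x + (- 1 + eps + phi) * x ^+ p - eps * x ^+ (p ^ 2) - phi * x ^+ (p ^ 3).

Lemma ev_Tpoly : K (evX (Tpoly p cF M) - Tval).
Proof.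
have -> : Tval = (x + (- 1 + eps + phi) * x ^+ p) +
    (- eps * x ^+ (p ^ 2) + - phi * x ^+ (p ^ 3)).
  by rewrite /Tval !mulNr addrA.
rewrite /Tpoly !evXD; apply: ilDc.
  apply: ilDc.
    by have := ev_monX 1 oneF; rewrite ev_oneF mul1r expr1.
  apply: il_trans (ev_monX _ _) _; rewrite -mulrBl; apply: ilMr; first exact: srX.
  exact: ev_lam1F.
apply: ilDc; apply: il_trans (ev_monX _ _) _; rewrite -mulrBl evFN.
  by rewrite ev_epsF subrr mul0r; apply: il0.
apply: ilMr; first exact: srX.
by rewrite -opprD; apply: ilN; exact: ev_phiF.
Qed.

Lemma ev_mulFY c a : K (evY (mulFY cE cF c a) - evF c * evY a).
Proof.
rewrite /evY; elim: a => [|u a IH] /=; first by rewrite mulr0 subrr; apply: il0.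
rewrite mulrDr [_ * (y * _)]mulrCA; apply: ilDc.
  by apply: pev_scale => //; [exact: iszFP | exact: evFM].
by rewrite -mulrBr; apply: ilM.
Qed.

Variable A : Y.
Hypothesis KA : K (y ^+ p - evY A).

Lemma evY_red r : K (evY (yred p cE cF M A r) - y * evY r).
Proof.
have -> : y * evY r = evY ([::] :: r) by rewrite /= /evX /= add0r.
have -> : evY ([::] :: r) = evY (take p ([::] :: r)) + y ^+ p * evY (drop p ([::] :: r)).
  exact: pev_drop.
rewrite /yred evYD; apply: ilDc; first exact: il_refl.
apply: (@il_trans _ _ _ _ (evY (drop p ([::] :: r)) * evY A)).
  apply: pevM => //; [exact: iszXP | exact: evXD | exact: evXM].
by rewrite mulrC -mulrBl; apply: ilMr; [exact: evYS | exact: il_sym].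
Qed.

Lemma evY_mul a b : K (evY (ymul p cE cF M A a b) - evY a * evY b).
Proof.
elim: a => [|c a IH]; first by rewrite /= mul0r subrr; apply: il0.
rewrite /ymul [foldr _ _ _]/= -/(ymul p cE cF M A a b) evYD.
have -> : evY (c :: a) * evY b = y * (evY a * evY b) + evX c * evY b.
  by rewrite /evY /=; ring.
apply: ilDc; last first.
  by apply: pev_scale => //; [exact: iszXP | exact: evXM].
by apply: il_trans (evY_red _) _; rewrite -mulrBr; apply: ilM.
Qed.

Lemma evY_pow a n : K (evY (ypow p cE cF M A a n) - evY a ^+ Pos.to_nat n).
Proof.
have sq m : K (evY (ypow p cE cF M A a m) - evY a ^+ Pos.to_nat m) ->
   K (evY (ymul p cE cF M A (ypow p cE cF M A a m) (ypow p cE cF M A a m)) -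
      evY a ^+ (Pos.to_nat m + Pos.to_nat m)).
  move=> IH; apply: il_trans (evY_mul _ _) _; rewrite exprD.
  by apply: ilMc => //; [exact: evYS | apply: srX; exact: evYS].
elim: n => [m IH|m IH|] /=; last by rewrite expr1; apply: il_refl.
  have -> : Pos.to_nat m~1 = (Pos.to_nat m + Pos.to_nat m).+1 by lia.
  apply: il_trans (evY_mul _ _) _; rewrite exprS -mulrBr.
  by apply: ilM; [exact: evYS | exact: sq].
have -> : Pos.to_nat m~0 = (Pos.to_nat m + Pos.to_nat m)%N by lia.
exact: sq.
Qed.

End Mod.

Hypotheses (Je : J (eps ^+ cE)) (Jp : J (phi ^+ cF)) (Jx : J (x ^+ M)).
Variable A : Y.
Hypothesis chk : ycheck p cE cF M A.
Hypothesis eqy : J (y ^+ p - (y - Tval + eps * (y ^+ p - y ^+ (p ^ 2)) +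
                              phi * (y ^+ p - y ^+ (p ^ 3)))).

Lemma cert_sound : J (y ^+ p - evY A).
Proof.
set d := y ^+ p - evY A.
have sd : s d by apply: srB; [exact: srX | exact: evYS].
pose K := il_add J sd.
have JK z : J z -> K z.
  move=> h; split; first exact: il_sr h.
  by exists 0; [apply: sr0 | rewrite mulr0 subr0].
have Kd : K (y ^+ p - evY A).
  by split=> //; exists 1; [apply: sr1 | rewrite mulr1 subrr; apply: il0].
have pE : Pos.to_nat (Pos.of_nat p) = p by rewrite Nat2Pos.id //; lia.
set R1 := ypow p cE cF M A A (Pos.of_nat p).
set R2 := ypow p cE cF M A R1 (Pos.of_nat p).
have KR1 : K (y ^+ (p ^ 2) - evY R1).
  rewrite expnS expn1 exprM; apply: il_trans (il_sym (evY_pow (JK _ Je) (JK _ Jp) (JK _ Jx) Kd _ _)).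
  by rewrite pE; apply: ilXc => //; [apply: srX | apply: evYS].
have KR2 : K (y ^+ (p ^ 3) - evY R2).
  rewrite expnSr exprM; apply: il_trans (il_sym (evY_pow (JK _ Je) (JK _ Jp) (JK _ Jx) Kd _ _)).
  by rewrite pE; apply: ilXc => //; [apply: srX | apply: evYS].
pose x1 := (y ^+ p - y ^+ (p ^ 2)) - (evY A - evY R1).
pose x2 := (y ^+ p - y ^+ (p ^ 3)) - (evY A - evY R2).
have Kx1 : K x1 by apply: ilBc.
have Kx2 : K x2 by apply: ilBc.
apply: (@defect_il _ _ _ d eps phi x1 x2 sd _ _ se sp Je Jp Kx1 Kx2).
have hA : J (evY A - (y - Tval + eps * (evY A - evY R1) + phi * (evY A - evY R2))).
  have /andP[_ /(pev_isz y iszXP)] := chk.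
  rewrite -/(evY _) evYD evYN => /subr0_eq e; rewrite {1}e /ystep -/R1 -/R2.
  have hb : J (evY (ybase p cF M) - (y - Tval)).
    have -> : evY (ybase p cF M) =
       evX (negX (Tpoly p cF M)) + y * (evF oneF + x * 0 + y * 0) by [].
    rewrite evXN ev_oneF !mulr0 !addr0 mulr1 [- _ + y]addrC.
    apply: ilDc; first exact: il_refl.
    by rewrite -opprD; apply: ilN; apply: ev_Tpoly.
  have h1 : J (evY (addY (ybase p cF M) (mulFY cE cF epsF (addY A (negY R1)))) -
     (y - Tval + eps * (evY A - evY R1))).
    rewrite evYD; apply: ilDc => //.
    by apply: il_trans (ev_mulFY Je Jp _ _) _; rewrite ev_epsF evYD evYN; apply: il_refl.
  case: ifP => [cF1|_].
    apply: il_trans h1 _.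
    rewrite (_ : _ - _ = - (phi * (evY A - evY R2))); last by ring.
    apply: ilN; apply: ilMr.
      by apply: srB; apply: evYS.
    by have := Jp; rewrite (_ : cF = 1%N) ?expr1 //; lia.
  rewrite evYD; apply: ilDc => //; apply: il_trans (ev_mulFY Je Jp _ _) _.
  rewrite evYD evYN -mulrBl; apply: ilMr; first by apply: srB; apply: evYS.
  exact: ev_phiF.
rewrite /d; apply: il_trans (ilBc eqy (il_refl J (evY A))) _.
have -> : y - Tval + eps * (y ^+ p - y ^+ (p ^ 2)) + phi * (y ^+ p - y ^+ (p ^ 3)) - evY A
   - (eps * x1 + phi * x2) =
  - (evY A - (y - Tval + eps * (evY A - evY R1) + phi * (evY A - evY R2))).
  by rewrite /x1 /x2; ring.
exact: ilN.
Qed.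

End Sound.

(** * Reduction of MC to polynomials in eps and phi *)

Section Shear.
Variable A : comNzRingType.
Implicit Types f g : ps (ps A).

(* theta f (X, xi) = f (xi, xi X), with the variable X outermost. *)
Definition swap f : ps (ps A) := fun b n => f n b.
Definition shear f : ps (ps A) := fun b => psX ^+ b * f b.
Definition theta f := shear (swap f).

Fact theta_is_zmod_morphism : zmod_morphism theta.
Proof. by move=> f g; apply/funext=> b; rewrite psB /theta /shear -mulrBr. Qed.

Lemma swapM f g : swap (f * g) = swap f * swap g.
Proof.
apply/funext=> b; apply/funext=> n.
by rewrite -[f * g]gbmulE -[swap f * swap g]gbmulE; exact: exchange_big.
Qed.

Lemma swapX f k : swap (f ^+ k) = swap f ^+ k.
Proof.
elim: k => [|k IH]; last by rewrite !exprS swapM IH.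
by apply/funext=> -[|b]; apply/funext=> -[|n].
Qed.

Lemma shearM f g : shear (f * g) = shear f * shear g.
Proof.
apply/funext=> b; rewrite /shear !psM mulr_sumr; apply: eq_bigr => i _.
have -> : psX ^+ b = psX ^+ i * psX ^+ (b - i) :> ps A.
  by rewrite -exprD subnKC // -ltnS.
by rewrite mulrACA.
Qed.

Fact theta_is_monoid_morphism : monoid_morphism theta.
Proof.
split=> [|f g]; last by rewrite /theta swapM shearM.
rewrite /theta (_ : swap 1 = 1); last exact: (swapX 1 0).
apply/funext=> b; rewrite /shear !ps1; case: eqP => [->|_]; first by rewrite mul1r.
by rewrite mulr0.
Qed.

HB.instance Definition _ :=
  GRing.isZmodMorphism.Build (ps (ps A)) (ps (ps A)) theta theta_is_zmod_morphism.
HB.instance Definition _ :=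
  GRing.isMonoidMorphism.Build (ps (ps A)) (ps (ps A)) theta theta_is_monoid_morphism.

Lemma thetaB f g : theta (f - g) = theta f - theta g.
Proof. exact: rmorphB. Qed.
Lemma thetaD f g : theta (f + g) = theta f + theta g.
Proof. exact: rmorphD. Qed.
Lemma thetaMn f k : theta (f *+ k) = theta f *+ k.
Proof. exact: rmorphMn. Qed.
Lemma thetaM f g : theta (f * g) = theta f * theta g.
Proof. exact: rmorphM. Qed.
Lemma thetaX f k : theta (f ^+ k) = theta f ^+ k.
Proof. exact: rmorphXn. Qed.
Lemma theta_sum (I : Type) (r : seq I) (P : pred I) (G : I -> ps (ps A)) :
  theta (\sum_(i <- r | P i) G i) = \sum_(i <- r | P i) theta (G i).
Proof. exact: rmorph_sum. Qed.

Lemma theta_fil N f b : fil2 A N f -> fil1 A N (theta f b).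
Proof.
move/fil2P=> h; apply/fil1P => n nN; rewrite /theta /shear psXnM /swap.
by case: ltnP => // bn; apply: h; lia.
Qed.

Lemma thetaC c : theta (psC (psC c)) = psC (psC c).
Proof.
apply/funext=> -[|b]; rewrite /theta /shear.
  by rewrite mul1r; apply/funext=> -[|n].
by rewrite (_ : swap _ b.+1 = 0) ?mulr0 //; apply/funext=> -[|n].
Qed.

Lemma theta_xi : theta psX = psC psX.
Proof.
apply/funext=> -[|b]; rewrite /theta /shear.
  by rewrite mul1r; apply/funext=> -[|[|n]].
by rewrite (_ : swap _ b.+1 = 0) ?mulr0 //; apply/funext=> -[|[|n]].
Qed.

Lemma theta_x : theta (psC psX) = psC psX * psX.
Proof.
apply/funext=> b; rewrite psCM /theta /shear.
case: b => [|[|b]].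
- by rewrite (_ : swap _ 0 = 0) ?mulr0 //; apply/funext=> -[|n].
- by rewrite expr1; congr (_ * _); apply/funext=> -[|n].
- by rewrite (_ : swap _ b.+2 = 0) ?mulr0 //; apply/funext=> -[|n].
Qed.

Definition eta f : ps (ps A) :=
  fun b => if b is b'.+1 then psX ^+ b' * swap f b else (fun n => f n.+1 0%N).

Lemma etaE f : fil2 A 1 f -> psC psX * eta f = theta f.
Proof.
move/fil2P=> h; apply/funext=> -[|b]; rewrite psCM /theta /shear /eta.
  rewrite mul1r; apply/funext=> -[|n]; rewrite psXM //.
  by rewrite /swap h.
by rewrite mulrA -exprS.
Qed.

Lemma psX_reg (f g : ps A) : psX * f = psX * g -> f = g.
Proof.
by move=> e; apply/funext=> n; have /(congr1 (@^~ n.+1)) := e; rewrite !psXM.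
Qed.

Lemma psXn_reg k (f g : ps A) : psX ^+ k * f = psX ^+ k * g -> f = g.
Proof.
by elim: k => [|k IH]; rewrite ?mul1r // exprS -!mulrA => /psX_reg.
Qed.

Lemma fil1_shift N (f : ps A) : fil1 A N f -> f = psX ^+ N * (fun n => f (n + N)%N).
Proof.
move/fil1P=> h; apply/funext=> n; rewrite psXnM; case: ltnP => hn; first exact: h.
by rewrite subnK.
Qed.

Lemma fil1_psX N (f : ps A) : fil1 A N.+1 (psX * f) -> fil1 A N f.
Proof.
by move/fil1P=> h; apply/fil1P => n hn; have := h n.+1 hn; rewrite psXM.
Qed.

End Shear.

Fact ring_aux3 (R : comNzRingType) (P x r t h xk : R) :
  ((P + x * r) * t + xk * x * h) - P * t = x * (r * t + xk * h).
Proof. by ring. Qed.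

Fact ring_aux4 (R : comNzRingType) (P a t1 t2 xk xc h : R) :
  (a * (P * t1 + xk * t2) + xk * xc * h) - P * (a * t1) = xk * (a * t2 + xc * h).
Proof. by ring. Qed.

Fact ring_aux5 (R : comNzRingType) (n : nat) (g l : R) :
  n%:R ^+ 4 * l = n%:R ^+ 3 * g - n%:R ^+ 3 * (g - l *+ n).
Proof. by rewrite -[l *+ n]mulr_natl; ring. Qed.

Fact ring_aux6 (R : comNzRingType) (x a b l : R) :
  x * a - (x * l + x * b) = x * (a - b - l).
Proof. by ring. Qed.

Fact ring_aux7 (R : comNzRingType) (y x y1 x1 y2 x2 y3 x3 L e g : R) :
  y1 - (y - (x + (- 1 + e + g) * x1 - e * x2 - g * x3) + e * (y1 - y2) + g * (y1 - y3)) =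
  L * (y1 - x1) - (1 * (y - x) + (L - 1 + e + g) * (y1 - x1) - e * (y2 - x2) - g * (y3 - x3)).
Proof. by ring. Qed.

Fact ring_aux8 (R : comNzRingType) (x1 x2 g s a w xa a' xw w' : R) :
  a = xa * a' -> x2 * w = xw * w' ->
  x1 * x2 * (g * (s * (a * w))) = (xa * xw) * ((x1 * g) * (s * (a' * w'))).
Proof.
move=> -> e; rewrite (_ : _ * _ = x1 * (g * (s * (xa * a' * (x2 * w))))); last by ring.
by rewrite e; ring.
Qed.

Fact ring_aux9 (R : comNzRingType) (l1 l2 l3 : R) :
  l1 = 1 + (l1 + (l2 + l3)) - 1 + - l2 + - l3.
Proof. by ring. Qed.

Lemma sum_scale (R : comNzRingType) (x g : R) (G : nat -> R) (r : seq nat) :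
  x * (g * \sum_(j <- r) G j) = \sum_(j <- r) x * (g * G j).
Proof. by rewrite !mulr_sumr. Qed.

Section PevMorph.
Variables (R1 R2 : comNzRingType) (h : {rmorphism R1 -> R2}).

Lemma pev_morph (T : Type) (ev1 : T -> R1) (ev2 : T -> R2) x l :
  (forall a, ev2 a = h (ev1 a)) -> pev ev2 (h x) l = h (pev ev1 x l).
Proof.
move=> e; elim: l => [|a l IH] /=; first by rewrite rmorph0.
by rewrite e rmorphD rmorphM -IH.
Qed.

Lemma evF_morph eps phi l : evF (h eps) (h phi) l = h (evF eps phi l).
Proof.
apply: pev_morph => a; apply: pev_morph => b.
by rewrite /evZ rmorph_int.
Qed.
End PevMorph.

Lemma evX_coef (R : comNzRingType) (eps phi : R) l b :
  (evX (psC eps) (psC phi) psX l : ps R) b = evF eps phi (nth [::] l b).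
Proof.
elim: l b => [|a l IH] b; first by rewrite nth_nil.
rewrite /evX /pev /= -/(pev _ _ _) -/(evX _ _ _ _) psD evF_morph psXM.
by case: b => [|b]; rewrite /psC /= ?addr0 // add0r IH.
Qed.

Lemma horner_pev (R : comNzRingType) (T : Type) (ev : T -> R) (y : R) l :
  (Poly (map ev l)).[y] = pev ev y l.
Proof.
by elim: l => [|a l IH]; rewrite ?horner0 //= horner_cons IH addrC mulrC.
Qed.

Section MCcompute.
Variables (p cE cF M n : nat) (Ac : Y).
Let mul := mulF cE cF.
Let al : X := behead (if odd p then nth [::] Ac 0 else negX (nth [::] Ac 0)).
Let wl : X := [::] :: behead al.
Definition wpowF j : X := iter j (mulX cE cF M.-1 wl) [:: oneF].
Definition natF k : F := [:: [:: Z.of_nat k]].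
Definition ccF j : F :=
  if j == 0%N then oneF else
  if j.+1 == p then mul (natF p) (lam1F cF) else
  if j.+1 == (p ^ 2)%N then mul (natF (p ^ 2)) (negF epsF) else [::].
Definition binF j : F := if odd j then negF (natF 'C(n + j, j)) else natF 'C(n + j, j).
Definition termF k j : F :=
  let w := nth [::] (wpowF j) k in
  if iszF w then [::] else
  mul (binF j) (mul (iter (n - j)%N (mul (nth [::] al 0)) oneF) w).
Definition sumF (t : nat -> F) r : F := foldr (fun k acc => addF (t k) acc) [::] r.
Definition MCF : F :=
  sumF (fun k => if iszF (ccF (n - k)%N) then [::] else
                 mul (ccF (n - k)%N) (sumF (termF k) (iota 0 k.+1))) (iota 0 n.+1).
Definition alF := al.
Definition wlF := wl.
End MCcompute.

Section WeightCheck.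
Variables (p we wf : nat).
Definition zpow k : Z := iter k (Z.mul (Z.of_nat p)) (Zpos 1).
Fixpoint wtE k (e : E) : bool :=
  if e is z :: e' then
    Z.eqb z (Z.mul (zpow k) (Z.div z (zpow k))) && wtE (k - we)%N e'
  else true.
Fixpoint wtF k (l : F) : bool :=
  if l is e :: l' then wtE k e && wtF (k - wf)%N l' else true.
End WeightCheck.

Fact ring_odd (R : comNzRingType) (P e U w u k q z s Pe Pf uf : R) :
  P ^+ 2 * e = - w -> P ^+ 6 = Pe * Pf -> U = u * uf ->
  - k * s - q = P * z ->
  P ^+ 6 * (Pe * k * e ^+ 3 - q * u) =
   - (k * Pe) * (w ^+ 3 - U) - k * Pe * u * (uf - s * Pf) + P * z * P ^+ 6 * u.
Proof.
move=> e1 e2 -> <-.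
have -> : P ^+ 6 * (Pe * k * e ^+ 3 - q * u) =
  Pe * k * (P ^+ 2 * e) ^+ 3 - q * u * P ^+ 6 by ring.
by rewrite e1 e2; ring.
Qed.

Fact ring_two2 (R : comNzRingType) (h h3 k1 k3 k4 k6 k7 l2 l3 u : R) :
  l2 = 4 * h + 2 * (1 + 4 * k3) ->
  l3 = 64 * h3 + 32 * h ^+ 2 * (1 + 4 * k1) + 32 * h * (1 + 4 * k4) + 16 * (1 + 4 * k7) ->
  u = 64 * (1 + 4 * k6) + 64 * h ^+ 2 ->
  18 * - l3 + 36 * (- l2) ^+ 3 - u =
  2 ^+ 7 * (- 9 * h3 - 18 * h ^+ 2 * k1 - 18 * h * k4 - 9 * k7
    - 9 * (3 * k3 * (1 + 2 * h) ^+ 2 + 12 * k3 ^+ 2 * (1 + 2 * h) + 16 * k3 ^+ 3)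
    - 2 * k6 - 5 - 18 * h - 32 * h ^+ 2 - 18 * h ^+ 3).
Proof. by move=> -> -> ->; ring. Qed.

Fact ring_two4 (R : comNzRingType) (h h3 k1 k3 k4 k7 l2 l3 u m q a b : R) :
  a = 1 + 2 * h + 4 * k3 ->
  b = 4 * h3 + 2 * h ^+ 2 * (1 + 4 * k1) + 2 * h * (1 + 4 * k4) + (1 + 4 * k7) ->
  l2 = 2 * a -> l3 = 16 * b -> u = 1024 * h ^+ 2 * (1 + 4 * k4) ->
  m = h + h ^+ 2 + 2 * k3 * (1 + 2 * h) + 4 * k3 ^+ 2 ->
  q = h3 + 2 * h ^+ 2 * k1 + 2 * h * k4 + k7 ->
  600 * (- l2) ^+ 2 * - l3 + 400 * (- l2) ^+ 5 - u =
  2 ^+ 11 * (- 25 - 50 * h - 38 * h ^+ 2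
     - 25 * (3 * q + k3 + 3 * m * b + 2 * m * a + 4 * m ^+ 2 * a) - 2 * h ^+ 2 * k4).
Proof. by move=> -> -> -> -> -> -> ->; ring. Qed.

Fact ring_cube (R : comNzRingType) (a b : R) :
  (b + a) ^+ 3 - a ^+ 3 = b * (b * b + 3%:R * (b * a) + 3%:R * (a * a)).
Proof. by ring. Qed.

Fact ring_l2 (R : comNzRingType) (x y : R) :
  2 * (2 ^+ 3 * x) + (2 * y) ^+ 3 = 2 ^+ 2 * (4 * x + 2 * y ^+ 3).
Proof. by ring. Qed.

Fact ring_l4 (R : comNzRingType) (x y z : R) :
  2 ^+ 7 * y + z * (2 ^+ 3 * x) ^+ 2 + (4 * x + 2 * z ^+ 3) * (2 * z) ^+ 4 =
  2 * (64 * y + 32 * x ^+ 2 * z + 32 * x * z ^+ 4 + 16 * z ^+ 7).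
Proof. by ring. Qed.

Fact ring_l5 (R : comNzRingType) (x y z : R) : 1 + (z - 1 + - x + - y) = z - x - y.
Proof. by ring. Qed.

Fact ring_l6 (R : comNzRingType) (g L x y h : R) : g = L - 1 + - x + - y ->
  x = 4 * h + 2 * g ^+ 3 ->
  g - 1 = L - y - (2 ^+ 2 * h + 2 ^+ 1 * ((1 + g) * (1 - g + g ^+ 2))).
Proof.
move=> e ex; have -> : L = g + 1 + x + y by rewrite e; ring.
by rewrite ex; ring.
Qed.

Fact ring_l7 (R : comNzRingType) (x y : R) :
  2%:R ^+ 6 * (1 + 4 * y) + (2 ^+ 3 * x) ^+ 2 = 64 * (1 + 4 * y) + 64 * x ^+ 2.
Proof. by ring. Qed.

Fact ring_l8 (R : comNzRingType) (x y : R) :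
  2%:R ^+ 4 * (1 + 4 * y) * (2 ^+ 3 * x) ^+ 2 = 1024 * x ^+ 2 * (1 + 4 * y).
Proof. by ring. Qed.

Fact ring_l9 (R : comNzRingType) (x y : R) :
  4 * x + 2 * (1 + 4 * y) = 2 * (1 + 2 * x + 4 * y).
Proof. by ring. Qed.

Fact ring_l10 (R : comNzRingType) (x y z t w : R) :
  64 * y + 32 * x ^+ 2 * (1 + 4 * z) + 32 * x * (1 + 4 * t) + 16 * (1 + 4 * w) =
  16 * (4 * y + 2 * x ^+ 2 * (1 + 4 * z) + 2 * x * (1 + 4 * t) + (1 + 4 * w)).
Proof. by ring. Qed.

Section Link.
Variables (A : comNzRingType) (p : nat) (divp : A -> A) (v : nat -> A).
Hypothesis pp : prime p.
Hypothesis divpE : forall x, p%:R * divp x = x.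
Variable f : frob0 p A.
Hypothesis v_int : forall j, intg f (v j).
Hypothesis sgv : forall j, sg f (v j) = v j ^+ p.
Hypothesis fl : forall x, intg f x -> frob_lift f x.
Hypothesis v1_reg : forall x, intg f (pinv f * (v 1 * x)) -> intg f x ->
  intg f (pinv f * x).

Local Notation S := (ps A).
Local Notation V := (ps (ps A)).
Local Notation c := p.-1.
Local Notation ell := (gell p divp v).
Local Notation logc := (glogc p divp v).
Local Notation angle := (ganglep p divp v).
Local Notation Phi := (frob1 pp f).
Local Notation int := (intg Phi).
Let p1 : (1 < p)%N := prime_gt1 pp.
Let p0 : (0 < p)%N := prime_gt0 pp.

Definition arem : S := fun n => angle (n + c)%N.

Lemma arem_int : int arem.
Proof. by move=> n; apply: (angle_int pp divpE v_int sgv fl). Qed.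

Lemma angle_split : angle = p%:R + psX ^+ c * arem.
Proof.
have low n := @angle_low A p divp v pp divpE n.
apply/funext=> n; rewrite psD ps_nat psXnM; case: ltnP => h.
  rewrite addr0 low; last by lia.
  case: eqP => // _; case: eqP => // e; lia.
rewrite /arem subnK // (_ : (n == 0%N) = false) ?add0r //; lia.
Qed.

Lemma arem0 : arem 0%N = v 1 * (1 - p%:R ^+ c).
Proof.
rewrite /arem add0n (angle_low v pp divpE); last by lia.
by rewrite (_ : (c == 0%N) = false) ?eqxx //; lia.
Qed.

Local Notation inI := (inI Phi psX angle).
Local Notation hat := (hat Phi psX angle c).
Let iX : int psX := X_int pp f.
Let ia : int angle := angle_int pp divpE v_int sgv fl.

Lemma inI_div k x : int x -> inI (k + c) (p%:R * x) -> inI k x.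
Proof.
move=> ix [t [h [it ih e]]].
pose q := pinv f.
have qp z : p%:R * (q * z) = z by rewrite mulrA pinvE mul1r.
have key : p%:R * (x - t) = psX ^+ c * (arem * t + psX ^+ k * h) :> S.
  by rewrite mulrBr e angle_split exprD; exact: ring_aux3.
have keyn n : intg f (q * (arem * t + psX ^+ k * h) n).
  have /(congr1 (@^~ (n + c)%N)) := key; rewrite psXnM ltnNge leq_addl /= addnK => <-.
  have -> : (p%:R * (x - t)) (n + c)%N = p%:R * (x - t) (n + c)%N.
    by rewrite mulr_natl psMn mulr_natl.
  by rewrite mulrCA qp; apply: intgB.
have tq i : (i < k)%N -> intg f (q * t i).
  elim/ltn_ind: i => i IH ik.
  have := keyn i; rewrite psD psXnM ik addr0 psM big_ord_recl subn0 arem0.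
  rewrite mulrDr => hi; apply: v1_reg => //.
  set s := \sum_(_ < i) _ in hi.
  have hs : intg f (q * s).
    rewrite mulr_sumr; apply: intg_sum => j _; rewrite mulrCA; apply: intgM.
      exact: arem_int.
    by have hj := ltn_ord j; apply: IH; rewrite lift0; lia.
  have [m cm] : exists m, c = m.+1 by exists c.-1; lia.
  have -> : q * (v 1 * t i) = (q * (v 1 * (1 - p%:R ^+ c) * t i) + q * s - q * s)
     + v 1 * t i * p%:R ^+ m.
    rewrite addrK cm exprS.
    have -> : v 1 * t i * p%:R ^+ m = p%:R * q * (v 1 * t i * p%:R ^+ m).
      by rewrite (pinvE f : p%:R * q = 1) mul1r.
    by move: (p%:R : A) => P; ring.
  apply: intgD; first exact: intgB.
  by apply: intgM; [apply: intgM | apply: intgX; apply: intg_nat].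
pose t1 : S := fun i => if (i < k)%N then q * t i else 0.
pose t2 : S := fun i => t (i + k)%N.
have it1 : int t1 by move=> i; rewrite /t1; case: ifP => [/tq|_] //; apply: intg0.
have tE : t = p%:R * t1 + psX ^+ k * t2.
  apply/funext=> i; rewrite psD psXnM mulr_natl psMn -mulr_natl /t1 /t2.
  by case: ltnP => ik; rewrite ?qp ?addr0 // mulr0 add0r subnK.
pose g := x - angle * t1.
have ig : int g by apply: intgB => //; apply: intgM.
have gk : fil1 A k g.
  have pg : p%:R * g = psX ^+ k * (angle * t2 + psX ^+ c * h).
    by rewrite /g mulrBr e {1}tE exprD; exact: ring_aux4.
  apply/fil1P => n nk; have /(congr1 (@^~ n)) := pg.
  rewrite psXnM nk mulr_natl psMn -mulr_natl => z.
  by rewrite -[g n]mul1r -(pinvE f) [p%:R * _]mulrC -mulrA z mulr0.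
exists t1, (fun n => g (n + k)%N); split=> //.
by rewrite -(fil1_shift gk) /g [RHS]addrC subrK.
Qed.

Definition lam k : S := psC (ell k) * psX ^+ (p ^ k).-1.

Lemma lamX k : psX * lam k = psC (ell k) * psX ^+ (p ^ k).
Proof. by rewrite /lam mulrCA -exprS prednK // expn_gt0 p0. Qed.

Lemma lam_int k m : (k <= m)%N -> int (p%:R ^+ m * lam k).
Proof.
move=> km; rewrite /lam mulrA; apply: intgM; last exact: intgX.
rewrite -(subnK km) exprD -mulrA; apply: intgM; first by apply: intgX; apply: intg_nat.
have -> : p%:R ^+ k * psC (ell k) = psC (p%:R ^+ k * ell k) :> S.
  by rewrite rmorphM rmorphXn rmorph_nat.
move=> n; rewrite /psC; case: (n == 0%N); last exact: intg0.
exact: (ell_int divpE v_int).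
Qed.

Lemma fil_hat N m B (x : S) : (B + m * c <= N)%N -> fil1 A N x ->
  int (p%:R ^+ m * x) -> hat B x.
Proof.
move=> hN hx ix; exists m; apply: (@inIW _ _ _ _ _ iX _ N) => //.
have h : fil1 A N (p%:R ^+ m * x) by apply: filMl.
by rewrite (fil1_shift h); apply: inI0 => n; apply: ix.
Qed.

Lemma lam_hat k B : (B + k * c <= (p ^ k).-1)%N -> hat B (lam k).
Proof.
move=> h; apply: fil_hat h _ _; last exact: lam_int.
by apply: filMl; apply: filX1; apply: fil1X.
Qed.

Definition Lam : S := \sum_(k < 4) lam k.
Variable B : nat.
Hypothesis hB : (B + 4 * c <= (p ^ 4).-1)%N.
Let p4 : (p ^ 4).-1.+1 = (p ^ 4)%N. Proof. by rewrite prednK // expn_gt0 p0. Qed.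

Lemma logTX : fil1 A (p ^ 4)%N ((logc : S) - logT p divp v (@psC A) 4 psX).
Proof. by apply: islogD => //; [exact: fil1X | exact: islog1_X]. Qed.

Lemma psX_lamX k g : psX * (lam k * g ^+ (p ^ k)) = psC (ell k) * (psX * g) ^+ (p ^ k) :> S.
Proof. by rewrite mulrA lamX exprMn mulrA. Qed.

Lemma Lam_hat : hat B Lam.
Proof.
have h : fil1 A (p ^ 4).-1%N (\sum_(k < 4) lam k * angle ^+ (p ^ k) - Lam *+ p).
  apply: fil1_psX; rewrite p4.
  have e1 : psX * (\sum_(k < 4) lam k * angle ^+ (p ^ k)) =
      logT p divp v (@psC A) 4 (gfmul p divp v p).
    rewrite mulr_sumr /logT; apply: eq_bigr => k _.
    by rewrite psX_lamX XangleE.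
  have e2 : psX * Lam = logT p divp v (@psC A) 4 psX.
    by rewrite mulr_sumr /logT; apply: eq_bigr => k _; rewrite lamX.
  rewrite mulrBr mulrnAr e1 e2.
  have h1 := fil_sym (islogD p1 4 (fmul_fil p divp v p) (islog_fmul divp v pp p)).
  apply: fil_trans h1 _.
  by rewrite -mulrnBl -mulr_natl; apply: filMl; apply: logTX.
exists 4%N; apply: (inIW iX hB); set N := (p ^ 4).-1 in h *.
set s3 : S := \sum_(k < 4) p%:R ^+ 3 * lam k * angle ^+ (p ^ k).-1.
have e3 : angle * s3 = p%:R ^+ 3 * \sum_(k < 4) lam k * angle ^+ (p ^ k).
  rewrite !mulr_sumr; apply: eq_bigr => k _; rewrite mulrCA -exprS prednK ?expn_gt0 ?p0 //.
  by rewrite mulrA.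
have -> := ring_aux5 p (\sum_(k < 4) lam k * angle ^+ (p ^ k)) Lam.
rewrite -e3.
have i1 : int s3.
  apply: intg_sum => k _; apply: intgM; last exact: intgX.
  by apply: lam_int; rewrite -ltnS.
have i2 : int (p%:R ^+ 3 * (\sum_(k < 4) lam k * angle ^+ (p ^ k) - Lam *+ p)).
  rewrite mulrBr; apply: intgB.
    rewrite mulr_sumr; apply: intg_sum => k _; rewrite mulrA; apply: intgM.
      by apply: lam_int; rewrite -ltnS.
    exact: intgX.
  rewrite mulrnAr mulr_sumr; apply: intgMn; apply: intg_sum => k _.
  by apply: lam_int; rewrite -ltnS.
have h' := filMl (p%:R ^+ 3) h.
apply: inID; first exact: inI_angle.
rewrite (fil1_shift h') -mulrN; apply: inI0 => n; apply: intgN; exact: i2.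
Qed.

Local Notation y i := (gfaddx p divp v (gfmul p divp v i)).
Local Notation etai i := (eta (y i)).

Lemma eta_int i b : int (etai i b).
Proof.
have h := faddx_int divpE v_int sgv fl (fmul_int pp divpE v_int sgv fl i).
case: b => [|b]; first by move=> n; apply: h.
by rewrite /eta; apply: intgM; [apply: intgX | move=> n; apply: h].
Qed.

Lemma psC_lam k (g : V) : psC psX * (psC (lam k) * g ^+ (p ^ k)) =
  psC (psC (ell k)) * (psC psX * g) ^+ (p ^ k).
Proof.
by rewrite mulrA -rmorphM lamX rmorphM rmorphXn exprMn mulrA.
Qed.

Lemma eta_eq i b :
  hat B ((\sum_(k < 4) psC (lam k) * (etai i ^+ (p ^ k) - psX ^+ (p ^ k)) - psC Lam *+ i) b).
Proof.
have hy : fil2 A 1 (y i) := faddx_fil p divp v (fmul_fil p divp v i).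
set D := \sum_(k < 4) _ - _.
have hl := islog_faddx pp (fmul_fil p divp v i) (islog_fmul divp v pp i).
have h1 := islogD p1 4 hy hl.
have hX := logTX.
pose LT2 := logT p divp v (@iota2 A) 4.
have eC : psC (logT p divp v (@psC A) 4 psX) = LT2 (psC psX).
  by rewrite /LT2 /logT rmorph_sum; apply: eq_bigr => k _; rewrite rmorphM rmorphXn.
have eE : emb (logT p divp v (@psC A) 4 psX) = LT2 psX.
  rewrite /LT2 /logT rmorph_sum; apply: eq_bigr => k _.
  by rewrite rmorphM rmorphXn /= embX embC.
have h2 : fil2 A (p ^ 4)%N (LT2 (y i) - (LT2 psX *+ i + LT2 (psC psX))).
  apply: fil_trans (fil_sym h1) _; rewrite opprD addrACA; apply: filD.
    rewrite rmorphMn -mulrnBl -mulr_natl; apply: filMl.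
    by rewrite -eE -rmorphB; apply: emb_fil.
  by rewrite -eC -rmorphB; apply: psC_fil.
have tL z : theta (LT2 z) = \sum_(k < 4) psC (psC (ell k)) * theta z ^+ (p ^ k).
  rewrite /LT2 /logT theta_sum; apply: eq_bigr => k _.
  by rewrite thetaM thetaX; congr (_ * _); apply: thetaC.
have tE : theta (LT2 (y i) - (LT2 psX *+ i + LT2 (psC psX))) = psC psX * D.
  have t1 : theta (LT2 psX) = psC psX * psC Lam.
    rewrite tL theta_xi -rmorphM /Lam mulr_sumr rmorph_sum; apply: eq_bigr => k _.
    by rewrite lamX rmorphM rmorphXn.
  have t2 : theta (LT2 (psC psX)) = psC psX * \sum_(k < 4) psC (lam k) * psX ^+ (p ^ k).
    by rewrite tL theta_x mulr_sumr; apply: eq_bigr => k _; rewrite psC_lam.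
  have t3 : theta (LT2 (y i)) = psC psX * \sum_(k < 4) psC (lam k) * etai i ^+ (p ^ k).
    by rewrite tL -(etaE hy) mulr_sumr; apply: eq_bigr => k _; rewrite psC_lam.
  have e4 : D = \sum_(k < 4) psC (lam k) * etai i ^+ (p ^ k) -
      \sum_(k < 4) psC (lam k) * psX ^+ (p ^ k) - psC Lam *+ i.
    rewrite /D -sumrB; congr (_ - _); apply: eq_bigr => k _; exact: mulrBr.
  have fin (a1 a2 a3 x1 x2 x3 : V) : a1 = psC psX * x1 -> a2 = psC psX * x2 ->
      a3 = psC psX * x3 -> a3 - (a1 *+ i + a2) = psC psX * (x3 - x2 - x1 *+ i).
    by move=> -> -> ->; rewrite -mulrnAr; exact: ring_aux6.
  have tB : theta (LT2 (y i) - (LT2 psX *+ i + LT2 (psC psX))) =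
      theta (LT2 (y i)) - (theta (LT2 psX) *+ i + theta (LT2 (psC psX))).
    by rewrite thetaB thetaD thetaMn.
  by rewrite tB (fin _ _ _ _ _ _ t1 t2 t3) -e4.
have h3 := theta_fil b h2; rewrite tE psCM -p4 in h3; have h4 := fil1_psX h3.
apply: (@fil_hat _ 3 _ _ _ h4); first by lia.
have i3 k (g : V) : (forall d, int (g d)) -> int (p%:R ^+ 3 * (psC (lam k) * g) b) \/ (3 < k)%N.
  move=> ig; case: (leqP k 3) => k3; [left | by right].
  by rewrite psCM mulrA; apply: intgM => //; apply: lam_int.
pose ips := ps_frob Phi pp.
have iY k : intg ips (etai i ^+ (p ^ k) - psX ^+ (p ^ k)).
  apply: intgB; apply: intgX; first exact: eta_int.
  by move=> d; apply: intg_nat.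
rewrite /D psB mulrBr ps_sum mulr_sumr; apply: intgB.
  apply: intg_sum => k _; have [//|] := i3 k _ (iY k).
  by rewrite ltnNge -ltnS ltn_ord.
rewrite psMn mulrnAr /psC; apply: intgMn; case: (b == 0%N); last first.
  by rewrite mulr0; apply: intg0.
rewrite /Lam mulr_sumr; apply: intg_sum => k _; apply: lam_int.
by rewrite -ltnS.
Qed.

Let ir : int arem := arem_int.
Let Sb := hat_subr iX ia ir angle_split.
Let JB := hat_idl iX ia ir angle_split.
Let VB := psv_subr iX ia ir angle_split.
Let JV (M : nat) := psv_idl iX ia ir angle_split M B.

Definition epsS : S := - lam 2.
Definition phiS : S := - lam 3.
Variables (wE wF cE cF M : nat).
Hypotheses (hwE : (wE + 2 * c <= (p ^ 2).-1)%N) (hwF : (wF + 3 * c <= (p ^ 3).-1)%N).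
Hypotheses (hcE : (B <= wE * cE)%N) (hcF : (B <= wF * cF)%N) (cF0 : (0 < cF)%N).

Lemma eps_hat : hat wE epsS.
Proof. by apply: (hatN iX ia); apply: lam_hat. Qed.
Lemma phi_hat : hat wF phiS.
Proof. by apply: (hatN iX ia); apply: lam_hat. Qed.
Lemma eps_S : Sb epsS. Proof. exact: (hatW iX (leq0n _) eps_hat). Qed.
Lemma phi_S : Sb phiS. Proof. exact: (hatW iX (leq0n _) phi_hat). Qed.
Lemma eps_nil : JB B (epsS ^+ cE).
Proof. exact: (hatW iX hcE (hatX iX ia cE eps_hat)). Qed.
Lemma phi_nil : JB B (phiS ^+ cF).
Proof. exact: (hatW iX hcF (hatX iX ia cF phi_hat)). Qed.

Lemma VB_C x : hat 0 x -> VB (psC x).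
Proof. by move=> hx [|b] //=; apply: hat0. Qed.
Lemma JV_C m x : hat B x -> JV m (psC x).
Proof.
move=> hx; split=> [[|b]|[|b] _]; rewrite /psC /=; try exact: hat0; last exact: hx.
exact: (hatW iX (leq0n _) hx).
Qed.
Lemma VB_X : VB psX.
Proof. by move=> b; apply: intg_hat; apply: (intg_nat Phi). Qed.
Lemma JV_X m : JV m (psX ^+ m).
Proof.
split=> [b|b bm]; first by rewrite psXn; apply: intg_hat; apply: (intg_nat Phi).
by rewrite psXn ltn_eqF //; apply: hat0.
Qed.
Lemma eta_VB i : VB (etai i).
Proof. by move=> b; apply: intg_hat; apply: eta_int. Qed.

Local Notation epsV := (psC epsS : V).
Local Notation phiV := (psC phiS : V).

Lemma lam0 : lam 0 = 1.
Proof. by rewrite /lam ell0 rmorph1 mul1r. Qed.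

Lemma lam1E : lam 1 = Lam - 1 + epsS + phiS.
Proof.
rewrite /Lam !big_ord_recl big_ord0 addr0 lam0 /epsS /phiS; exact: ring_aux9.
Qed.

Lemma eta_core m i : JV m (etai i ^+ p - (etai i - Tval p epsV phiV psX +
  epsV * (etai i ^+ p - etai i ^+ (p ^ 2)) + phiV * (etai i ^+ p - etai i ^+ (p ^ 3)))).
Proof.
pose SD : V := \sum_(k < 4) psC (lam k) * (etai i ^+ (p ^ k) - psX ^+ (p ^ k)).
have hSD : JV m SD.
  have h b := eta_eq i b.
  have hD : JV m (SD - psC Lam *+ i).
    by split=> [b|b _]; [apply: (hatW iX (leq0n _) (h b)) | apply: h].
  rewrite -(subrK (psC Lam *+ i) SD); apply: ilD => //.
  by rewrite -mulr_natl; apply: ilM; [apply: sr_nat | apply: JV_C; apply: Lam_hat].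
have eS : SD = 1 * (etai i - psX) + (psC Lam - 1 + epsV + phiV) * (etai i ^+ p - psX ^+ p)
   - epsV * (etai i ^+ (p ^ 2) - psX ^+ (p ^ 2)) - phiV * (etai i ^+ (p ^ 3) - psX ^+ (p ^ 3)).
  have e1 : psC (lam 1) = psC Lam - 1 + epsV + phiV.
    by rewrite lam1E !rmorphD; congr (_ + _ + _ + _); rewrite rmorphN rmorph1.
  have e2 : psC (lam 2) = - epsV by rewrite /epsS rmorphN opprK.
  have e3 : psC (lam 3) = - phiV by rewrite /phiS rmorphN opprK.
  have -> : SD = psC (lam 0) * (etai i ^+ (p ^ 0) - psX ^+ (p ^ 0)) +
     psC (lam 1) * (etai i ^+ (p ^ 1) - psX ^+ (p ^ 1)) +
     psC (lam 2) * (etai i ^+ (p ^ 2) - psX ^+ (p ^ 2)) +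
     psC (lam 3) * (etai i ^+ (p ^ 3) - psX ^+ (p ^ 3)).
    by rewrite /SD !big_ord_recl big_ord0 addr0 !addrA.
  by rewrite e1 e2 e3 lam0 rmorph1 expn0 expn1 !expr1 !mulNr.
have -> := ring_aux7 (etai i) psX (etai i ^+ p) (psX ^+ p) (etai i ^+ (p ^ 2))
  (psX ^+ (p ^ 2)) (etai i ^+ (p ^ 3)) (psX ^+ (p ^ 3)) (psC Lam) epsV phiV.
rewrite -eS; apply: ilB => //; apply: ilMr; last by apply: JV_C; apply: Lam_hat.
by apply: srB; apply: srX; [apply: eta_VB | apply: VB_X].
Qed.

Lemma eta00 i : etai i 0%N 0%N = i%:R.
Proof.
have hy : fil2 A 1 (y i) := faddx_fil p divp v (fmul_fil p divp v i).
have hl := islog_faddx pp (fmul_fil p divp v i) (islog_fmul divp v pp i).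
have /fil2P/(_ 1%N 0%N) := islogD p1 1 hy hl.
rewrite addn0 expn1 => /(_ p1); rewrite /logT big_ord1 !psB !psD ell0.
rewrite rmorph1 mul1r expn0 expr1 /emb psMn (logc1 divp v p1) => e.
have := subr0_eq e; rewrite /eta => <-.
by rewrite addr0.
Qed.

Lemma pow_hat (w : V) n : (forall b, hat (1 - b) (w b)) ->
  forall b, hat (n - b) ((w ^+ n) b).
Proof.
move=> hw; elim: n => [|n IH] b.
  by rewrite sub0n expr0 ps1; apply: intg_hat; apply: (intg_nat Phi).
rewrite exprS psM; apply: (@il_sum _ Sb (JB (n.+1 - b))) => i _.
apply: (hatW iX _ (hatM iX ia (hw i) (IH _))).
by have := ltn_ord i; lia.
Qed.

Lemma eta_unit m i j : (i < j < p)%N ->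
  exists2 u, VB u & JV m ((etai j - etai i) * u - 1).
Proof.
case/andP=> ij jp.
have cop : coprime (j - i) p.
  by rewrite coprime_sym prime_coprime // gtnNdvd //; lia.
have ji : (0 < j - i)%N by lia.
have /(@coprimeP _ _ ji)[[a b] /= e] := cop.
pose w : V := 1 - (etai j - etai i) * a%:R.
have wi d : int (w d).
  rewrite /w psB ps1; apply: intgB; first exact: (intg_nat Phi).
  rewrite mulr_natr psMn; apply: intgMn; rewrite psB; apply: intgB; exact: eta_int.
have w00 : w 0%N 0%N = - (b * p)%:R.
  rewrite /w !psB mulr_natr !psMn !psB !eta00 !ps1.
  have -> : (j%:R - i%:R : A) *+ a = (a * (j - i))%:R.
    by rewrite natrM natrB ?mulr_natl // ltnW.
  have -> : (a * (j - i) = 1 + b * p)%N by lia.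
  by rewrite natrD opprD addrA subrr sub0r.
have hw d : hat (1 - d) (w d).
  case: d => [|d]; last by rewrite subSS sub0n; apply: intg_hat.
  have -> : w 0%N = - (b%:R * p%:R ^+ 1) + psX ^+ 1 * (fun k => w 0%N k.+1).
    apply/funext=> -[|k]; rewrite psD psN expr1 psXM -natrM ps_nat /=.
      by rewrite w00 addr0.
    by rewrite oppr0 add0r.
  apply: (hatD iX ia ir angle_split).
    apply: (hatN iX ia); apply: (hatMl iX ia); first by apply: intg_hat; apply: (intg_nat Phi).
    by apply: (hatW iX _ (hat_P iX ia ir angle_split 1)); lia.
  by apply: inI_hat; apply: inI0 => k; apply: wi.
pose N := (B + m)%N.
exists (a%:R * \sum_(k < N) w ^+ k).
  apply: (@srM _ VB); first exact: sr_nat.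
  by apply: (@sr_sum _ VB) => k _; apply: (@srX _ VB) => d; apply: intg_hat.
have -> : (etai j - etai i) * (a%:R * \sum_(k < N) w ^+ k) - 1 = - w ^+ N.
  have ew : (etai j - etai i) * a%:R = - (w - 1) by rewrite /w opprB subKr.
  by rewrite mulrA ew mulNr -subrX1 opprB addrAC subrr sub0r.
apply: (@ilN _ _ (JV m)); split=> [d|d dm]; apply: (hatW iX _ (pow_hat N hw d)) => //.
by rewrite /N; lia.
Qed.

Variable Ac : Y.
Hypothesis chk : ycheck p cE cF M Ac.
Local Notation prodE := (\prod_(i < p) etai i).
Local Notation evXV := (evX epsV phiV psX).

Lemma nil_V : JV M (epsV ^+ cE) /\ JV M (phiV ^+ cF).
Proof.
by split; rewrite -rmorphXn; apply: JV_C; [apply: eps_nil | apply: phi_nil].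
Qed.

Lemma prod_eta : JV M (prodE -
  evXV (if odd p then nth [::] Ac 0 else negX (nth [::] Ac 0))).
Proof.
have [nE nF] := nil_V.
have sE : VB epsV by apply: VB_C; apply: eps_S.
have sF : VB phiV by apply: VB_C; apply: phi_S.
have rt i : JV M (etai i ^+ p - evY epsV phiV psX (etai i) Ac).
  exact: (cert_sound p0 cF0 sE sF VB_X (eta_VB i) nE nF (JV_X M) chk (eta_core M i)).
have szA : (size Ac <= p)%N by case/andP: chk.
pose R := Poly (map evXV Ac).
have sR : (size R < size ('X^p : {poly V}))%N.
  by rewrite size_polyXn ltnS (leq_trans (size_Poly _)) // size_map.
have eR z : ('X^p - R).[z] = z ^+ p - evY epsV phiV psX z Ac.
  by rewrite hornerD hornerN hornerXn horner_pev.
pose ys : seq V := mkseq (fun i => etai i) p.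
have sys : size ys = p by rewrite size_mkseq.
have ynth i : (i < p)%N -> ys`_i = etai i by move=> ip; rewrite nth_mkseq.
have := @monic_roots _ _ (JV M) ys ('X^p - R).
have -> : \prod_(z <- ys) - z = (-1) ^+ p * prodE.
  have -> : prodE = \prod_(z <- ys) z.
    by rewrite /ys /mkseq big_map -[X in iota 0 X]subn0 -/(index_iota 0 p) big_mkord.
  rewrite -sys; elim: (ys) => [|z l IH]; first by rewrite !big_nil mul1r.
  by rewrite !big_cons IH /= exprS mulN1r !mulNr mulrCA.
have -> : ('X^p - R).[0] = - evXV (nth [::] Ac 0).
  rewrite eR expr0n gtn_eqF // sub0r; congr (- _); rewrite /evY.
  by case: (Ac) => [|u l] //=; rewrite mul0r addr0.
move=> h; have {}h : JV M (- evXV (nth [::] Ac 0) - (-1) ^+ p * prodE).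
  apply: h.
  - by rewrite monicE lead_coefDl ?size_polyN // lead_coefXn.
  - by rewrite size_polyDl ?size_polyN // size_polyXn sys.
  - move=> k; rewrite coefB coefXn; apply: srB; first exact: sr_nat.
    rewrite coef_Poly; case: (ltnP k (size Ac)) => hk.
      by rewrite (nth_map [::]) //; apply: evXS => //; apply: VB_X.
    by rewrite nth_default ?size_map //; apply: sr0.
  - by move=> z /mapP[i _ ->]; split; [exact: eta_VB | rewrite eR].
  - move=> i j; rewrite sys => ij; have /andP[h1 h2] := ij.
    by rewrite !ynth ?(ltn_trans h1) //; apply: eta_unit.
move: h; rewrite -signr_odd; case: (odd p); rewrite ?expr1 ?expr0.
  by rewrite mulN1r opprK addrC.
by rewrite mul1r evXN => /ilN; rewrite opprB.
Qed.

Definition anorm i : S := prodE i.+1.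

Lemma prodP_theta : theta (gprodP p divp v) = psC psX ^+ p * prodE.
Proof.
have -> : gprodP p divp v = \prod_(i < p) y i.
  by rewrite /gprodP; elim/big_rec2: _ => [|i a b _ ->]; [exact: gboneE | exact: gbmulE].
rewrite (rmorph_prod (@theta A)).
have hy i : fil2 A 1 (y i) := faddx_fil p divp v (fmul_fil p divp v i).
rewrite (eq_bigr (fun i : 'I_p => psC psX * etai i)); last first.
  by move=> i _; rewrite (etaE (hy i)).
by rewrite big_split prodr_const card_ord.
Qed.

Lemma acoef_norm i : psX ^+ i * gacoef p divp v i = psX ^+ c * anorm i.
Proof.
apply: psX_reg; rewrite !mulrA -!exprS prednK //.
have /(congr1 (@^~ i.+1)) := prodP_theta.
by rewrite -rmorphXn psCM.
Qed.

Lemma anorm_int i : int (anorm i).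
Proof.
pose ips := ps_frob Phi pp.
suff h : intg ips prodE by apply: h.
elim/big_rec: _ => [|j a _ ha]; first exact: intg1.
by apply: intgM => //; move=> b; apply: eta_int.
Qed.

Definition wnorm : V := fun i => if (0 < i)%N then anorm i else 0.

Lemma shearX (g : V) k : shear (g ^+ k) = shear g ^+ k.
Proof.
elim: k => [|k IH]; last by rewrite !exprS shearM IH.
by apply/funext=> -[|b]; rewrite /shear !expr0 !ps1 ?mul1r //= mulr0.
Qed.

Lemma w_norm j k : psX ^+ k * (swap (gwser p divp v) ^+ j) k =
  psX ^+ (c * j) * (wnorm ^+ j) k.
Proof.
have e : shear (swap (gwser p divp v)) = psC (psX ^+ c) * wnorm.
  apply/funext=> -[|i]; rewrite psCM /shear /wnorm /=.
    by rewrite ?mulr0.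
  by rewrite -acoef_norm.
have /(congr1 (@^~ k)) := shearX (swap (gwser p divp v)) j.
by rewrite e exprMn -rmorphXn -exprM psCM.
Qed.

Definition ccn j : S := psX ^+ j * psC (gcc p divp v j).
Definition MCn n : S := \sum_(0 <= k < n.+1) ccn (n - k)%N *
  \sum_(0 <= j < k.+1) ((-1) ^+ j * 'C(n + j, j)%:R) * (anorm 0 ^+ (n - j) * (wnorm ^+ j) k).

Lemma MC_norm n : gMC p divp v n = psX ^+ ((c - 1) * n) * MCn n.
Proof.
apply: (@psXn_reg _ n); rewrite mulrA -exprD.
have -> : (n + (c - 1) * n = c * n)%N by nia.
have -> : gMC p divp v n = \sum_(0 <= k < n.+1) psC (gcc p divp v (n - k)%N) *
   \sum_(0 <= j < k.+1) ((-1) ^+ j * 'C(n + j, j)%:R) *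
     (gacoef p divp v 0 ^+ (n - j) * (swap (gwser p divp v) ^+ j) k).
  apply/funext=> m; rewrite /gMC ps_sum big_mkord; apply: eq_bigr => k _.
  rewrite psCM; congr (_ * _); rewrite /gScoef ps_sum big_mkord.
  apply: eq_bigr => j _.
  have -> : (-1) ^+ j * 'C(n + j, j)%:R = psC ((-1) ^+ j * 'C(n + j, j)%:R) :> S.
    by rewrite rmorphM rmorphXn rmorphN rmorph1 rmorph_nat.
  rewrite psCM; congr (_ * _); rewrite gspowE -swapX.
  have -> : (fun q => gbpow (gwser p divp v) j q k) = swap (gwser p divp v ^+ j) k.
    by apply/funext=> q; rewrite gbpowE.
  by [].
rewrite /MCn mulr_sumr [RHS]mulr_sumr; apply: eq_big_nat => k /andP[_ kn].
rewrite sum_scale [RHS]sum_scale; apply: eq_big_nat => j /andP[_ jk].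
have -> : psX ^+ n = psX ^+ (n - k) * psX ^+ k :> S by rewrite -exprD subnK // -ltnS.
have ea : gacoef p divp v 0 ^+ (n - j) = psX ^+ (c * (n - j)) * anorm 0 ^+ (n - j).
  by have := acoef_norm 0; rewrite mul1r => ->; rewrite exprMn -exprM.
rewrite (ring_aux8 _ _ _ ea (w_norm j k)) -exprD -mulnDr subnK //.
by move: kn jk; rewrite !ltnS => kn jk; apply: leq_trans jk kn.
Qed.

Local Notation evFS_ := (evF epsS phiS).

Lemma sumF_sound (t : nat -> F) (G : nat -> S) r :
  (forall k, k \in r -> JB B (G k - evFS_ (t k))) ->
  JB B (\sum_(k <- r) G k - evFS_ (sumF t r)).
Proof.
elim: r => [|k r IH] h; first by rewrite big_nil subrr; apply: il0.
rewrite big_cons /sumF [foldr _ _ _]/= -/(sumF t r) evFD; apply: ilDc.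
  by apply: h; rewrite mem_head.
by apply: IH => j jr; apply: h; rewrite inE jr orbT.
Qed.

Let FM a b : JB B (evFS_ (mulF cE cF a b) - evFS_ a * evFS_ b).
Proof. exact: (evFM eps_S phi_S eps_nil phi_nil). Qed.
Let FS a : Sb (evFS_ a). Proof. exact: (evFS eps_S phi_S). Qed.

Lemma ev_natF k : evFS_ (natF k) = k%:R.
Proof.
rewrite /evF /pev /= /evE /pev /= !mulr0 !addr0 /evZ.
by have -> : int_of_Z (Z.of_nat k) = k by exact: (Z_of_intK (Posz k)).
Qed.

Variable n : nat.
Hypotheses (nM : (n.+1 < M)%N) (np : (n.+1 < p ^ 3)%N).

Lemma anorm_ev i : (i.+1 < M)%N ->
  JB B (anorm i - evFS_ (nth [::] (alF p Ac) i)).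
Proof.
move=> iM; have [_ /(_ i.+1 iM)] := prod_eta.
by rewrite psB evX_coef /alF -nth_behead.
Qed.

Lemma ccn_ev j : (j <= n)%N -> JB B (ccn j - evFS_ (ccF p cE cF j)).
Proof.
move=> jn.
have cE0 k : gcc p divp v (p ^ k).-1 = (p ^ k)%:R * ell k.
  have pk : (0 < p ^ k)%N by rewrite expn_gt0 p0.
  rewrite /gcc prednK //.
  have kp : (k < (p ^ k).+1)%N by rewrite ltnS ltnW // ltn_expl.
  rewrite (bigD1 (Ordinal kp)) //= eqxx mul1r big1 ?addr0 // => i.
  by rewrite -val_eqE /= eqn_exp2l // eq_sym => /negbTE ->; rewrite mul0r.
have cE1 k : ccn (p ^ k).-1 = (p ^ k)%:R * lam k.
  by rewrite /ccn cE0 rmorphM rmorph_nat /lam mulrCA [psX ^+ _ * _]mulrC.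
rewrite /ccF; case: eqP => [->|/eqP j0].
  have c0 : ccn 0 = 1 by have := cE1 0%N; rewrite expn0 mul1r lam0.
  by rewrite c0 ev_oneF subrr; apply: il0.
case: eqP => [jp|/eqP j1].
  have -> : j = (p ^ 1).-1 by rewrite expn1 -jp.
  rewrite cE1 expn1; apply: il_sym; apply: il_trans (FM _ _) _; rewrite ev_natF -mulrBr.
  apply: ilM; first exact: sr_nat.
  apply: il_trans (ev_lam1F eps_S phi_S phi_nil) _; rewrite lam1E.
  rewrite (_ : _ - _ = - Lam); first by apply: ilN; apply: Lam_hat.
  by move: epsS phiS Lam => e g L; rewrite opprD addrACA subrr addr0 opprD addrACA subrr addr0 opprD opprK addrCA addNr addr0.
case: eqP => [jp|/eqP j2].
  have -> : j = (p ^ 2).-1 by rewrite -jp.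
  rewrite cE1; apply: il_sym; apply: il_trans (FM _ _) _.
  by rewrite ev_natF evFN ev_epsF /epsS opprK subrr; apply: il0.
rewrite /ccn (_ : gcc _ _ _ j = 0); first by rewrite rmorph0 mulr0 subrr; apply: il0.
rewrite /gcc big1 // => -[k hk] _ /=; case: eqP => [e|]; last by rewrite mul0r.
case: k hk e => [|[|[|k]]] hk e.
- by move: j0; rewrite expn0 in e; case: e => ->.
- by move: j1; rewrite expn1 in e; rewrite e eqxx.
- by move: j2; rewrite e eqxx.
- have : (p ^ 3 <= p ^ k.+3)%N by rewrite leq_pexp2l.
  by rewrite -e => h; move: np jn h; lia.
Qed.

Lemma wpow_ev j : JV M.-1 (wnorm ^+ j - evXV (wpowF p cE cF M Ac j)).
Proof.
have nE : JV M.-1 (epsV ^+ cE) by rewrite -rmorphXn; apply: JV_C; apply: eps_nil.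
have nF : JV M.-1 (phiV ^+ cF) by rewrite -rmorphXn; apply: JV_C; apply: phi_nil.
have sE : VB epsV by apply: VB_C; apply: eps_S.
have sF : VB phiV by apply: VB_C; apply: phi_S.
have sX a : VB (evXV a) by apply: (evXS sE sF VB_X).
have sw : VB wnorm.
  by move=> [|i]; [apply: hat0 | apply: intg_hat; apply: anorm_int].
have hw : JV M.-1 (wnorm - evXV (wlF p Ac)).
  have h i : (i < M.-1)%N -> hat B ((wnorm - evXV (wlF p Ac)) i).
    case: i => [|i] iM; rewrite psB evX_coef /wnorm /=.
      by rewrite subrr; apply: hat0.
    by rewrite nth_behead; apply: anorm_ev; lia.
  by split=> [b|//]; rewrite psB; apply: (hatB iX ia ir angle_split); [apply: sw | apply: sX].
elim: j => [|j IH].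
  have -> : evXV (wpowF p cE cF M Ac 0) = evF epsV phiV oneF + psX * 0 by [].
  by rewrite ev_oneF mulr0 addr0 subrr; apply: il0.
rewrite exprS /wpowF iterS -/(wpowF p cE cF M Ac j).
apply: il_trans (il_sym (evXM sE sF VB_X nE nF (JV_X _) _ _)).
by apply: ilMc => //; apply: srX.
Qed.

Lemma MCn_ev : JB B (MCn n - evFS_ (MCF p cE cF M n Ac)).
Proof.
apply: sumF_sound => k; rewrite mem_iota => /andP[_ kn].
have scc : Sb (ccn (n - k)%N).
  have h := ccn_ev (leq_subr k n).
  by rewrite -(subrK (evFS_ (ccF p cE cF (n - k)%N)) (ccn _)); apply: srD => //; apply: il_sr h.
set inner := \sum_(0 <= j < k.+1) _.
have hin : JB B (inner - evFS_ (sumF (termF p cE cF M n Ac k) (iota 0 k.+1))).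
  apply: sumF_sound => j; rewrite mem_iota => /andP[_ jk].
  have [_ /(_ k)] := wpow_ev j; rewrite psB evX_coef => hw.
  have {}hw : JB B ((wnorm ^+ j) k - evFS_ (nth [::] (wpowF p cE cF M Ac j) k)).
    by apply: hw; lia.
  have sa : Sb (anorm 0) by apply: intg_hat; apply: anorm_int.
  have swn : Sb ((wnorm ^+ j) k).
    by rewrite -(subrK (evFS_ (nth [::] (wpowF p cE cF M Ac j) k)) (_ k)); apply: srD => //; apply: il_sr hw.
  have ssg : Sb ((-1) ^+ j * 'C(n + j, j)%:R).
    by apply: srM; [apply: srX; apply: srN; apply: sr1 | apply: sr_nat].
  rewrite /termF; case: ifP => [z|_].
    rewrite (iszFP epsS phiS z) subr0 in hw; rewrite subr0.
    by apply: ilM => //; apply: ilM => //; apply: srX.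
  apply: il_sym; apply: il_trans (FM _ _) _.
  have -> : evFS_ (binF n j) = (-1) ^+ j * 'C(n + j, j)%:R.
    rewrite /binF -signr_odd; case: (odd j); rewrite ?evFN ev_natF ?mulN1r ?mul1r //.
  rewrite -mulrBr; apply: ilM => //; apply: il_trans (FM _ _) _.
  apply: ilMc => //; first by apply: srX.
    have h0 : JB B (anorm 0 - evFS_ (nth [::] (alF p Ac) 0)) by apply: anorm_ev; lia.
    elim: (n - j)%N => [|m IH].
      have -> : anorm 0 ^+ 0 = evFS_ oneF by rewrite expr0 ev_oneF.
      exact: il_refl.
    rewrite iterS exprS; apply: il_trans (FM _ _) _; apply: ilMc => //.
    exact: il_sym.
  exact: il_sym.
have hc := ccn_ev (leq_subr k n).
case: ifP => [z|_].
  rewrite (iszFP epsS phiS z) subr0 in hc; rewrite subr0; apply: ilMr => //.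
  rewrite -(subrK (evFS_ (sumF (termF p cE cF M n Ac k) (iota 0 k.+1))) inner).
  by apply: srD => //; apply: il_sr hin.
apply: il_sym; apply: il_trans (FM _ _) _; apply: ilMc => //; exact: il_sym.
Qed.

Lemma gcc_int j : intg f (gcc p divp v j).
Proof.
apply: intg_sum => k _; apply: intgM; first exact: intg_nat.
by rewrite natrX; apply: (ell_int divpE v_int).
Qed.

Lemma MCn_int : int (MCn n).
Proof.
pose ips := ps_frob Phi pp.
have iw : intg ips wnorm.
  by move=> [|i]; [apply: (intg0 Phi) | apply: anorm_int].
apply: intg_sum => k _; apply: intgM.
  apply: intgM; first exact: intgX.
  by move=> m; rewrite /psC; case: (m == 0%N); [apply: gcc_int | apply: intg0].
apply: intg_sum => j _; apply: intgM.
  by apply: intgM; [apply: intgX; apply: intgN; apply: intg1 | apply: intg_nat].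
by apply: intgM; [apply: intgX; apply: anorm_int | apply: (intgX j iw)].
Qed.

Let hD := hatD iX ia ir angle_split.
Let hN := @hatN p _ Phi psX angle c iX ia.
Let hM := @hatM p _ Phi psX angle c iX ia.
Let hMl := @hatMl p _ Phi psX angle c iX ia.
Let hW := @hatW p _ Phi psX angle c iX.
Let hP := hat_P iX ia ir angle_split.
Let hI x : int x -> hat 0 x. Proof. exact: intg_hat. Qed.
Let hZ (m : ssrint.int) : hat 0 m%:~R.
Proof.
by case: m => k; apply: hI; [exact: (intg_nat Phi) | rewrite NegzE rmorphN; apply: intgN; exact: (intg_nat Phi)].
Qed.

Variables (we wf : nat).
Hypotheses (hwe : (c * we <= wE)%N) (hwf : (c * wf <= wF)%N).

Lemma wtE_sound k e : wtE p we k e -> hat (c * k) (evE epsS e).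
Proof.
have zE m : evZ S (zpow p m) = p%:R ^+ m.
  elim: m => [|m IH] //; rewrite exprS -IH /zpow iterS /evZ.
  have -> := rmorphM int_of_Z (Z.of_nat p) (iter m (Z.mul (Z.of_nat p)) (Zpos 1)).
  rewrite rmorphM; congr (_ * _).
  exact: (congr1 (fun z : ssrint.int => z%:~R : S) (Z_of_intK (Posz p))).
elim: e k => [|z e IH] k; first by move=> _; apply: hat0.
move=> /= /andP[/Z.eqb_spec hz /IH he]; apply: hD.
  rewrite hz /evZ.
  have -> := rmorphM int_of_Z (zpow p k) (Z.div z (zpow p k)).
  rewrite rmorphM mulrC; apply: hMl; first exact: hZ.
  by have h := hP k; rewrite -zE (mulnC k) in h; exact: h.
apply: (hW _ (hM (hW hwe eps_hat) he)); nia.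
Qed.

Lemma wtF_sound k l : wtF p we wf k l -> hat (c * k) (evFS_ l).
Proof.
elim: l k => [|e l IH] k; first by move=> _; apply: hat0.
move=> /= /andP[/wtE_sound he /IH hl]; apply: hD => //.
apply: (hW _ (hM (hW hwf phi_hat) hl)); nia.
Qed.

Lemma MC_reduce k (L : F) (u : S) :
  wtF p we wf k (addF (MCF p cE cF M n Ac) (negF L)) -> (c * k <= B)%N ->
  int u -> hat (c * k) (evFS_ L - u) ->
  inI (c * k + (c - 1) * n) (gMC p divp v n - psX ^+ ((c - 1) * n) * u).
Proof using All.
move=> /wtF_sound h1 kB iu h2; rewrite MC_norm -mulrBr addnC; apply: inIM => //.
  by rewrite -[psX ^+ _]mulr1; apply: inI0; apply: intg1.
apply: (hat_inI inI_div); first by apply: intgB => //; apply: MCn_int.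
have h3 : hat (c * k) (MCn n - evFS_ (MCF p cE cF M n Ac)).
  exact: (hW kB MCn_ev).
rewrite evFD evFN in h1.
rewrite -(subrK (evFS_ (MCF p cE cF M n Ac)) (MCn n)) -addrA; apply: hD => //.
by rewrite -(subrK (evFS_ L) (evFS_ (MCF p cE cF M n Ac))) -addrA; apply: hD.
Qed.

Definition u1 : S := psC (v 1) * psX ^+ c.
Definition u2 : S := psC (v 2) * psX ^+ (p ^ 2).-1.

Lemma vX_hat k m : hat m (psC (v k) * psX ^+ m).
Proof.
rewrite mulrC; apply: inI_hat; apply: inI0.
by move=> j; rewrite /psC; case: (j == 0%N); [apply: v_int | apply: intg0].
Qed.

Lemma pell1 : p%:R * ell 1 = v 1.
Proof. by rewrite (ell_untw v divpE) // big_ord1 ell0 mul1r expn0 expr1. Qed.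

Lemma pell2 : p%:R * ell 2 = v 2 + ell 1 * v 1 ^+ p.
Proof.
rewrite (ell_untw v divpE) // !big_ord_recl big_ord0 addr0 ell0 mul1r expn0 expr1.
by rewrite lift0 expn1.
Qed.

Lemma u1_lam : u1 = p%:R * lam 1.
Proof. by rewrite /u1 -pell1 rmorphM rmorph_nat /lam expn1 mulrA. Qed.

Lemma u2_lam : p%:R ^+ 2 * lam 2 = p%:R * u2 + u1 ^+ p.+1.
Proof.
have e1 : p%:R ^+ 2 * ell 2 = p%:R * v 2 + v 1 ^+ p.+1.
  by rewrite expr2 -mulrA pell2 mulrDr mulrA pell1 exprS.
have -> : u1 ^+ p.+1 = psC (v 1 ^+ p.+1) * psX ^+ (p ^ 2).-1.
  rewrite /u1 exprMn -rmorphXn -exprM; congr (_ * _ ^+ _).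
  by rewrite -mulnn; nia.
rewrite /lam /u2 mulrA [p%:R * (_ * _)]mulrA -mulrDl; congr (_ * _).
by rewrite -(rmorph_nat (@psC A)) -rmorphXn -!rmorphM -rmorphD e1.
Qed.

Hypotheses (B1 : (c <= B)%N) (wE1 : (c <= wE)%N) (wF1 : (c <= wF)%N).

Lemma u1_neg : hat (c + c) (u1 + p%:R).
Proof.
have -> : u1 + p%:R = p%:R ^+ 1 * (Lam + epsS + phiS).
  rewrite u1_lam -{2}[p%:R]mulr1 -mulrDr expr1 lam1E; congr (_ * _).
  by move: Lam epsS phiS => a b d; ring.
apply: hM; first by have := hP 1; rewrite mul1n.
apply: hD; [apply: hD |]; [exact: (hW B1 Lam_hat) | exact: (hW wE1 eps_hat) | exact: (hW wF1 phi_hat)].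
Qed.

Lemma final_odd (k q z : ssrint.int) (e3 f3 d : nat) :
  (e3 + f3 = 6)%N -> (d + f3 = 3 * p.+1)%N -> - k * (-1) ^+ f3 - q = p%:Z * z ->
  hat (c * d.+1) (p%:R ^+ e3 * k%:~R * epsS ^+ 3 - q%:~R * u1 ^+ d).
Proof using All.
move=> h6 hd hk.
have hu1 : hat c u1 by apply: vX_hat.
have u1X m : hat (c * m) (u1 ^+ m) by apply: (hatX iX ia).
apply: (@hat_divX _ _ _ _ _ _ 6).
have e2 : p%:R ^+ 2 * epsS = - (p%:R * u2 + u1 ^+ p.+1) by rewrite /epsS mulrN u2_lam.
have e6 : p%:R ^+ 6 = p%:R ^+ e3 * p%:R ^+ f3 :> S by rewrite -exprD h6.
have eU : u1 ^+ (3 * p.+1) = u1 ^+ d * u1 ^+ f3 by rewrite -exprD hd.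
have ek : - k%:~R * (-1) ^+ f3 - q%:~R = p%:R * z%:~R :> S.
  have /(congr1 (fun m : ssrint.int => m%:~R : S)) := hk.
  by rewrite rmorphB rmorphM rmorphN rmorphXn rmorphN1 rmorphM.
have -> := ring_odd e2 e6 eU ek.
set a := u1 ^+ p.+1 in e2 *; set b := p%:R * u2 in e2 *.
have hb : hat (c + c * p.+1) b.
  have h2 : hat (c * p.+1) u2.
    have e : (c * p.+1 = (p ^ 2).-1)%N by rewrite -mulnn; nia.
    by rewrite e; exact: (vX_hat 2 (p ^ 2).-1).
  by have := hM (hP 1) h2; rewrite mul1n expr1.
have ha : hat (c * p.+1) a by apply: u1X.
have hb' : hat (c * p.+1) b by apply: (hW _ hb); lia.
have t1 : hat (c + 3 * (c * p.+1)) ((b + a) ^+ 3 - u1 ^+ (3 * p.+1)).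
  have -> : u1 ^+ (3 * p.+1) = a ^+ 3 by rewrite /a -exprM mulnC.
  have -> : (b + a) ^+ 3 - a ^+ 3 = b * (b * b + 3%:R * (b * a) + 3%:R * (a * a)).
    by move: (a) (b) => x y; exact: ring_cube.
  have h3 : hat 0 3%:R by apply: hI; apply: (intg_nat Phi).
  apply: (hW _ (hM hb _)); last first.
    by apply: hD; [apply: hD; [exact: (hM hb' hb') | apply: hMl => //; exact: (hM hb' ha)] | apply: hMl => //; exact: (hM ha ha)].
  by lia.
have t2 : hat (c + c * f3) (u1 ^+ f3 - (-1) ^+ f3 * p%:R ^+ f3).
  case: f3 {h6 hd hk e6 eU ek} => [|g]; first by rewrite !expr0 mulr1 subrr; apply: hat0.
  rewrite -exprMn mulN1r subrXX opprK.
  have -> : (c + c * g.+1 = (c + c) + c * g)%N by rewrite mulnS addnA.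
  apply: hM; first exact: u1_neg.
  apply: (@il_sum _ Sb (JB (c * g))) => i _ /=.
  have hmP : hat c (- p%:R) by apply: hN; have := hP 1; rewrite mul1n.
  apply: (hW _ (hM (u1X (g - i)%N) (hatX iX ia i hmP))).
  by rewrite -mulnDr subnK // -ltnS.
have hk0 := hN (hZ k).
apply: hD.
  apply: hD.
    rewrite -mulNr; apply: (hW _ (hM (hM hk0 (hP e3)) t1)).
    by rewrite add0n; nia.
  apply: hN; apply: (hW _ (hM (hM (hM (hZ k) (hP e3)) (u1X d)) t2)).
  by rewrite add0n; nia.
have h4 := hM (hM (hM (hP 1) (hZ z)) (hP 6)) (u1X d); rewrite expr1 in h4.
by apply: (hW _ h4); rewrite !mul1n addn0; nia.
Qed.

Section Two.
Hypotheses (p2 : p = 2%N) (B2 : (1 < B)%N).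
Let q2 := pinv Phi.
Definition u3 : S := psC (v 3) * psX ^+ (p ^ 3).-1.

Let c1 : c = 1%N. Proof. by rewrite p2. Qed.
Let e2p : (2 : S) = p%:R. Proof. by rewrite p2. Qed.
Let hP2 a : hat a (2 ^+ a).
Proof. by rewrite e2p; have := hP a; rewrite c1 muln1. Qed.
Let hdiv a k x : hat (k + a) (2 ^+ a * x) -> hat k x.
Proof. by rewrite e2p => h; apply: (@hat_divX _ _ _ _ _ _ a); move: h; rewrite c1 muln1. Qed.
Let qE a : 2 ^+ a * q2 ^+ a = 1.
Proof. by have := pinvX Phi a; rewrite {1}p2. Qed.
Let canc a (x y : S) : 2 ^+ a * x = 2 ^+ a * y -> x = y.
Proof. by move=> e; rewrite -[x]mul1r -[y]mul1r -(qE a) [2 ^+ a * _]mulrC -!mulrA e. Qed.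

Lemma two_data : exists h h3 : S, [/\ hat 0 h, hat 0 h3, u2 = 2 ^+ 3 * h,
  lam 2 = 4 * h + 2 * lam 1 ^+ 3 &
  lam 3 = 64 * h3 + 32 * h ^+ 2 * lam 1 + 32 * h * lam 1 ^+ 4 + 16 * lam 1 ^+ 7].
Proof.
have eu1 : u1 = 2 * lam 1 by rewrite u1_lam e2p.
have E1 : (p ^ 1).-1 = 1%N by rewrite p2.
have E2 : (p ^ 2).-1 = 3%N by rewrite p2.
have E3 : (p ^ 3).-1 = 7%N by rewrite p2.
exists (q2 ^+ 3 * u2), (q2 ^+ 7 * u3).
have e2 : u2 = 2 ^+ 3 * (q2 ^+ 3 * u2) by rewrite mulrA qE mul1r.
have e3 : u3 = 2 ^+ 7 * (q2 ^+ 7 * u3) by rewrite mulrA qE mul1r.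
set h := q2 ^+ 3 * u2 in e2 *; set h3 := q2 ^+ 7 * u3 in e3 *.
have eh : hat 0 h.
  apply: (hdiv (a := 3)); rewrite -e2 add0n.
  by have := vX_hat 2 (p ^ 2).-1; rewrite -/u2 E2.
have eh3 : hat 0 h3.
  apply: (hdiv (a := 7)); rewrite -e3 add0n.
  by have := vX_hat 3 (p ^ 3).-1; rewrite -/u3 E3.
have el2 : lam 2 = 4 * h + 2 * lam 1 ^+ 3.
  apply: (canc (a := 2)); have := u2_lam; rewrite eu1 e2 {1 2 3}p2 => ->.
  by move: (h) (lam 1) => x y; exact: ring_l2.
have el3 : 2 * lam 3 = u3 + lam 1 * u2 ^+ 2 + lam 2 * u1 ^+ 4.
  have e : 2 * ell 3 = v 3 + ell 1 * v 2 ^+ 2 + ell 2 * v 1 ^+ 4.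
    have := ell_untw v divpE (isT : (0 < 3)%N); rewrite !big_ord_recl big_ord0 addr0.
    by rewrite ell0 mul1r expn0 expr1 !addrA {1}p2 !lift0 p2.
  have ec : psC (2 * ell 3) = 2 * psC (ell 3) :> S.
    by rewrite rmorphM (rmorph_nat (@psC A) 2).
  rewrite /lam /u3 /u2 /u1 mulrA -ec e !(E1, E2, E3, c1) !rmorphD (rmorphM _ (ell 1) (v 2 ^+ 2)) (rmorphM _ (ell 2) (v 1 ^+ 4)) !rmorphXn /=.
  by move: (psC (ell 1)) (psC (ell 2)) (psC (v 1)) (psC (v 2)) (psC (v 3)) psX => a b x y z t; ring.
split=> //; apply: (canc (a := 1)); rewrite expr1 el3 e3 e2 eu1 el2.
by move: (h) (h3) (lam 1) => x y z; exact: ring_l4.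
Qed.

Lemma lam1_one : exists2 k, hat 0 k & lam 1 = 1 + 4 * k.
Proof.
have [h [h3 [hh hh3 _ el2 _]]] := two_data.
exists (q2 ^+ 2 * (lam 1 - 1)); last first.
  have -> : 4 * (q2 ^+ 2 * (lam 1 - 1)) = 2 ^+ 2 * q2 ^+ 2 * (lam 1 - 1).
    by rewrite -mulrA; congr (_ * _); rewrite -natrX.
  by rewrite qE mul1r addrC subrK.
apply: (hdiv (a := 2)); rewrite mulrA qE mul1r add0n.
have hL : hat 2 Lam.
  exact: (hW B2 Lam_hat).
have hl3 : hat 4 (lam 3) by apply: lam_hat; rewrite p2.
have hl2 : hat 1 (lam 2) by apply: lam_hat; rewrite p2.
have g0 : hat 0 (lam 1) by apply: lam_hat; rewrite p2.
have g1 : hat 1 (1 + lam 1).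
  have -> : 1 + lam 1 = Lam - lam 2 - lam 3.
    by rewrite lam1E /epsS /phiS; move: (lam 2) (lam 3) Lam => x y z; exact: ring_l5.
  by apply: hD; [apply: hD; [exact: (hW _ hL) | exact: hN] | apply: hN; exact: (hW _ hl3)].
have -> : lam 1 - 1 = Lam - lam 3 - (2 ^+ 2 * h + 2 ^+ 1 * ((1 + lam 1) * (1 - lam 1 + lam 1 ^+ 2))).
  apply: (ring_l6 (x := lam 2)); first by rewrite lam1E /epsS /phiS.
  exact: el2.
have h0 : hat 0 (1 - lam 1 + lam 1 ^+ 2).
  apply: hD; [apply: hD; [exact: hat1 | exact: hN] | exact: (hatX iX ia 2 g0)].
apply: hD; [apply: hD => //; apply: hN; exact: (hW _ hl3) | apply: hN; apply: hD].
  by have := hM (hP2 2) hh.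
by have := hM (hP2 1) (hM g1 h0).
Qed.

Lemma lam1_pow m : exists2 k, hat 0 k & lam 1 ^+ m = 1 + 4 * k.
Proof.
have [k hk e] := lam1_one; have g0 : hat 0 (lam 1) by apply: lam_hat; rewrite p2.
exists (k * \sum_(i < m) lam 1 ^+ i).
  apply: hMl => //; apply: (@sr_sum _ Sb) => i _; exact: (hatX iX ia i g0).
rewrite mulrA -[LHS](subrK 1) subrX1 addrC; congr (1 + _ * _).
by rewrite {1}e addrC addKr.
Qed.

Let hn k : hat 0 k%:R. Proof. by apply: hI; apply: (intg_nat Phi). Qed.

Lemma final_two2 : hat 7 (18%:R * phiS + 36%:R * epsS ^+ 3 - (u1 ^+ 6 + u2 ^+ 2)).
Proof using All.
have [h [h3 [hh hh3 e2 el2 el3]]] := two_data.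
have [k1 i1 f1] := lam1_pow 1; have [k3 i3 f3] := lam1_pow 3.
have [k4 i4 f4] := lam1_pow 4; have [k6 i6 f6] := lam1_pow 6; have [k7 i7 f7] := lam1_pow 7.
rewrite expr1 in f1; rewrite f3 in el2; rewrite f4 f7 {1}f1 in el3.
have eu : u1 ^+ 6 + u2 ^+ 2 = 64 * (1 + 4 * k6) + 64 * h ^+ 2.
  by rewrite u1_lam exprMn f6 e2 p2; move: (h) (k6) => x y; exact: ring_l7.
rewrite /phiS /epsS (ring_two2 el2 el3 eu); apply: (hM (hP2 7)).
have hX2 x m : hat 0 x -> hat 0 (x ^+ m) by move=> hx; exact: (hatX iX ia m hx).
have hB' x y : hat 0 x -> hat 0 y -> hat 0 (x - y) by move=> hx hy; apply: hD => //; apply: hN.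
have h12 : hat 0 (1 + 2 * h) by apply: hD; [exact: hat1 | apply: hMl => //; exact: hn].
have h1' := hat1 Phi psX angle c.
do ![apply: hB' | apply: hD | apply: hMl | apply: hN | apply: hX2 | exact: hn | assumption].
Qed.

Lemma final_two4 : hat 11 (600%:R * epsS ^+ 2 * phiS + 400%:R * epsS ^+ 5 - u1 ^+ 4 * u2 ^+ 2).
Proof using All.
have [h [h3 [hh hh3 e2 el2 el3]]] := two_data.
have [k1 i1 f1] := lam1_pow 1; have [k3 i3 f3] := lam1_pow 3.
have [k4 i4 f4] := lam1_pow 4; have [k7 i7 f7] := lam1_pow 7.
rewrite expr1 in f1; rewrite f3 in el2; rewrite f4 f7 {1}f1 in el3.
pose a := 1 + 2 * h + 4 * k3.
pose b := 4 * h3 + 2 * h ^+ 2 * (1 + 4 * k1) + 2 * h * (1 + 4 * k4) + (1 + 4 * k7).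
have eu : u1 ^+ 4 * u2 ^+ 2 = 1024 * h ^+ 2 * (1 + 4 * k4).
  by rewrite u1_lam exprMn f4 e2 p2; move: (h) (k4) => x y; exact: ring_l8.
have ea : lam 2 = 2 * a.
  by rewrite el2 /a; move: (h) (k3) => x y; exact: ring_l9.
have eb : lam 3 = 16 * b.
  by rewrite el3 /b; move: (h) (h3) (k1) (k4) (k7) => x y z t w; exact: ring_l10.
rewrite /phiS /epsS (ring_two4 erefl erefl ea eb eu erefl erefl); apply: (hM (hP2 11)).
have hX2 x m : hat 0 x -> hat 0 (x ^+ m) by move=> hx; exact: (hatX iX ia m hx).
have hB' x y : hat 0 x -> hat 0 y -> hat 0 (x - y) by move=> hx hy; apply: hD => //; apply: hN.
have h1' := hat1 Phi psX angle c.
do ![apply: hB' | apply: hD | apply: hMl | apply: hN | apply: hX2 | exact: hn | assumption].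
Qed.

End Two.
End Link.

(** * The ring BP and normal forms *)

From mathcomp Require Import finmap.

Local Notation BQ := {malg rat[{cmonom nat}]}.

Section Quotient.
Variables (R : comNzRingType) (al x : ps R) (g : R -> R).

Fixpoint nf_seq n : seq R :=
  if n is n'.+1 then rcons (nf_seq n')
    (g (x n' + \sum_(i < n') al (n' - i)%N * (nf_seq n')`_i)) else [::].

Lemma size_nf_seq n : size (nf_seq n) = n.
Proof. by elim: n => // n IH; rewrite [nf_seq _]/= size_rcons IH. Qed.

Lemma nf_seqS n : nf_seq n.+1 = rcons (nf_seq n)
    (g (x n + \sum_(i < n) al (n - i)%N * (nf_seq n)`_i)).
Proof. by []. Qed.

Definition nf_quo : ps R := fun i => (nf_seq i.+1)`_i.

Lemma nth_nf_seq m i : (i < m)%N -> (nf_seq m)`_i = nf_quo i.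
Proof.
elim: m => // m IH; rewrite ltnS leq_eqVlt => /predU1P[->//|im].
by rewrite nf_seqS nth_rcons size_nf_seq im IH.
Qed.

Lemma nf_quoE n : nf_quo n = g (x n + \sum_(i < n) al (n - i)%N * nf_quo i).
Proof.
have -> : nf_quo n = (nf_seq n.+1)`_n by [].
rewrite nf_seqS nth_rcons size_nf_seq ltnn eqxx; congr (g (_ + _)).
by apply: eq_bigr => i _; rewrite nth_nf_seq.
Qed.

Lemma nf_lift (s a t0 t c h : R) (y : R) : s - y = a * t -> y - c = a * t0 + h ->
  s = c + a * (t0 + t) + h.
Proof. by move=> e1 e2; rewrite -[s](subrK y) e1 -[y](subrK c) e2; ring. Qed.
End Quotient.

Section PLocal.
Variable p : nat.
Hypothesis pp : prime p.
Local Notation pl := (plocal p).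

Lemma plocalI (r : rat) (a : int) (b : nat) : coprime b p ->
  r * b%:R = a%:~R -> pl r.
Proof.
move=> cb e; rewrite /plocal.
have e2 : numq r * b%:Z = a * denq r.
  by apply: (@intr_inj rat); rewrite !rmorphM /= numqE -e mulrAC.
have : (`|denq r| %| `|numq r| * b)%N.
  by rewrite -[b]absz_nat -abszM e2 abszM dvdn_mull.
rewrite Gauss_dvdr; last by rewrite coprime_sym coprime_num_den.
by move/coprime_dvdl; apply.
Qed.

Lemma plocalE r : pl r -> exists b : nat,
  [/\ (0 < b)%N, coprime b p & r * b%:R = (numq r)%:~R].
Proof.
move=> h; exists `|denq r|%N; split=> //; first by rewrite absz_gt0 denq_neq0.
by rewrite numqE pmulrn absz_denq.
Qed.

Lemma plocal_int (z : int) : pl z%:~R.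
Proof. by apply: (@plocalI _ z 1%N); rewrite ?coprime1n ?mulr1. Qed.

Lemma plocal_nat n : pl n%:R.
Proof. by rewrite pmulrn; apply: plocal_int. Qed.

Lemma plocalD r s : pl r -> pl s -> pl (r + s).
Proof.
move=> /plocalE[b [_ cb e]] /plocalE[d [_ cd h]].
apply: (@plocalI _ (numq r * d%:Z + numq s * b%:Z) (b * d)%N).
  by rewrite coprimeMl cb.
rewrite natrM rmorphD !rmorphM /= -!pmulrn -e -h mulrDl.
by congr (_ + _); rewrite !mulrA // mulrAC.
Qed.

Lemma plocalM r s : pl r -> pl s -> pl (r * s).
Proof.
move=> /plocalE[b [_ cb e]] /plocalE[d [_ cd h]].
apply: (@plocalI _ (numq r * numq s) (b * d)%N).
  by rewrite coprimeMl cb.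
by rewrite natrM rmorphM /= -e -h mulrACA.
Qed.

Lemma plocalN r : pl r -> pl (- r).
Proof.
by move=> h; rewrite -mulN1r; apply: plocalM => //; apply: (plocal_int (-1)).
Qed.

Lemma plocal_digit r : pl r -> exists2 d : nat, (d < p)%N & pl ((r - d%:R) / p%:R).
Proof.
move=> /plocalE[b [b0 cb e]].
have /(@coprimeP _ _ b0)[[u t] /= ut] := cb.
have p0 := prime_gt0 pp.
have pz : p%:Z != 0 by lia.
pose a := numq r * u%:Z.
have a0 := modz_ge0 a pz.
have ap : ((a %% p)%Z < p%:Z) by apply: ltz_pmod; lia.
pose d := `|(a %% p)%Z|%N; pose q := (a %/ p)%Z.
have dE : d%:Z = (a %% p)%Z by rewrite /d gez0_abs.
exists d; first by lia.
have ed : a = q * p%:Z + d%:Z by rewrite dE; exact: divz_eq.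
have pn : (p%:R : rat) != 0 by rewrite pnatr_eq0; lia.
apply: (@plocalI _ (q * b%:Z - numq r * t%:Z) b) => //.
have utR : u%:R * b%:R = 1 + t%:R * p%:R :> rat.
  by rewrite -natrM (_ : (u * b = 1 + t * p)%N); [rewrite natrD natrM | lia].
have edR : r * b%:R * u%:R = q%:~R * p%:R + d%:R :> rat.
  have := congr1 (fun z : int => z%:~R : rat) ed.
  by rewrite /a rmorphM rmorphD rmorphM /= e -!pmulrn.
have dR : d%:R = r * b%:R * u%:R - q%:~R * p%:R :> rat.
  by rewrite edR addrAC subrr add0r.
apply: (mulfI pn); rewrite mulrA [p%:R * (_ / _)]mulrC mulfVK //.
rewrite rmorphB !rmorphM /= -e -!pmulrn dR.
transitivity (r * b%:R - r * b%:R * (u%:R * b%:R) + q%:~R * p%:R * b%:R).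
  by move: (b%:R) (u%:R) (q%:~R) (p%:R : rat) => x y z w; ring.
rewrite utR; move: (b%:R) (t%:R) (q%:~R) (p%:R : rat) => x y z w; ring.
Qed.

Lemma digit_inj (d d' : nat) (r : rat) : (d < p)%N -> (d' < p)%N -> pl r ->
  d%:R - d'%:R = p%:R * r -> d = d'.
Proof.
move=> dp dp' /plocalE[b [b0 cb e]] h.
have ei : (d%:Z - d'%:Z) * b%:Z = p%:Z * numq r.
  by apply: (@intr_inj rat); rewrite !rmorphM rmorphB /= -!pmulrn -e h mulrA.
have : (p %| `|d%:Z - d'%:Z| * b)%N.
  by rewrite -[b]absz_nat -abszM ei abszM dvdn_mulr.
rewrite Gauss_dvdl; last by rewrite coprime_sym.
case: (posnP `|d%:Z - d'%:Z|%N) => [|h0 /(dvdn_leq h0)]; lia.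
Qed.

Local Notation iB := (inBP p).
Let p0 : (p%:R : rat) != 0.
Proof. by rewrite pnatr_eq0 -lt0n prime_gt0. Qed.

Lemma inBP0 : iB (0 : BQ).
Proof. by move=> m; rewrite mcoeff0; apply: (plocal_nat 0). Qed.

Lemma inBPU (r : rat) k : pl r -> iB (<< r *g k >> : BQ).
Proof.
move=> h m; rewrite mcoeffU; case: (k == m) => //; exact: (plocal_nat 0).
Qed.

Lemma inBP1 : iB (1 : BQ).
Proof. by apply: inBPU; apply: (plocal_nat 1). Qed.

Lemma inBPD (x y : BQ) : iB x -> iB y -> iB (x + y).
Proof. by move=> hx hy m; rewrite mcoeffD; apply: plocalD. Qed.

Lemma inBPZ r (x : BQ) : pl r -> iB x -> iB (r *: x).
Proof. by move=> hr hx m; rewrite mcoeffZ; apply: plocalM. Qed.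

Lemma inBPN (x : BQ) : iB x -> iB (- x).
Proof. by rewrite -scaleN1r; apply: inBPZ; apply: (plocal_int (-1)). Qed.

Lemma inBP_sum (I : Type) (s : seq I) (F : I -> BQ) :
  (forall i, iB (F i)) -> iB (\sum_(i <- s) F i).
Proof.
by move=> h; elim/big_rec: _ => [|i x _ hx]; [apply: inBP0 | apply: inBPD].
Qed.

Lemma inBPM (x y : BQ) : iB x -> iB y -> iB (x * y).
Proof.
move=> hx hy; rewrite malgME; apply: inBP_sum => k1; apply: inBP_sum => k2.
by apply: inBPU; apply: plocalM.
Qed.

Lemma inBPX (x : BQ) n : iB x -> iB (x ^+ n).
Proof.
by move=> hx; elim: n => [|n IH]; [apply: inBP1 | rewrite exprS; apply: inBPM].
Qed.

Lemma malgU1M (k l : {cmonom nat}) : << k >> * << l >> = << (monalg.mul k l) >> :> BQ.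
Proof. by rewrite malgM_def fgmulUU mulr1. Qed.

Definition frobm (k : {cmonom nat}) : BQ := << k >> ^+ p.

Lemma frobm_mmorphism : mmorphism frobm.
Proof.
split=> [k l|]; first by rewrite /frobm -malgU1M exprMn.
by rewrite /frobm; exact: expr1n.
Qed.

HB.instance Definition _ :=
  isMultiplicative.Build {cmonom nat} BQ frobm frobm_mmorphism.

Definition sgBP (x : BQ) : BQ := mmap (@malgC {cmonom nat} rat) frobm x.

Lemma sgBPU r k : sgBP << r *g k >> = r *: frobm k.
Proof. by rewrite /sgBP mmapU mul_malgC. Qed.

Lemma sgBP_int x : iB x -> iB (sgBP x).
Proof.
move=> hx; rewrite /sgBP mmapE; apply: inBP_sum => k.
rewrite mul_malgC /frobm; apply: inBPZ; first exact: hx.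
by apply: inBPX; apply: inBPU; apply: (plocal_nat 1).
Qed.

Lemma sgBP1 : sgBP 1 = 1.
Proof.
transitivity (1 *: frobm monalg.one); first exact: sgBPU.
by rewrite scale1r; case: frobm_mmorphism.
Qed.

Lemma sgBPE x : sgBP x = \sum_(k <- finmap.enum_fset (msupp x)) x@_k *: frobm k.
Proof. by rewrite /sgBP mmapE; apply: eq_bigr => k _; rewrite mul_malgC. Qed.

Lemma sgBPM x y : sgBP (x * y) = sgBP x * sgBP y.
Proof.
rewrite malgME {1}/sgBP raddf_sum (sgBPE x) (sgBPE y) big_distrlr /=.
apply: eq_bigr => k _; rewrite raddf_sum /=; apply: eq_bigr => l _.
rewrite mmapU mul_malgC -scalerAl -scalerAr scalerA; congr (_ *: _).
by case: frobm_mmorphism => h _; exact: h.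
Qed.

Definition divBP (x : BQ) : BQ := (p%:R)^-1 *: x.

Lemma divBPE x : p%:R * divBP x = x.
Proof. by rewrite mulr_natl /divBP -scaler_nat scalerA mulfV // scale1r. Qed.

Definition bp_frob : frob0 p BQ.
Proof.
apply: (@Frob0 _ _ (inBP p) sgBP (divBP 1)).
- exact: divBPE.
- exact: inBP0.
- exact: inBP1.
- exact: inBPD.
- exact: inBPN.
- exact: inBPM.
- exact: sgBP_int.
- exact: mmap0.
- exact: sgBP1.
- exact: mmapD.
- exact: sgBPM.
Defined.

Lemma pinv_bp x : pinv bp_frob * x = divBP x.
Proof. by rewrite /= /divBP -scalerAl mul1r. Qed.

Lemma frob_liftU1 k : frob_lift bp_frob (<< k >> : BQ).
Proof.
split; first by apply: inBPU; apply: (plocal_nat 1).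
rewrite pinv_bp (_ : sg _ _ = frobm k); last by rewrite /= sgBPU scale1r.
by rewrite subrr /divBP scaler0; apply: inBP0.
Qed.

Lemma frob_lift_p (z : BQ) : iB z -> frob_lift bp_frob (p%:R * z).
Proof.
move=> hz; split.
  by rewrite mulr_natl -scaler_nat; apply: inBPZ => //; apply: plocal_nat.
rewrite pinv_bp /divBP mulr_natl (_ : sg _ _ = sgBP z *+ p); last exact: mmapMn.
have e : (p ^ p = p ^ p.-1 * p)%N by rewrite -expnSr prednK // prime_gt0.
rewrite exprMn_n e mulrnA -mulrnBl -scaler_nat scalerA mulVf // scale1r.
apply: inBPD; first exact: sgBP_int.
apply: inBPN; rewrite -scaler_nat; apply: inBPZ; first exact: plocal_nat.
exact: inBPX.
Qed.

Lemma frob_lift_Mn (R : comNzRingType) (f : frob0 p R) (x y : R) d :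
  frob_lift f x -> frob_lift f y -> frob_lift f (x *+ d + y).
Proof.
move=> hx hy; elim: d => [|d IH]; first by rewrite mulr0n add0r.
by rewrite mulrS -addrA; apply: frob_liftD.
Qed.

Fact scale_digit (V : lalgType rat) (x : V) (y : rat) d :
  (d%:R + p%:R * y) *: x = x *+ d + p%:R * (y *: x).
Proof. by rewrite scalerDl -scalerA !scaler_nat mulr_natl. Qed.

Lemma malgUE (a : rat) k : << a *g k >> = a *: << k >> :> BQ.
Proof.
by rewrite -mul_malgC malgM_def fgmulUU mulr1 mul1m.
Qed.

Lemma bp_frob_lift x : intg bp_frob x -> frob_lift bp_frob x.
Proof.
move=> hx; rewrite (monalgE x); apply: frob_lift_sum => // k.
have [d [y hy e]] : exists d : nat, exists2 y, pl y & x@_k = d%:R + p%:R * y.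
  have [d _ he] := plocal_digit (hx k); exists d, ((x@_k - d%:R) / p%:R) => //.
  by rewrite [p%:R * _]mulrC mulfVK // addrC subrK.
rewrite e malgUE scale_digit; apply: frob_lift_Mn; first exact: frob_liftU1.
apply: frob_lift_p; apply: inBPZ => //; apply: inBPU; exact: (plocal_nat 1).
Qed.

Lemma mcoeffU1M (k m : {cmonom nat}) (x : BQ) : (<< k >> * x)@_(monalg.mul k m) = x@_m.
Proof.
have kI : injective (fun l : {cmonom nat} => (monalg.mul k l)).
  move=> l l' e; apply/eqP/cmP => i.
  by have := congr1 (fun q : cmonom nat => q i) e; rewrite /= !cmM => /addnI.
rewrite malgM_def fgmulUg raddf_sum /= [in RHS](monalgE x) raddf_sum /=.
by apply: eq_bigr => l _; rewrite !mcoeffU mul1r (inj_eq kI).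
Qed.

Lemma vv_int j : intg bp_frob (vv j).
Proof. by apply: inBPU; apply: (plocal_nat 1). Qed.

Lemma sg_vv j : sg bp_frob (vv j) = (vv j : BQ) ^+ p.
Proof. by rewrite /= sgBPU scale1r. Qed.

Lemma vv_reg x : intg bp_frob (pinv bp_frob * ((vv 1 : BQ) * x)) ->
  intg bp_frob x -> intg bp_frob (pinv bp_frob * x).
Proof.
rewrite !pinv_bp => h _ m; have := h (monalg.mul (ucm 0) m).
by rewrite /divBP !mcoeffZ mcoeffU1M.
Qed.

Lemma digitpoly_inj (x y T : BQ) : digitpoly p x -> digitpoly p y -> iB T ->
  x - y = p%:R * T -> x = y /\ T = 0.
Proof.
move=> hx hy hT e; suff xy : x = y.
  split=> //; rewrite -[T]scale1r -(mulVf p0) -scalerA scaler_nat -[T *+ p]mulr_natl -e.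
  by rewrite xy subrr scaler0.
apply/malgP => m; have [d dp ed] := hx m; have [d' dp' ed'] := hy m.
rewrite ed ed'; congr (_%:R); apply: (digit_inj dp dp' (hT m)).
by rewrite -ed -ed' -mcoeffB e mulr_natl mcoeffMn mulr_natl.
Qed.

Lemma digit_reduce (y : BQ) : exists t : BQ, iB y -> iB t /\ digitpoly p (y + p%:R * t).
Proof.
have /choice[e he] : forall r : rat, exists s : rat, pl r ->
    pl s /\ exists2 d : nat, (d < p)%N & r + p%:R * s = d%:R.
  move=> r; case: (boolP (pl r)) => [h|_]; last by exists 0.
  have [d dp hd] := plocal_digit h; exists (- ((r - d%:R) / p%:R)) => _; split.
    exact: plocalN.
  by exists d => //; rewrite mulrN [p%:R * _]mulrC mulfVK // subKr.
exists [malg k in msupp y => e y@_k] => hy.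
split=> m; rewrite ?mcoeffD ?(mulr_natl, mcoeffMn) mcoeffE; case: ifP => hm.
- by case: (he _ (hy m)).
- exact: (plocal_nat 0).
- by rewrite -mulr_natl; case: (he _ (hy m)).
- by exists 0%N; rewrite ?prime_gt0 // mul0rn addr0 mcoeff_outdom // hm.
Qed.

Section NormalForm.
Variable al : ps BQ.
Hypotheses (al0 : al 0%N = p%:R) (al_int : forall n, iB (al n)).

Lemma nf_exists (x : ps BQ) : (forall n, iB (x n)) ->
  exists2 t : ps BQ, (forall n, iB (t n)) & forall n, digitpoly p ((x + al * t) n).
Proof.
move=> hx; have /choice[g hg] := digit_reduce.
pose t := nf_quo al x g; have tE n := nf_quoE al x g n.
rewrite -/t in tE.
have hy n : (forall i, (i < n)%N -> iB (t i)) ->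
    iB (x n + \sum_(i < n) al (n - i)%N * t i).
  move=> h; apply: inBPD => //; elim/big_rec: _ => [|i z _ hz]; first exact: inBP0.
  by apply: inBPD => //; apply: inBPM => //; apply: h.
have ti n : iB (t n).
  elim/ltn_ind: n => n IH; rewrite tE; exact: (hg _ (hy n IH)).1.
exists t => // n; rewrite psD mulrC psM big_ord_recr /= subnn al0 addrA.
rewrite [t n * _]mulrC (eq_bigr (fun i : 'I_n => al (n - i)%N * t i)); last by move=> i _; rewrite mulrC.
rewrite [t n]tE; exact: (hg _ (hy n (fun i _ => ti i))).2.
Qed.

Lemma nf_lowest (s t h : ps BQ) c m : (forall n, digitpoly p (s n)) ->
  (forall n, iB (t n)) -> digitpoly p c ->
  s = psC c * psX ^+ m + al * t + psX ^+ m.+1 * h ->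
  (forall i, (i < m)%N -> s i = 0) /\ s m = c.
Proof.
move=> hs ht hc e.
pose ci i := if i == m then c else 0.
have dci i : digitpoly p (ci i).
  rewrite /ci; case: ifP => // _ k; exists 0%N; rewrite ?prime_gt0 //.
  by rewrite mcoeff0.
have key i : (i <= m)%N -> s i = ci i /\ t i = 0.
  elim/ltn_ind: i => i IH im; apply: digitpoly_inj => //.
  have := congr1 (fun z : ps BQ => z i) e.
  rewrite !psD psCM psXn psXnM ltnS im addr0 => ->.
  have -> : c * (i == m)%:R = ci i by rewrite /ci; case: (i == m); rewrite ?mulr1 ?mulr0.
  rewrite addrAC subrr add0r mulrC psM big_ord_recr /= subnn al0 [t i * _]mulrC.
  rewrite big1 ?add0r // => j _.
  by have [|_ ->] := IH j (ltn_ord j); rewrite ?mul0r // ltnW // (leq_trans (ltn_ord j)).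
split=> [i im|]; last by have [-> _] := key m (leqnn m); rewrite /ci eqxx.
by have [-> _] := key i (ltnW im); rewrite /ci ltn_eqF.
Qed.
End NormalForm.

Lemma NF_lowestI (x : ps BQ) c m : (forall n, iB (anglep p n)) ->
  anglep p 0%N = p%:R -> (forall n, iB (x n)) -> digitpoly p c ->
  inI (frob1 pp bp_frob) psX (anglep p : ps BQ) m.+1 (x - psC (c : BQ) * psX ^+ m) ->
  NF_lowest p x c m.
Proof.
move=> ai a0 hx hc [t0 [h [it0 ih e]]].
split.
  have [t it ht] := nf_exists a0 ai hx.
  exists (x + (anglep p : ps BQ) * t); split=> //; exists t => // n.
  by rewrite psD addrAC subrr add0r.
move=> s [ds [t it es]].
have {}es : (s : ps BQ) - x = (anglep p : ps BQ) * t by apply/funext.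
apply: (@nf_lowest (anglep p) a0 s (t0 + t) h c m) => //.
  by move=> n; rewrite psD; apply: inBPD => //; apply: it0.
exact: (nf_lift es e).
Qed.
End PLocal.

Definition mpow (i n : nat) : {cmonom nat} := iter n (fun k => monalg.mul (ucm i) k) monalg.one.

Lemma mpowS i n : mpow i n.+1 = monalg.mul (ucm i) (mpow i n).
Proof. by []. Qed.

Lemma morph_exp_iter (K : Type) (R : comNzRingType) (h : K -> R) (mu : K -> K -> K) o u n :
  h o = 1 -> (forall k l, h k * h l = h (mu k l)) -> h u ^+ n = h (iter n (mu u) o).
Proof. by move=> ho hM; elim: n => [|n IH]; rewrite ?expr0 // exprS IH hM. Qed.

Lemma vvX i n : (vv i : BQ) ^+ n = << mpow i.-1 n >>.
Proof.
exact: (@morph_exp_iter _ BQ (fun k => << k >>) (@monalg.mul _) monalg.one (ucm i.-1) n erefl malgU1M).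
Qed.

Lemma mpowE i n j : (mpow i n : cmonom nat) j = (n * (i == j))%N.
Proof.
elim: n => [|n IH]; first exact: cm1.
by rewrite (mpowS i n) cmM ucmE IH mulSn.
Qed.

Lemma digitpolyU p q k : (q < p)%N -> digitpoly p (q%:R * << k >> : BQ).
Proof.
move=> qp m; rewrite mulr_natl mcoeffMn mcoeffU.
by case: (k == m); [exists q | exists 0%N; rewrite ?mul0rn //; lia].
Qed.

Lemma digitpolyU1 k : digitpoly 2 (<< k >> : BQ).
Proof.
move=> m; rewrite mcoeffU; case: (k == m).
  by exists 1%N.
by exists 0%N.
Qed.

Lemma digitpolyD (x y : BQ) : (forall m, x@_m = 0 \/ x@_m = 1) ->
  (forall m, y@_m = 0 \/ y@_m = 1) -> (forall m, x@_m = 0 \/ y@_m = 0) ->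
  digitpoly 2 (x + y).
Proof.
move=> hx hy hxy m; rewrite mcoeffD.
case: (hxy m) => ->; rewrite ?add0r ?addr0.
  by case: (hy m) => ->; [exists 0%N | exists 1%N].
by case: (hx m) => ->; [exists 0%N | exists 1%N].
Qed.

Lemma mcoeffU01 (k m : {cmonom nat}) :
  (<< k >> : BQ)@_m = 0 \/ (<< k >> : BQ)@_m = 1.
Proof. by rewrite mcoeffU; case: (k == m); [right | left]. Qed.

Lemma digitpolyUU k l : k != l -> digitpoly 2 (<< k >> + << l >> : BQ).
Proof.
move=> kl.
have h m : (<< k >> : BQ)@_m = 0 \/ (<< l >> : BQ)@_m = 0.
  case: (eqVneq k m) kl => [->|km] kl; [right | left].
    by rewrite mcoeffU eq_sym (negbTE kl).
  by rewrite mcoeffU (negbTE km).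
exact: (digitpolyD (mcoeffU01 k) (mcoeffU01 l) h).
Qed.

Lemma digit_two2 : digitpoly 2 (vv 1 ^+ 6 + vv 2 ^+ 2).
Proof.
have kl : mpow 1.-1 6 != mpow 2.-1 2.
  apply/eqP => e.
  have : (mpow 1.-1 6 : cmonom nat) 0%N = (mpow 2.-1 2 : cmonom nat) 0%N.
    exact: (congr1 (fun k : cmonom nat => k 0%N) e).
  by rewrite !mpowE.
have h := digitpolyUU kl.
rewrite -(vvX 1 6) -(vvX 2 2) in h; exact: h.
Qed.

Lemma digit_two4 : digitpoly 2 (vv 1 ^+ 4 * vv 2 ^+ 2).
Proof.
have h := digitpolyU1 (monalg.mul (mpow 1.-1 4) (mpow 2.-1 2)).
rewrite -(malgU1M (mpow 1.-1 4) (mpow 2.-1 2)) -(vvX 1 4) -(vvX 2 2) in h; exact: h.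
Qed.

Lemma digit_odd p q d : (q < p)%N -> digitpoly p (q%:R * vv 1 ^+ d).
Proof.
move=> qp; have h := digitpolyU (mpow 1.-1 d) qp.
rewrite -(vvX 1 d) in h; exact: h.
Qed.

(** * The numerical cases *)

Delimit Scope Z_scope with bZ.

Fact ring_cube_ev (R : comNzRingType) (z e f k : R) : z = 0 ->
  z + e * (z + e * (z + e * (k + e * 0))) + f * 0 = k * e ^+ 3.
Proof. by move=> ->; ring. Qed.

Fact ring_two2_ev (R : comNzRingType) (z e f k l : R) : z = 0 ->
  z + e * (z + e * (z + e * (k + e * 0))) + f * (l + e * 0 + f * 0) =
  l * f + k * e ^+ 3.
Proof. by move=> ->; ring. Qed.

Fact ring_two4_ev (R : comNzRingType) (z e f k l : R) : z = 0 ->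
  z + e * (z + e * (z + e * (z + e * (z + e * (k + e * 0))))) +
    f * (z + e * (z + e * (l + e * 0)) + f * 0) =
  l * e ^+ 2 * f + k * e ^+ 5.
Proof. by move=> ->; ring. Qed.

Lemma evF_cube (V : comNzRingType) (e f : V) k :
  evF e f [:: [:: Z0; Z0; Z0; k]] = (int_of_Z k)%:~R * e ^+ 3.
Proof. exact: (@ring_cube_ev _ 0 _ _ _ erefl). Qed.

Lemma evF_two2 (V : comNzRingType) (e f : V) :
  evF e f [:: [:: Z0; Z0; Z0; 36%bZ]; [:: 18%bZ]] = 18%:R * f + 36%:R * e ^+ 3.
Proof. exact: (@ring_two2_ev _ 0 _ _ _ _ erefl). Qed.

Lemma evF_two4 (V : comNzRingType) (e f : V) :
  evF e f [:: [:: Z0; Z0; Z0; Z0; Z0; 400%bZ]; [:: Z0; Z0; 600%bZ]] =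
  600%:R * e ^+ 2 * f + 400%:R * e ^+ 5.
Proof. exact: (@ring_two4_ev _ 0 _ _ _ _ erefl). Qed.

Fact pow_odd (A : comNzRingType) (a : A) (q N c d : nat) :
  psX ^+ N * (q%:R * (psC a * psX ^+ c) ^+ d) =
  psC (q%:R * a ^+ d) * psX ^+ (c * d + N).
Proof.
rewrite rmorphM rmorphXn rmorph_nat exprMn -exprM exprD /=.
by rewrite [LHS]mulrC !mulrA.
Qed.

Fact ring_pow2 (R : comNzRingType) (a b x : R) :
  1 * ((a * x ^+ 1) ^+ 6 + (b * x ^+ 3) ^+ 2) = (a ^+ 6 + b ^+ 2) * x ^+ 6.
Proof. by ring. Qed.

Fact pow_two2 (A : comNzRingType) (a b : A) n :
  psX ^+ ((1 - 1) * n) * ((psC a * psX ^+ 1) ^+ 6 + (psC b * psX ^+ 3) ^+ 2) =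
  psC (a ^+ 6 + b ^+ 2) * psX ^+ 6.
Proof. by rewrite subnn mul0n expr0 rmorphD !rmorphXn; exact: ring_pow2. Qed.

Fact ring_pow4 (R : comNzRingType) (a b x : R) :
  1 * ((a * x ^+ 1) ^+ 4 * (b * x ^+ 3) ^+ 2) = a ^+ 4 * b ^+ 2 * x ^+ 10.
Proof. by ring. Qed.

Fact pow_two4 (A : comNzRingType) (a b : A) n :
  psX ^+ ((1 - 1) * n) * ((psC a * psX ^+ 1) ^+ 4 * (psC b * psX ^+ 3) ^+ 2) =
  psC (a ^+ 4 * b ^+ 2) * psX ^+ 10.
Proof.
have -> : psC (a ^+ 4 * b ^+ 2) = psC a ^+ 4 * psC b ^+ 2 :> ps A.
  by rewrite -!rmorphXn -rmorphM.
by rewrite subnn mul0n expr0; exact: ring_pow4.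
Qed.

Lemma int_of_Z_zpow p e : int_of_Z (zpow p e) = p%:Z ^+ e.
Proof.
elim: e => // e IH; rewrite exprS -IH.
have -> : zpow p e.+1 = Z.mul (Z.of_nat p) (zpow p e) by [].
have -> := rmorphM int_of_Z (Z.of_nat p) (zpow p e).
by congr (_ * _); exact: (Z_of_intK (Posz p)).
Qed.

Lemma evF_odd (V : comNzRingType) (e f : V) p e3 (k3 kZ : Z) :
  k3 = Z.mul (zpow p e3) kZ ->
  evF e f [:: [:: Z0; Z0; Z0; k3]] = p%:R ^+ e3 * (int_of_Z kZ)%:~R * e ^+ 3.
Proof.
move=> ->; rewrite evF_cube; congr (_ * _).
have -> : int_of_Z (Z.mul (zpow p e3) kZ) = p%:Z ^+ e3 * int_of_Z kZ.
  by rewrite -int_of_Z_zpow; exact: (rmorphM int_of_Z (zpow p e3) kZ).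
by rewrite rmorphM rmorphXn.
Qed.

Section Instance.
Variables (p : nat) (pp : prime p).
Local Notation c := p.-1.
Local Notation dv := (divBP p).
Local Notation v := (vv : nat -> BQ).
Local Notation f := (bp_frob pp).
Local Notation Phi := (frob1 pp f).
Local Notation angle := (ganglep p dv v).

Let fl x : intg f x -> frob_lift f x. Proof. exact: bp_frob_lift. Qed.

Lemma anglep_int n : inBP p (anglep p n).
Proof.
rewrite anglepE; exact: (angle_int pp (divBPE pp) (vv_int pp) (sg_vv pp) fl n).
Qed.

Lemma anglep0 : anglep p 0%N = p%:R.
Proof.
have c0 : (0 < c)%N by have := prime_gt1 pp; lia.
have e : angle = p%:R + psX ^+ c * arem p dv v.
  by apply: angle_split; first [exact: pp | exact: (divBPE pp) | exact: (vv_int pp) | exact: (sg_vv pp) | exact: fl].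
have := congr1 (fun z : ps BQ => z 0%N) e.
rewrite psD ps_nat psXnM c0 addr0 => <-; rewrite anglepE; exact: erefl.
Qed.

Variables (B wE wF cE cF M n we wf : nat) (Ac : Y).
Hypotheses (hB : (B + 4 * c <= (p ^ 4).-1)%N)
  (hwE : (wE + 2 * c <= (p ^ 2).-1)%N) (hwF : (wF + 3 * c <= (p ^ 3).-1)%N)
  (hcE : (B <= wE * cE)%N) (hcF : (B <= wF * cF)%N) (cF0 : (0 < cF)%N)
  (chk : ycheck p cE cF M Ac) (nM : (n.+1 < M)%N) (np : (n.+1 < p ^ 3)%N)
  (hwe : (c * we <= wE)%N) (hwf : (c * wf <= wF)%N)
  (B1 : (c <= B)%N) (wE1 : (c <= wE)%N) (wF1 : (c <= wF)%N).

Lemma NF_reduce k L (u : ps BQ) (a : BQ) m :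
  wtF p we wf k (addF (MCF p cE cF M n Ac) (negF L)) -> (c * k <= B)%N ->
  intg Phi u ->
  hat Phi psX angle c (c * k) (evF (epsS p dv v) (phiS p dv v) L - u) ->
  digitpoly p a -> psX ^+ ((c - 1) * n) * u = psC a * psX ^+ m ->
  (m < c * k + (c - 1) * n)%N -> NF_lowest p (MC p n) a m.
Proof.
move=> h1 h2 h3 h4 ha eu mk.
have h := MC_reduce (divBPE pp) (vv_int pp) (sg_vv pp) fl (@vv_reg p pp) hB hwE
  hwF hcE hcF cF0 chk nM np hwe hwf h1 h2 h3 h4.
have iX := X_int pp f.
have ia := angle_int pp (divBPE pp) (vv_int pp) (sg_vv pp) fl.
have iM : intg Phi (gMC p dv v n).
  rewrite -(subrK (psX ^+ ((c - 1) * n) * u) (gMC p dv v n)).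
  apply: intgD; first exact: (inI_intg iX ia h).
  by apply: intgM; [apply: intgX; exact: iX | exact: h3].
apply: (@NF_lowestI p pp).
- exact: anglep_int.
- exact: anglep0.
- rewrite MCE; exact: iM.
- exact: ha.
- rewrite MCE anglepE; have := inIW iX mk h; rewrite eu => H; exact: H.
Qed.

Let vvX_int j m : intg Phi (psC (v j) * psX ^+ m).
Proof.
apply: intgM; last by apply: intgX; exact: (X_int pp f).
by move=> i; rewrite /psC; case: (i == 0%N); [apply: vv_int | apply: (intg0 f)].
Qed.

Lemma NF_odd (k3 kZ zZ : Z) (q e3 f3 d m : nat) :
  k3 = Z.mul (zpow p e3) kZ -> (e3 + f3 = 6)%N -> (d + f3 = 3 * p.+1)%N ->
  Z.sub (if odd f3 then kZ else Z.opp kZ) (Z.of_nat q) = Z.mul (Z.of_nat p) zZ ->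
  (q < p)%N ->
  wtF p we wf d.+1 (addF (MCF p cE cF M n Ac)
    (negF [:: [:: Z0; Z0; Z0; k3]])) ->
  (c * d.+1 <= B)%N -> m = (c * d + (c - 1) * n)%N ->
  NF_lowest p (MC p n) (q%:R * vv 1 ^+ d) m.
Proof.
move=> e3E h6 hd hk qp hw dB mE.
have ofn j : int_of_Z (Z.of_nat j) = j%:Z by exact: (Z_of_intK (Posz j)).
have eM : int_of_Z (Z.mul (Z.of_nat p) zZ) = p%:Z * int_of_Z zZ.
  by rewrite -(ofn p); exact: (rmorphM int_of_Z (Z.of_nat p) zZ).
have eB a : int_of_Z (Z.sub a (Z.of_nat q)) = int_of_Z a - q%:Z.
  by rewrite -(ofn q); exact: (rmorphB int_of_Z a (Z.of_nat q)).
have eN : int_of_Z (Z.opp kZ) = - int_of_Z kZ by exact: (rmorphN int_of_Z kZ).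
have hkI : - int_of_Z kZ * (-1) ^+ f3 - q%:Z = p%:Z * int_of_Z zZ.
  have := congr1 int_of_Z hk; rewrite eM eB => <-.
  congr (_ - _); rewrite -signr_odd; case: (odd f3).
    by rewrite expr1 mulrN1 opprK.
  by rewrite eN expr0 mulr1.
have hfin := final_odd pp (divBPE pp) (vv_int pp) (sg_vv pp) fl (@vv_reg p pp) hB
  hwE hwF hcE hcF cF0 chk nM np hwe hwf B1 wE1 wF1 h6 hd hkI.
apply: (NF_reduce hw dB (u := q%:R * u1 p v ^+ d)).
- apply: intgM; first exact: (intg_nat Phi q).
  apply: intgX; exact: (vvX_int 1 p.-1).
- rewrite (evF_odd _ _ e3E); exact: hfin.
- exact: digit_odd.
- rewrite /u1 mE; exact: (pow_odd (vv 1 : BQ) q).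
- by have := prime_gt1 pp; rewrite mE; nia.
Qed.

Section Two.
Hypotheses (p2 : p = 2%N) (B2 : (1 < B)%N).

Let c1 : c = 1%N. Proof. by rewrite p2. Qed.
Let E2 : (p ^ 2).-1 = 3%N. Proof. by rewrite p2. Qed.

Lemma NF_two2 :
  wtF p we wf 7 (addF (MCF p cE cF M n Ac)
    (negF [:: [:: Z0; Z0; Z0; 36%bZ]; [:: 18%bZ]])) -> (7 <= B)%N ->
  NF_lowest p (MC p n) (vv 1 ^+ 6 + vv 2 ^+ 2) 6.
Proof.
move=> hw dB.
have hfin := final_two2 pp (divBPE pp) (vv_int pp) (sg_vv pp) fl (@vv_reg p pp) hB
  hwE hwF hcE hcF cF0 chk nM np hwe hwf B1 wE1 wF1 p2 B2.
have k7 : (c * 7 = 7)%N by rewrite c1.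
apply: (NF_reduce hw (u := u1 p v ^+ 6 + u2 p v ^+ 2)).
- by rewrite k7.
- apply: intgD; apply: intgX; [exact: (vvX_int 1 p.-1) | exact: (vvX_int 2 (p ^ 2).-1)].
- rewrite k7.
  rewrite evF_two2.
  exact: hfin.
- rewrite p2; exact: digit_two2.
- rewrite /u1 /u2 c1 E2; exact: (pow_two2 (vv 1 : BQ) (vv 2 : BQ)).
- by rewrite c1.
Qed.

Lemma NF_two4 :
  wtF p we wf 11 (addF (MCF p cE cF M n Ac)
    (negF [:: [:: Z0; Z0; Z0; Z0; Z0; 400%bZ]; [:: Z0; Z0; 600%bZ]])) -> (11 <= B)%N ->
  NF_lowest p (MC p n) (vv 1 ^+ 4 * vv 2 ^+ 2) 10.
Proof.
move=> hw dB.
have hfin := final_two4 pp (divBPE pp) (vv_int pp) (sg_vv pp) fl (@vv_reg p pp) hB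
  hwE hwF hcE hcF cF0 chk nM np hwe hwf B1 wE1 wF1 p2 B2.
have k11 : (c * 11 = 11)%N by rewrite c1.
apply: (NF_reduce hw (u := u1 p v ^+ 4 * u2 p v ^+ 2)).
- by rewrite k11.
- apply: intgM; apply: intgX; [exact: (vvX_int 1 p.-1) | exact: (vvX_int 2 (p ^ 2).-1)].
- rewrite k11.
  rewrite evF_two4.
  exact: hfin.
- rewrite p2; exact: digit_two4.
- rewrite /u1 /u2 c1 E2; exact: (pow_two4 (vv 1 : BQ) (vv 2 : BQ)).
- by rewrite c1.
Qed.
End Two.
End Instance.

Lemma ycheck2 : ycheck 2 11 3 6 (ysolve 2 11 3 6).
Proof. by vm_compute. Qed.

Lemma case2_2 : NF_lowest 2 (MC 2 2) (vv 1 ^+ 6 + vv 2 ^+ 2) 6.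
Proof.
apply: (@NF_two2 2 isT 11 1 4 11 3 6 2 1 4 _ _ _ _ _ _ _ ycheck2); vm_compute; reflexivity.
Qed.

Lemma case2_4 : NF_lowest 2 (MC 2 4) (vv 1 ^+ 4 * vv 2 ^+ 2) 10.
Proof.
apply: (@NF_two4 2 isT 11 1 4 11 3 6 4 1 4 _ _ _ _ _ _ _ ycheck2); vm_compute; reflexivity.
Qed.

Lemma ycheck3 : ycheck 3 5 1 6 (ysolve 3 5 1 6).
Proof. by vm_compute. Qed.

Lemma case3 : NF_lowest 3 (MC 3 4) (2%:R * vv 1 ^+ 9) 22.
Proof.
apply: (@NF_odd 3 isT 20 4 20 5 1 6 4 2 10 _ _ _ _ _ _ _ ycheck3
  _ _ _ _ _ _ _ 1350%bZ 50%bZ 16%bZ 2 3 3); vm_compute; reflexivity.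
Qed.

Lemma ycheck5 : ycheck 5 5 1 10 (ysolve 5 5 1 10).
Proof. by vm_compute. Qed.

Lemma case5 : NF_lowest 5 (MC 5 8) (3%:R * vv 1 ^+ 16) 88.
Proof.
apply: (@NF_odd 5 isT 80 16 112 5 1 10 8 4 28 _ _ _ _ _ _ _ ycheck5
  _ _ _ _ _ _ _ 354375%bZ 567%bZ (-114)%bZ 3 4 2); vm_compute; reflexivity.
Qed.

Lemma ycheck7 : ycheck 7 5 1 14 (ysolve 7 5 1 14).
Proof. by vm_compute. Qed.

Lemma case7 : NF_lowest 7 (MC 7 12) (4%:R * vv 1 ^+ 22) 192.
Proof.
apply: (@NF_odd 7 isT 180 36 324 5 1 14 12 6 54 _ _ _ _ _ _ _ ycheck7
  _ _ _ _ _ _ _ 43823052%bZ 18252%bZ (-2608)%bZ 4 4 2); vm_compute; reflexivity.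
Qed.

Lemma ycheck11 : ycheck 11 5 1 22 (ysolve 11 5 1 22).
Proof. by vm_compute. Qed.

Lemma case11 : NF_lowest 11 (MC 11 20) (9%:R * vv 1 ^+ 34) 520.
Proof.
apply: (@NF_odd 11 isT 500 100 1300 5 1 22 20 10 130 _ _ _ _ _ _ _ ycheck11
  _ _ _ _ _ _ _ 311237850924%bZ 21257964%bZ (-1932543)%bZ 9 4 2); vm_compute; reflexivity.
Qed.

Lemma ycheck13 : ycheck 13 5 1 26 (ysolve 13 5 1 26).
Proof. by vm_compute. Qed.

Lemma case13 : NF_lowest 13 (MC 13 24) (11%:R * vv 1 ^+ 40) 744.
Proof.
apply: (@NF_odd 13 isT 720 144 2160 5 1 26 24 12 180 _ _ _ _ _ _ _ ycheck13
  _ _ _ _ _ _ _ 21955983140000%bZ 768740000%bZ (-59133847)%bZ 11 4 2); vm_compute; reflexivity.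
Qed.

Theorem theorem2p4 :
  (NF_lowest 2 (MC 2 2) (vv 1 ^+ 6 + vv 2 ^+ 2) 6 /\
   NF_lowest 2 (MC 2 4) (vv 1 ^+ 4 * vv 2 ^+ 2) 10) /\
  NF_lowest 3 (MC 3 4) (2%:R * vv 1 ^+ 9) 22 /\
  NF_lowest 5 (MC 5 8) (3%:R * vv 1 ^+ 16) 88 /\
  NF_lowest 7 (MC 7 12) (4%:R * vv 1 ^+ 22) 192 /\
  NF_lowest 11 (MC 11 20) (9%:R * vv 1 ^+ 34) 520 /\
  NF_lowest 13 (MC 13 24) (11%:R * vv 1 ^+ 40) 744.
Proof.
exact: (conj (conj case2_2 case2_4)
  (conj case3 (conj case5 (conj case7 (conj case11 case13))))).
Qed.
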